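(* Let $1\le p<\infty$. Suppose that the cost function $\beta$ is $\epsilon$-tame with $\epsilon<1/p$. Then $S_n^{\mathrm Q}/n$ converges in $L^p$ to $S$ as $n\to\infty$.
   Context: Fix $\alpha\in[0,1]$, a sequence of integers $(m_n)_{n\ge1}$ with $1\le m_n\le n$ and $m_n/n\to\alpha$, and a symmetric measurable cost function $\beta:(0,1)\times(0,1)\to[0,\infty)$ ($\beta(u,t)$ is the cost of comparing two keys with seeds $u\neq t$; values on the diagonal are irrelevant). For $0<\epsilon<\infty$, $\beta$ is called $\epsilon$-tame if there is a constant $0<c<\infty$ such that $\beta(u,t)\le c\,(t-u)^{-\epsilon}$ for all $0<u<t<1$. Let $U_1,U_2,\dots$ be i.i.d. uniform$(0,1)$ random variables (the seeds), all on one probability space. Definition of $S$. Put $L_0:=0$, $R_0:=1$ and, inductively for $k\ge 1$, $$\tau_k:=\inf\{i:\ L_{k-1}<U_i<R_{k-1}\},$$ $$L_k:=\mathbf 1(U_{\tau_k}<\alpha)\,U_{\tau_k}+\mathbf 1(U_{\tau_k}>\alpha)\,L_{k-1},\qquad R_k:=\mathbf 1(U_{\tau_k}<\alpha)\,R_{k-1}+\mathbf 1(U_{\tau_k}>\alpha)\,U_{\tau_k},$$ $$I_k:=\int_{L_{k-1}}^{R_{k-1}}\beta(u,U_{\tau_k})\,du,\qquad S:=\sum_{k\ge1}I_k .$$ Definition of $S_n^{\mathrm Q}$. Fix $n\ge 1$. Put $L_0(n):=0$, $R_0(n):=1$ and, inductively for $k\ge1$, $$\tau_k(n):=\inf\{i\le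 n:\ L_{k-1}(n)<U_i<R_{k-1}(n)\}\qquad(\inf\emptyset=\infty).$$ If $\tau_k(n)<\infty$, let $\mathrm{pivrank}_k(n)$ be the rank of $U_{\tau_k(n)}$ among $U_1,\dots,U_n$ (rank 1 being the smallest) and set $$L_k(n):=\mathbf 1(\mathrm{pivrank}_k(n)\le m_n)\,U_{\tau_k(n)}+\mathbf 1(\mathrm{pivrank}_k(n)>m_n)\,L_{k-1}(n),$$ $$R_k(n):=\mathbf 1(\mathrm{pivrank}_k(n)\ge m_n)\,U_{\tau_k(n)}+\mathbf 1(\mathrm{pivrank}_k(n)<m_n)\,R_{k-1}(n);$$ if $\tau_k(n)=\infty$, set $(L_k(n),R_k(n)):=(L_{k-1}(n),R_{k-1}(n))$. Let $$S_{n,k}^{\mathrm Q}:=\sum_{i:\ \tau_k(n)<i\le n}\mathbf 1(L_{k-1}(n)<U_i<R_{k-1}(n))\,\beta(U_i,U_{\tau_k(n)})$$ (an empty sum, equal to $0$, when $\tau_k(n)=\infty$) and $S_n^{\mathrm Q}:=\sum_{k\ge1}S_{n,k}^{\mathrm Q}$. ($S_n^{\mathrm Q}$ has the distribution of the total cost of QuickSelect for finding the key of rank $m_n$ among $n$ keys, i.e. of QuickQuant$(n,\alpha)$.) *)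

(* Defs.v *)
From HB Require Import structures.
From mathcomp Require Import all_boot all_order all_algebra finmap.
From mathcomp Require Import all_classical all_reals all_analysis.
From mathcomp Require Import measurable_realfun.

Set Implicit Arguments.
Unset Strict Implicit.
Unset Printing Implicit Defensive.

Import Order.TTheory GRing.Theory Num.Theory.
Import numFieldNormedType.Exports.

Local Open Scope classical_set_scope.
Local Open Scope ring_scope.

Section Probability.
Context {d : measure_display} {T : measurableType d} {R : realType}.
Variable P : probability T R.

Definition mutually_independent (X : nat -> {RV P >-> R}) : Prop :=
  forall (J : {fset nat}) (A : nat -> set R),
    (forall i, measurable (A i)) ->
    P (\bigcap_(i in [set` J]) (X i @^-1` A i)) =
    (\prod_(i <- J) P (X i @^-1` A i))%E.

Definition uniform01 (X : {RV P >-> R}) : Prop :=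
  forall A : set R, measurable A ->
    distribution P X A = uniform_prob (@ltr01 R) A.

Definition in_Lp (p : R) (X : T -> \bar R) : Prop :=
  measurable_fun [set: T] X /\ ('N[P]_(p%:E)[X] < +oo)%E.

(* Functions are extended real-valued, since S_limit below is a countable sum
   of integrals.  Measurability has to be required because Lnorm is also
   defined on non-measurable functions. *)
Definition cvg_in_Lp (p : R) (X : nat -> T -> \bar R) (Y : T -> \bar R)
    : Prop :=
  [/\ forall n, in_Lp p (X n), in_Lp p Y &
      ('N[P]_(p%:E)[(fun w => X n w - Y w)])%E @[n --> \oo] --> 0%E].

End Probability.

Section Cost.
Context {R : realType}.

(* Only the values of beta on ]0, 1[ x ]0, 1[ matter. *)
Definition cost_function (beta : R -> R -> R) : Prop :=
  [/\ measurable_fun ((`]0, 1[ : set R) `*` (`]0, 1[ : set R))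
        (fun x : R * R => beta x.1 x.2),
      (forall u t : R, 0 < u < 1 -> 0 < t < 1 -> 0 <= beta u t) &
      (forall u t : R, 0 < u < 1 -> 0 < t < 1 -> beta u t = beta t u)].

Definition tame (eps : R) (beta : R -> R -> R) : Prop :=
  exists2 c : R, 0 < c &
    forall u t : R, 0 < u -> u < t -> t < 1 -> beta u t <= c * (t - u) `^ (- eps).

End Cost.

(* Infimum of a set of indices; None stands for inf(empty set) = +oo. *)
Definition first_index (Q : pred nat) : option nat :=
  if pselect (exists i, Q i) is left ex then Some (ex_minn ex) else None.

(* The constructions below are made for one realisation u of the seeds.
   Seeds are numbered from 0: u i is the seed U_(i+1) and the first n seeds
   are u 0, ..., u (n - 1). *)
Section Limit.
Context {R : realType}.
Variables (alpha : R) (beta : R -> R -> R) (u : nat -> R).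

Definition tau_of (LR : R * R) : option nat :=
  first_index (fun i => LR.1 < u i < LR.2).

(* For i.i.d. uniform seeds, every tau_k is almost surely finite; on the
   exceptional event, (L_k, R_k) = (L_(k-1), R_(k-1)) and I_k = 0. *)
Fixpoint LR (k : nat) : R * R :=
  if k is j.+1 then
    if tau_of (LR j) is Some t then
      ((u t < alpha)%R%:R * u t + (alpha < u t)%R%:R * (LR j).1,
       (u t < alpha)%R%:R * (LR j).2 + (alpha < u t)%R%:R * u t)
    else LR j
  else (0, 1).

Definition tau (k : nat) : option nat := tau_of (LR k.-1).

Definition I_term (k : nat) : \bar R :=
  if tau k is Some t then
    (\int[lebesgue_measure]_(x in `](LR k.-1).1, (LR k.-1).2[)
       (beta x (u t))%:E)%E
  else 0%E.

Definition S_limit : \bar R := (\sum_(1 <= k <oo) I_term k)%E.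

End Limit.

Section QuickQuant.
Context {R : realType}.
(* m is the target rank m_n *)
Variables (beta : R -> R -> R) (n m : nat) (u : nat -> R).

Definition tauQ_of (LR : R * R) : option nat :=
  first_index (fun i => (i < n)%N && (LR.1 < u i < LR.2)).

(* For pairwise distinct seeds (hence almost surely), this is the rank of u t
   among the first n seeds, 1 being the smallest. *)
Definition seed_rank (t : nat) : nat := #|[pred i : 'I_n | u i <= u t]|.

Fixpoint LRQ (k : nat) : R * R :=
  if k is j.+1 then
    if tauQ_of (LRQ j) is Some t then
      ((seed_rank t <= m)%N%:R * u t + (m < seed_rank t)%N%:R * (LRQ j).1,
       (m <= seed_rank t)%N%:R * u t + (seed_rank t < m)%N%:R * (LRQ j).2)
    else LRQ j
  else (0, 1).

Definition tauQ (k : nat) : option nat := tauQ_of (LRQ k.-1).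

Definition SQ_term (k : nat) : R :=
  if tauQ k is Some t then
    \sum_(t.+1 <= i < n | (LRQ k.-1).1 < u i < (LRQ k.-1).2) beta (u i) (u t)
  else 0.

Definition SQ : \bar R := (\sum_(1 <= k <oo) (SQ_term k)%:E)%E.

End QuickQuant.

(* Main.v *)
(** Index the pivots by the time [t] at which their seed is drawn rather than
    by their order. Almost surely, [S_n / n] is then the sum over [t] of the
    contributions [a n t] of the seeds that fall into the search interval of
    their time, and [S] is likewise a sum of contributions [s t].

    For fixed [t], outside an event of vanishing probability the ranks of the
    first [t] seeds compare with [m n] as the seeds themselves compare with
    [alpha], and the law of large numbers, applied to [beta] cut off near the
    diagonal, gives [a n t --> s t] in L^p.

    Uniformly in [n], let [lam] be slightly larger than [1 / t]. Except with
    exponentially small probability, the search interval at time [t] lies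
    within [lam] of the [t]-th seed and contains [O(n lam)] seeds. The target
    must then be close to that seed, which has probability [O(lam)] given the
    other seeds, so Jensen's inequality bounds the [p]-th moment of [a n t] by
    [O(lam ^ (p - 1) * lam ^ (1 - eps p) * lam)]. As [p + 1 - eps p > p], these
    bounds are summable, even against weights that turn the [p]-th power of a
    series into a series of [p]-th powers, and dominated convergence for series
    concludes. *)
Require Import Defs.
From HB Require Import structures.
From mathcomp Require Import all_boot all_order all_algebra finmap.
From mathcomp Require Import all_classical all_reals all_analysis.
From mathcomp Require Import measurable_realfun.
From mathcomp Require Import lra ring.

Import Order.TTheory GRing.Theory Num.Theory.
Import numFieldNormedType.Exports.

Local Open Scope classical_set_scope.
Local Open Scope ring_scope.

Set Implicit Arguments.
Unset Strict Implicit.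
Unset Printing Implicit Defensive.

(** * Sequences of seeds and resampling of one seed *)

(** Conditioning is replaced by resampling: the law of an i.i.d. sequence does not change when one
    seed is overwritten by a fresh draw, so a conditional expectation given the other seeds becomes
    an inner integral over that draw. This dictates the shape of the events in the moment estimate.
    The cost of comparing the seeds [i] and [t] is unbounded, so seed [i] has to be integrated out
    against the kernel and seed [t] against the event, which must not see seed [i] and may see seed
    [t] only as an explicit argument. The counts therefore omit both seeds, at the price of an error
    of at most 2 in the ranks.

    Resampling needs contributions that are fixed functions of the seeds, whereas the search
    interval comes from a recursion with random indices. A closed form removes this obstacle: a
    point of the unit interval lies in the search interval at time [t] exactly when every earlier
    seed, pivot or not, leaves it on the side of the target. In that form the finite sample and the
    limit differ only in the verdicts attached to the seeds, and their intervals coincide as soon as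
    these verdicts agree on the first [t] seeds. *)

Section seeds.
Context {R : realType}.

(** Boxes over an initial segment of indices suffice: they are closed under intersection and
    generate the product sigma-algebra, so a law on sequences is determined by its values on
    them. *)
Definition boxes : set (set (nat -> R)) :=
  [set S | exists n (A : nat -> set R), (forall i, measurable (A i)) /\
     S = [set u | forall i, (i < n)%N -> A i (u i)]].

Definition seeds := g_sigma_algebraType boxes.

Lemma setI_closed_boxes : setI_closed boxes.
Proof.
move=> _ _ [n [A [mA ->]]] [m [B [mB ->]]].
exists (maxn n m), (fun i => (if (i < n)%N then A i else setT) `&`
  (if (i < m)%N then B i else setT)); split.
  by move=> i; apply: measurableI; case: ifP.
apply/seteqP; split=> u /=.
  move=> [Au Bu] i _; split; case: ifP => //.
    exact: Au.
  exact: Bu.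
move=> ABu; split=> i ilt.
  have [] := ABu i _; first by rewrite leq_max ilt.
  by rewrite ilt.
have [] := ABu i _; first by rewrite leq_max ilt orbT.
by rewrite ilt.
Qed.

Lemma measurable_box n (A : nat -> set R) : (forall i, measurable (A i)) ->
  measurable ([set u | forall i, (i < n)%N -> A i (u i)] : set seeds).
Proof. by move=> mA; apply: sub_sigma_algebra; exists n, A. Qed.

Lemma measurable_seed i : measurable_fun setT (fun u : seeds => u i).
Proof.
move=> _ B mB; rewrite setTI.
have -> : (fun u : seeds => u i) @^-1` B =
    [set u | forall j, (j < i.+1)%N -> (if j == i then B else setT) (u j)].
  apply/seteqP; split=> u /=; first by move=> Bu j _; case: eqP => // ->.
  by move=> /(_ i (ltnSn i)); rewrite eqxx.
by apply: (@measurable_box _ (fun j => if j == i then B else setT)) => j; case: ifP.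
Qed.

Lemma measurable_seedsP d (X : measurableType d) (g : X -> seeds) :
  (forall i, measurable_fun setT (fun x => g x i)) -> measurable_fun setT g.
Proof.
move=> mg; apply: (@measurability _ _ _ seeds setT g boxes erefl).
move=> _ [_ [n [A [mA ->]] <-]]; rewrite setTI.
have -> : g @^-1` [set u | forall i, (i < n)%N -> A i (u i)] =
    \bigcap_i ((fun x => g x i) @^-1` (if (i < n)%N then A i else setT)).
  apply/seteqP; split=> u /= H i; first by move=> _; case: ifP => // /H.
  by move=> ilt; have := H i I; rewrite /= ilt.
apply: bigcapT_measurable => i; rewrite -[X in measurable X]setTI.
by apply: mg => //; case: ifP.
Qed.

Definition upd (u : seeds) (i : nat) (x : R) : seeds :=
  fun j => if j == i then x else u j.

Lemma updE u i x : upd u i x i = x.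
Proof. by rewrite /upd eqxx. Qed.

Lemma updN u i x j : j != i -> upd u i x j = u j.
Proof. by rewrite /upd => /negbTE ->. Qed.

Lemma measurable_upd d (X : measurableType d) (f : X -> seeds) (g : X -> R) i :
  measurable_fun setT f -> measurable_fun setT g ->
  measurable_fun setT (fun z => upd (f z) i (g z)).
Proof.
move=> mf mg; apply: measurable_seedsP => j; rewrite /upd.
case: eqP => // _; exact: (measurableT_comp (measurable_seed j) mf).
Qed.

Definition iid (nu : probability R R) (mu : probability seeds R) :=
  forall n (A : nat -> set R), (forall i, measurable (A i)) ->
  mu [set u | forall i, (i < n)%N -> A i (u i)] = (\prod_(i < n) nu (A i))%E.

Section resampling.
Variables (nu : probability R R) (mu : probability seeds R).
Hypothesis iid_mu : iid nu mu.
Local Open Scope ereal_scope.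

Let phi i (z : R * seeds) := upd z.2 i z.1.

Let mphi i : measurable_fun setT (phi i).
Proof. exact: measurable_upd. Qed.

(** Both sides are measures that agree on boxes: the constraint on coordinate [i] falls on the fresh
    draw, which has the same law [nu] and is independent of the rest. *)
Lemma resample_measure i (S : set seeds) : measurable S ->
  mu S = pushforward (nu \x mu)%E (phi i) S.
Proof.
move=> mS.
pose rho := @measure_function_pushforward__canonical__measure_function_Measure
  _ _ _ _ R (nu \x mu) (phi i) (mphi i).
apply: (@measure_unique _ R seeds boxes (fun=> setT) erefl setI_closed_boxes
    _ _ mu rho _ _ S mS).
- move=> _; exists 0%N, (fun=> setT); split=> //.
  by apply/seteqP; split.
- by rewrite bigcup_const//; exists 0%N.
- move=> _ [n [A [mA ->]]] /=; rewrite iid_mu//.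
  rewrite /pushforward.
  pose A' j := if j == i then setT else A j.
  pose B := if (i < n)%N then A i else setT.
  have mB : measurable B by rewrite /B; case: ifP.
  have mA' j : measurable (A' j) by rewrite /A'; case: ifP.
  have -> : phi i @^-1` [set u | forall j, (j < n)%N -> A j (u j)] =
     B `*` [set u | forall j, (j < n)%N -> A' j (u j)].
    apply/seteqP; split=> -[x u] /=.
      move=> H; split.
        by rewrite /B; case: ifP => // /H; rewrite /phi updE.
      by move=> j /H; rewrite /A' /phi /upd; case: eqP.
    move=> [Bx H] j jn; rewrite /phi /upd/=; case: eqP => [ji|/eqP ji].
      by move: Bx; rewrite /B -ji jn.
    by have := H j jn; rewrite /A' (negbTE ji).
  rewrite product_measure1E//; last exact: measurable_box.
  transitivity (nu B * \prod_(j < n) nu (A' j)); last first.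
    by congr *%E; exact/esym/iid_mu.
  have [ilt|ige] := ltnP i n.
    rewrite (bigD1 (Ordinal ilt))//= [X in _ = _ * X](bigD1 (Ordinal ilt))//=.
    rewrite /B /A' ilt eqxx probability_setT mul1e; congr *%E.
    by apply: eq_bigr => j; rewrite -val_eqE /= => /negbTE ->.
  rewrite /B ltnNge ige/= probability_setT mul1e; apply: eq_bigr => j _.
  by rewrite /A' ltn_eqF// (leq_trans _ ige).
- by move=> _ /=; apply: le_lt_trans (probability_le1 mu measurableT) _; rewrite ltry.
Qed.

Lemma integral_resample i (h : seeds -> \bar R) :
  measurable_fun setT h -> (forall u, 0 <= h u) ->
  \int[mu]_u h u = \int[nu]_x \int[mu]_u h (upd u i x).
Proof.
move=> mh h0.
pose rho := @measure_function_pushforward__canonical__measure_function_Measure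
  _ _ _ _ R (nu \x mu) (phi i) (mphi i).
transitivity (\int[rho]_u h u).
  by apply: eq_measure_integral => S mS _; exact: resample_measure.
rewrite ge0_integral_pushforward// preimage_setT.
rewrite fubini_tonelli1//; [exact: (measurableT_comp mh (mphi i))|by move=> z /=].
Qed.

Lemma measurable_resample_pair i (h : seeds -> \bar R) :
  measurable_fun setT h ->
  measurable_fun setT (fun z : R * seeds => h (upd z.2 i z.1)).
Proof. by move=> mh; exact: (measurableT_comp mh (mphi i)). Qed.

(** The inner integral over the draw plays the role of the conditional expectation given the other
    seeds. *)
Lemma integral_resampleC i (h : seeds -> \bar R) :
  measurable_fun setT h -> (forall u, 0 <= h u) ->
  \int[mu]_u h u = \int[mu]_u \int[nu]_x h (upd u i x).
Proof.
move=> mh h0; rewrite (integral_resample i)//.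
apply: (fubini_tonelli (fun z : R * seeds => h (upd z.2 i z.1))) => //.
exact: measurable_resample_pair.
Qed.

End resampling.
End seeds.
Arguments seeds R : clear implicits.

(** * Integration, and the uniform law *)

Section general.
Local Open Scope ereal_scope.

(* Monotonicity of the integral of nonnegative functions needs no
   measurability, the integral being a supremum over simple functions. *)
Lemma le_int d (T : measurableType d) (R : realType)
    (mu : {measure set T -> \bar R}) (f g : T -> \bar R) :
  (forall x, 0 <= f x) -> (forall x, f x <= g x) ->
  \int[mu]_x f x <= \int[mu]_x g x.
Proof.
move=> f0 fg; have g0 x : 0 <= g x := le_trans (f0 x) (fg x).
rewrite !ge0_integralTE//; apply: le_ereal_sup => _ [h hf <-].
by exists h => // x; exact: le_trans (hf x) (fg x).
Qed.

Lemma int_cst_le d (T : measurableType d) (R : realType)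
    (mu : probability T R) (f : T -> \bar R) (c : R) :
  (forall x, 0 <= f x) -> (forall x, f x <= c%:E) -> \int[mu]_x f x <= c%:E.
Proof.
move=> f0 fc; apply: le_trans (le_int mu f0 fc) _.
by rewrite integral_cst// [X in _ * X]probability_setT mule1.
Qed.

Lemma int_natr_bool d (T : measurableType d) (R : realType)
    (mu : {measure set T -> \bar R}) (f : T -> bool) :
  measurable_fun setT f ->
  \int[mu]_x ((f x)%:R : R)%:E = mu [set x | f x].
Proof.
move=> mf.
have mS : measurable [set x | f x].
  by rewrite -[X in measurable X]setTI; exact: (mf measurableT [set true]).
rewrite -[in RHS](setIT [set x | f x]) -(integral_indic mu measurableT mS).
apply: eq_integral => x _; rewrite indicE; congr (_%:R)%:E.
by apply/esym; case: (boolP (f x)) => fx; [rewrite mem_set|rewrite memNset//; apply/negP].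
Qed.

Lemma measurable_fun_natr_bool d (T : measurableType d) (R : realType) (f : T -> bool) :
  measurable_fun setT f -> measurable_fun setT (fun x => (f x)%:R : R).
Proof.
move=> mf; rewrite (_ : (fun _ => _) = fun x => if f x then 1%R else 0%R); last first.
  by apply/funext => x; case: (f x).
exact: measurable_fun_ifT.
Qed.

Lemma integral_EFinZl d (T : measurableType d) (R : realType)
    (mu : {measure set T -> \bar R}) (k : R) (f : T -> R) :
  measurable_fun setT f -> (forall x, 0 <= f x)%R -> (0 <= k)%R ->
  \int[mu]_x (k * f x)%:E = k%:E * \int[mu]_x (f x)%:E.
Proof.
move=> mf f0 k0; under eq_integral do rewrite EFinM.
by rewrite ge0_integralZl//; [exact/measurable_EFinP|move=> x _; rewrite lee_fin].
Qed.

Lemma integral_EFinD d (T : measurableType d) (R : realType)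
    (mu : {measure set T -> \bar R}) (f g : T -> R) :
  measurable_fun setT f -> measurable_fun setT g ->
  (forall x, 0 <= f x)%R -> (forall x, 0 <= g x)%R ->
  \int[mu]_x (f x + g x)%:E = \int[mu]_x (f x)%:E + \int[mu]_x (g x)%:E.
Proof.
move=> mf mg f0 g0; under eq_integral do rewrite EFinD.
rewrite ge0_integralD//; try exact/measurable_EFinP.
- by move=> x _; rewrite lee_fin.
- by move=> x _; rewrite lee_fin.
Qed.

Lemma integral_EFin_sum d (T : measurableType d) (R : realType)
    (mu : {measure set T -> \bar R}) (I : Type) (r : seq I) (Q : pred I)
    (f : I -> T -> R) :
  (forall i, measurable_fun setT (f i)) -> (forall i x, 0 <= f i x)%R ->
  \int[mu]_x (\sum_(i <- r | Q i) f i x)%:E =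
  \sum_(i <- r | Q i) \int[mu]_x (f i x)%:E.
Proof.
move=> mf f0; under eq_integral do rewrite -sumEFin -big_filter.
rewrite ge0_integral_sum ?big_filter//; last by move=> i x _; rewrite lee_fin.
by move=> i; exact/measurable_EFinP.
Qed.

Lemma integral_affine d (T : measurableType d) (R : realType)
    (mu : probability T R) (w a b : R) (f g : T -> R) :
  measurable_fun setT f -> measurable_fun setT g ->
  (forall x, 0 <= f x)%R -> (forall x, 0 <= g x)%R ->
  (0 <= w)%R -> (0 <= a)%R -> (0 <= b)%R ->
  \int[mu]_x (w + (a * f x + b * g x))%:E =
  w%:E + (a%:E * \int[mu]_x (f x)%:E + b%:E * \int[mu]_x (g x)%:E).
Proof.
move=> mf mg f0 g0 w0 a0 b0.
have maf : measurable_fun setT (fun x => a * f x)%R by exact: measurable_funM.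
have mbg : measurable_fun setT (fun x => b * g x)%R by exact: measurable_funM.
have af0 x : (0 <= a * f x)%R by rewrite mulr_ge0.
have bg0 x : (0 <= b * g x)%R by rewrite mulr_ge0.
rewrite integral_EFinD//; [|exact: measurable_funD|by move=> x; rewrite addr_ge0].
rewrite integral_EFinD// !integral_EFinZl//.
by congr (_ + _); rewrite integral_cst// [X in _ * X]probability_setT mule1.
Qed.

End general.

(* [uniform_prob] lives on [measurableTypeR R], which carries another
   measure display than [R]. *)
Definition to_R (R : realType) : measurableTypeR R -> R := idfun.

HB.instance Definition _ (R : realType) :=
  @isMeasurableFun.Build _ _ _ R (@to_R R) (@measurable_id _ _ setT).

Definition unif (R : realType) : probability R R :=
  distribution (uniform_prob (@ltr01 R)) (@to_R R).

Section uniform.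
Context {R : realType}.
Local Open Scope ereal_scope.
Local Notation nu := (unif R).

Lemma integral_unif (f : R -> \bar R) : measurable_fun setT f ->
  (forall x, 0 <= f x) ->
  \int[nu]_x f x = \int[lebesgue_measure]_(x in `[0%R, 1%R]) f x.
Proof.
move=> mf f0; rewrite ge0_integral_pushforward// preimage_setT.
by rewrite [LHS](integral_uniform (@ltr01 R))// subr0 invr1 mul1e.
Qed.

Lemma unifE (A : set R) : measurable A ->
  nu A = lebesgue_measure (A `&` `[0%R, 1%R]).
Proof.
move=> mA; rewrite -[in LHS](setIT A) -(integral_indic nu measurableT mA).
rewrite integral_unif//; last by exact/measurable_EFinP/measurable_indic.
by rewrite integral_indic.
Qed.

Lemma unif_le (A : set R) (a b : R) : measurable A -> (a <= b)%R ->
  A `&` `[0%R, 1%R] `<=` `[a, b] -> nu A <= (b - a)%:E.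
Proof.
move=> mA ab Aab; rewrite unifE//.
apply: (@le_trans _ _ (lebesgue_measure (`[a, b]%classic : set R))).
  by apply: le_measure; rewrite ?inE//=; exact: measurableI.
by rewrite lebesgue_measure_itv/=; case: ifP => // _; rewrite lee_fin subr_ge0.
Qed.

Lemma unif_oo (a b : R) : (0 <= a)%R -> (a <= b)%R -> (b <= 1)%R ->
  nu `]a, b[%classic = (b - a)%:E.
Proof.
move=> a0 ab b1; rewrite unifE// (_ : _ `&` _ = `]a, b[%classic).
  rewrite lebesgue_measure_itv/= lte_fin; case: ifPn => // /negbTE ba.
  have -> : a = b by apply/eqP; rewrite eq_le ab leNgt ba.
  by rewrite subrr.
apply/seteqP; split=> x /=; first by case.
rewrite !in_itv/= => /andP[ax xb]; split; rewrite ?ax//.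
by rewrite (le_trans a0 (ltW ax)) (le_trans (ltW xb) b1).
Qed.

Lemma integral_unif_outside (a b : R) : (0 <= a)%R -> (a <= b)%R -> (b <= 1)%R ->
  \int[nu]_x ((~~ (a < x < b)%R)%:R : R)%:E = (1 - (b - a))%:E.
Proof.
move=> a0 ab b1; rewrite int_natr_bool; last first.
  apply: measurable_neg; apply: measurable_and; exact: measurable_fun_ltr.
rewrite EFinB -unif_oo// -(@probability_setC _ _ _ nu)//.
by congr (nu _); apply/seteqP; split=> x /=; rewrite in_itv/= => /negP.
Qed.

Lemma unif_set1 (a : R) : nu [set a] = 0.
Proof.
apply/eqP; rewrite eq_le measure_ge0 andbT -[leRHS]/(0%:E) -(subrr a).
by apply: unif_le => // x [-> _]; rewrite /= in_itv/= lexx.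
Qed.

(** Sum of a dyadic series: the ball of radius [rk k] has mass at most [2 * rk k], bounding the
    singularity at the inner radius [rk k / 2] of its shell costs 2 to the power [s], and successive
    shells have ratio 2 to the power [s - 1]. *)
Definition sing_const (s : R) : R := (2 * 2 `^ s / (1 - 2 `^ (s - 1)))%R.

Lemma sing_const_ge0 s : (s < 1)%R -> (0 <= sing_const s)%R.
Proof.
move=> s1; rewrite /sing_const mulr_ge0 ?invr_ge0//.
rewrite subr_ge0 -[leRHS](powRr0 2); apply: ler_powR; last by rewrite subr_le0 ltW.
by rewrite ler1n.
Qed.

Lemma unif_near (v r : R) : (0 <= r)%R -> nu [set x | (`|x - v| < r)%R] <= (2 * r)%:E.
Proof.
move=> r0; rewrite (_ : 2 * r = (v + r) - (v - r))%R; last by ring.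
apply: unif_le; [|by lra|].
  have -> : [set x | (`|x - v| < r)%R] = `](v - r)%R, (v + r)%R[%classic.
    by apply/seteqP; split=> x /=; rewrite in_itv/= ltr_norml; lra.
  exact: measurable_itv.
by move=> x /= []; rewrite !in_itv/= ltr_norml; lra.
Qed.

(* Cutting [0 < |x - v| < r] into dyadic shells bounds the integral by a
   geometric series. *)
Lemma integral_sing_near (s r v : R) : (0 < s)%R -> (s < 1)%R -> (0 < r)%R ->
  \int[nu]_x (if (`|x - v| < r)%R then `|x - v| `^ (- s) else 0)%:E
  <= (sing_const s * r `^ (1 - s))%:E.
Proof.
move=> s0 s1 r0.
pose rk k := (2^-1 ^+ k * r)%R.
have rk0 k : (0 < rk k)%R by rewrite /rk mulr_gt0.
pose a k := (rk k.+1 `^ (- s))%R.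
pose F k (x : R) : \bar R := (a k * (`|x - v| < rk k)%R%:R)%:E.
have F0 k x : 0 <= F k x by rewrite lee_fin mulr_ge0// powR_ge0.
have mb k : measurable_fun setT (fun x : R => (`|x - v| < rk k)%R).
  apply: measurable_fun_ltr => //; apply: measurableT_comp => //.
  exact: measurable_funB.
have mF k : measurable_fun setT (F k).
  apply/measurable_EFinP/measurable_funM => //; exact: measurable_fun_natr_bool.
apply: (@le_trans _ _ (\int[nu]_x \sum_(0 <= k <oo) F k x)).
  apply: le_int => x; first by case: ifP => _; rewrite lee_fin// powR_ge0.
  case: ifPn => xr; last by apply: nneseries_ge0.
  (* At [x = v] no shell is available, but [powR] sends zero to zero for a nonzero exponent. *)
  have [xv|xv] := eqVneq x v.
    rewrite xv subrr normr0 powR0; first exact: nneseries_ge0.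
    by rewrite oppr_eq0 gt_eqF.
  have d0 : (0 < `|x - v|)%R by rewrite normr_gt0 subr_eq0.
  have : exists k, (rk k.+1 <= `|x - v|)%R.
    have /cvgrPdist_lt /(_ _ d0) [N _ /(_ N (leqnn N))] :
        (geometric r 2^-1 k @[k --> \oo] --> (0 : R))%R.
      by apply: cvg_geometric; rewrite ger0_norm// invf_lt1// ltr1n.
    rewrite sub0r normrN /= => H; exists N; rewrite /rk exprS -mulrA.
    have := ltW H; rewrite ger0_norm; last by rewrite mulr_ge0 ?exprn_ge0 ?(ltW r0).
    rewrite (mulrC r); apply: le_trans.
    by rewrite ler_piMl ?invf_le1 ?ler1n//; exact: ltW (rk0 N).
  move=> ex; case: (ex_minnP ex) => k kx kmin.
  have xk : (`|x - v| < rk k)%R.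
    case: k kmin kx => [|k] kmin kx; first by rewrite /rk expr0 mul1r.
    by rewrite ltNge; apply/negP => /kmin; rewrite ltnn.
  apply: (@le_trans _ _ (F k x)).
    rewrite lee_fin xk mulr1 /a !powRN lef_pV2 ?posrE ?powR_gt0//.
    by apply: ge0_ler_powR; rewrite ?nnegrE ?(ltW s0)// ltW.
  rewrite (nneseries_split 0 k.+1)// add0n big_nat_recr//=.
  apply: le_trans (leeDl _ (nneseries_ge0 _)) => //.
  by apply: leeDr; exact: sume_ge0.
rewrite integral_nneseries//.
pose z := (2 `^ (s - 1) : R)%R.
have z0 : (0 < z)%R by rewrite powR_gt0.
have z1 : (z < 1)%R.
  rewrite -(powRr0 2) /z /powR pnatr_eq0/= ltr_expR ltr_pM2r ?subr_lt0//.
  by rewrite ln_gt0// ltr1n.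
apply: (@le_trans _ _ (\sum_(0 <= k <oo)
    (geometric (2 * 2 `^ s * r `^ (1 - s))%R z k)%:E)).
  apply: lee_nneseries => [k _ _|k _]; first by apply: integral_ge0 => x _; exact: F0.
  rewrite /F.
  under eq_integral do rewrite EFinM.
  rewrite ge0_integralZl//; last 2 first.
  - by apply/measurable_EFinP; exact: measurable_fun_natr_bool.
  - by rewrite lee_fin powR_ge0.
  rewrite int_natr_bool//.
  apply: (@le_trans _ _ ((a k)%:E * (2 * rk k)%:E)).
    by apply: lee_wpmul2l; [rewrite lee_fin powR_ge0|exact/unif_near/ltW].
  rewrite -EFinM lee_fin le_eqVlt; apply/orP; left; apply/eqP.
  have -> : a k = (2 `^ s * rk k `^ (- s))%R.
    rewrite /a /rk exprS -mulrA powRM ?mulr_ge0 ?(ltW r0) ?exprn_ge0//.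
    by rewrite -powR_inv1// -powRrM mulN1r opprK.
  have -> : geometric (2 * 2 `^ s * r `^ (1 - s))%R z k =
      (2 * 2 `^ s * rk k `^ (1 - s))%R.
    rewrite /geometric/= /rk powRM ?(ltW r0) ?exprn_ge0//.
    rewrite -[in RHS]powR_mulrn// -powRrM (mulrC k%:R) powRrM powR_mulrn ?powR_ge0//.
    by rewrite -powR_inv1// -powRrM mulN1r opprB; ring.
  have -> : (rk k `^ (1 - s) = rk k `^ (- s) * rk k)%R.
    rewrite addrC powRD; first by rewrite powRr1// ltW.
    by apply/implyP => _; rewrite gt_eqF.
  by ring.
apply: lime_le; first by apply: is_cvg_nneseries => n _ _; rewrite lee_fin geometric_ge0 ?(ltW z0)// !mulr_ge0 ?powR_ge0.
apply: nearW => n; rewrite sumEFin lee_fin.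
rewrite /sing_const [leRHS]mulrAC.
apply: (@geometric_le_lim _ n (2 * 2 `^ s * r `^ (1 - s))%R z) => //.
  by rewrite !mulr_ge0 ?powR_ge0.
by rewrite ger0_norm// ltW.
Qed.

End uniform.

Section product_expectation.
Context {R : realType} (nu : probability R R) (mu : probability (seeds R) R).
Hypothesis iid_mu : iid nu mu.
Local Open Scope ereal_scope.

(** The seeds are integrated out from the last one down, the remaining factors not involving it. The
    bounds [c l] stand in for the exact means, so that the result is a product of reals. *)
Lemma integral_prod_le n (phi : nat -> R -> R) (c : nat -> R) :
  (forall l, measurable_fun setT (phi l)) -> (forall l x, 0 <= phi l x)%R ->
  (forall l, 0 <= c l)%R -> (forall l, \int[nu]_x (phi l x)%:E <= (c l)%:E) ->
  \int[mu]_u (\prod_(l < n) phi l (u l))%:E <= (\prod_(l < n) c l)%:E.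
Proof.
move=> mphi phi0 c0 phic.
have mprod k : measurable_fun setT (fun u : seeds R => (\prod_(l < k) phi l (u l))%R).
  apply: measurable_prod => l _.
  exact: (measurableT_comp (mphi l) (measurable_seed l)).
have prod0 k (u : seeds R) : (0 <= \prod_(l < k) phi l (u l))%R by apply: prodr_ge0.
elim: n => [|n IH].
  by apply: int_cst_le => u; rewrite !big_ord0.
rewrite (integral_resampleC iid_mu n); last 2 first.
- exact/measurable_EFinP.
- by move=> u; rewrite lee_fin.
apply: (@le_trans _ _ (\int[mu]_u ((c n)%:E * (\prod_(l < n) phi l (u l))%:E))).
  apply: le_int => u; first by apply: integral_ge0 => x _; rewrite lee_fin.
  under eq_integral => x _.
    rewrite big_ord_recr/= updE.
    under eq_bigr => l _ do rewrite updN ?(ltn_eqF (ltn_ord l))//.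
    over.
  rewrite integral_EFinZl//; last exact: prod0.
  by rewrite [leRHS]muleC; apply: lee_wpmul2l; rewrite ?lee_fin; [exact: prod0|exact: phic].
under eq_integral do rewrite -EFinM.
rewrite integral_EFinZl//.
by rewrite big_ord_recr/= mulrC EFinM; apply: lee_wpmul2l => //; rewrite lee_fin.
Qed.

End product_expectation.

(** * Transfer to the space of seed sequences *)

Section law_of_seeds.
Context {d} {T : measurableType d} {R : realType} (P : probability T R).
Variable U : nat -> {RV P >-> R}.

Definition seed_seq (w : T) : seeds R := fun i => U i w.

Lemma measurable_seed_seq : measurable_fun setT seed_seq.
Proof. by apply: measurable_seedsP => i; exact: measurable_funP. Qed.

HB.instance Definition _ := @isMeasurableFun.Build _ _ _ _ seed_seq measurable_seed_seq.

Definition seed_law : probability (seeds R) R := distribution P seed_seq.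

Lemma iid_seed_law : (forall i, uniform01 (U i)) -> mutually_independent U ->
  iid (unif R) seed_law.
Proof.
move=> unifU indU n A mA.
pose J : {fset nat} := [fset i in iota 0 n]%fset.
transitivity (P (\bigcap_(i in [set` J]) (U i @^-1` A i))).
  congr (P _); apply/seteqP; split=> w /= H i.
    by rewrite /= in_fset/= mem_iota => /H.
  by move=> ilt; apply: H; rewrite /= in_fset/= mem_iota.
rewrite indU//.
transitivity (\prod_(i <- iota 0 n) P (U i @^-1` A i))%E.
  apply: perm_big; apply: uniq_perm; [exact: fset_uniq|exact: iota_uniq|].
  by move=> i; rewrite in_fset.
rewrite -[n in iota 0 n]subn0 -/(index_iota 0 n) big_mkord; apply: eq_bigr => i _.
by rewrite -[LHS]/(distribution P (U i) (A i)) unifU.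
Qed.

Lemma integral_seed_law (h : seeds R -> \bar R) : measurable_fun setT h ->
  (forall u, 0 <= h u)%E -> (\int[seed_law]_u h u = \int[P]_w h (seed_seq w))%E.
Proof.
move=> mh h0; rewrite ge0_integral_pushforward//; exact: measurable_seed_seq.
Qed.

End law_of_seeds.

(** * Convexity *)

Section convexity.
Context {R : realType}.
Implicit Types (p : R).

(** Young's inequality for the product of [y] and 1 with the conjugate exponents [p] and
    [p / (p - 1)]. For [p = 1] the second would be infinite, but the claim is then an equality. *)
Lemma powR_tangent p (y : R) : 1 <= p -> 0 <= y -> 1 + p * (y - 1) <= y `^ p.
Proof.
move=> p1 y0; have p0 : 0 < p by lra.
have [->|pn1] := eqVneq p 1; first by rewrite powRr1//; lra.
have pgt1 : 1 < p by rewrite lt_neqAle eq_sym pn1.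
have q0 : 0 < p / (p - 1) by rewrite divr_gt0 ?subr_gt0.
have := @conjugate_powR R y 1 p (p / (p - 1)) y0 ler01 p0 q0.
rewrite invf_div powR1 mulr1.
have -> : p^-1 + (p - 1) / p = 1 by field; lra.
move=> /(_ erefl); rewrite -(ler_pM2l p0) => H; apply: le_trans (_ : _ <= p * y - (p - 1)) _; first lra.
rewrite lerBlDr; apply: le_trans H _.
by rewrite le_eqVlt; apply/orP; left; apply/eqP; field; lra.
Qed.

(* Jensen's inequality with weights of total mass at most 1, each term
   bounded below by the tangent at the mean. *)
Lemma powR_sum_weights (I : Type) (r : seq I) (Q : pred I) p (w a : I -> R) :
  1 <= p -> (forall i, 0 < w i) -> (forall i, 0 <= a i) ->
  \sum_(i <- r | Q i) w i <= 1 ->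
  (\sum_(i <- r | Q i) a i) `^ p <= \sum_(i <- r | Q i) w i `^ (1 - p) * a i `^ p.
Proof.
move=> p1 w0 a0 w1; have p0 : 0 < p by lra.
set A := \sum_(i <- r | Q i) a i.
have A0 : 0 <= A by apply: sumr_ge0.
have [AE|An0] := eqVneq A 0.
  rewrite AE powR0 ?gt_eqF//; apply: sumr_ge0 => i _.
  by rewrite mulr_ge0 ?powR_ge0.
have Agt0 : 0 < A by rewrite lt_neqAle eq_sym An0.
(* The tangent at 1, evaluated at [a i / (w i * A)] and multiplied by [w i] and by the [p]-th power
   of [A]. *)
have key i : A `^ p * (w i + p * (a i / A - w i)) <= w i `^ (1 - p) * a i `^ p.
  have wA0 : 0 < w i * A by rewrite mulr_gt0.
  have y0 : 0 <= a i / (w i * A) by rewrite divr_ge0// ltW.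
  have := powR_tangent p1 y0; rewrite -(ler_pM2l (w0 i)) => /(ler_wpM2l (powR_ge0 A p)).
  have -> : w i * (1 + p * (a i / (w i * A) - 1)) = w i + p * (a i / A - w i).
    by field; rewrite An0 gt_eqF.
  move=> /le_trans; apply; rewrite le_eqVlt; apply/orP; left; apply/eqP.
  rewrite powRM ?invr_ge0 ?(ltW wA0)// -powR_inv1 ?(ltW wA0)// -powRrM mulN1r.
  rewrite powRM ?(ltW (w0 i))// !powRN powRD; last first.
    by apply/implyP => _; rewrite gt_eqF.
  rewrite powRr1 ?(ltW (w0 i))// powRN.
  by field; rewrite !gt_eqF ?powR_gt0.
apply: le_trans (ler_sum _ (fun i _ => key i)).
rewrite -mulr_sumr big_split/= -mulr_sumr sumrB -mulr_suml -/A divff//.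
rewrite -[leLHS]mulr1; apply: ler_wpM2l; first exact: powR_ge0.
set W := \sum_(i <- r | Q i) w i in w1 *.
have : 0 <= (p - 1) * (1 - W) by rewrite mulr_ge0; lra.
by lra.
Qed.

(** Jensen's inequality with equal weights, the inverse of the number of terms; an empty sum has no
    such weight and is treated apart. *)
Lemma powR_sum_count (I : Type) (r : seq I) (Q : pred I) p (a : I -> R) :
  1 <= p -> (forall i, 0 <= a i) ->
  (\sum_(i <- r | Q i) a i) `^ p <=
  (\sum_(i <- r | Q i) 1) `^ (p - 1) * \sum_(i <- r | Q i) a i `^ p.
Proof.
move=> p1 a0; have p0 : 0 < p by lra.
have C (x : R) : \sum_(i <- r | Q i) x = (count Q r)%:R * x.
  by rewrite big_const_seq iter_addr_0 mulr_natl.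
rewrite C mulr1.
have [N0|N0] := posnP (count Q r).
  have H := has_count Q r; rewrite N0 ltnn in H.
  rewrite !big_hasC ?H// powR0 ?gt_eqF// mulr0; lra.
have Nr0 : 0 < (count Q r)%:R :> R by rewrite ltr0n.
have := @powR_sum_weights I r Q p (fun=> (count Q r)%:R^-1) a p1 (fun=> _) a0.
rewrite C divff ?gt_eqF// lexx.
rewrite invr_gt0 => /(_ (fun=> Nr0) erefl) /le_trans; apply.
rewrite -mulr_sumr -powR_inv1 ?(ltW Nr0)// -powRrM.
by rewrite mulN1r opprB.
Qed.
End convexity.

(** * Pivots and their contributions *)

Section pivots.
Context {R : realType}.
Implicit Types (u : nat -> R) (lo hi : nat -> bool).

(* For seeds in ]0, 1[, [survives lo hi u t x] says that the search interval
   just before the [t]-th seed is examined contains [x], where [lo j] and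
   [hi j] say that the target lies strictly above, respectively below, the
   [j]-th seed. *)
Definition survives lo hi u t (x : R) : bool :=
  (0 < x < 1) && all (fun j => lo j && (u j < x) || hi j && (x < u j)) (iota 0 t).

Lemma survivesP lo hi u t x : reflect
  (0 < x < 1 /\ forall j, (j < t)%N -> lo j && (u j < x) || hi j && (x < u j))
  (survives lo hi u t x).
Proof.
apply: (iffP andP) => -[x01 H]; split=> //.
  by move=> j jt; move/allP: H => /(_ j); rewrite mem_iota; apply.
by apply/allP => j; rewrite mem_iota; exact: H.
Qed.

Definition rank_below n u (y : R) : nat := (\sum_(0 <= l < n) (u l <= y)%R)%N.

(** Leaving out the seeds [i] and [t] makes the count insensitive to resampling them. It falls short
    of the full count by at most 2. *)
Definition rank_others n i t u (y : R) : nat :=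
  (\sum_(0 <= l < n | (l != i) && (l != t)) (u l <= y)%R)%N.

Lemma rank_below_le n u x y : x <= y -> (rank_below n u x <= rank_below n u y)%N.
Proof.
move=> xy; apply: leq_sum => l _; case: (boolP (u l <= x)%R) => // ulx.
by rewrite (le_trans ulx xy).
Qed.

Lemma rank_below_lt n u j y : (j < n)%N -> y < u j ->
  (rank_below n u y < rank_below n u (u j))%N.
Proof.
move=> jn yj; rewrite /rank_below !big_mkord.
rewrite (bigD1 (Ordinal jn))//= [X in (_ < X)%N](bigD1 (Ordinal jn))//=.
rewrite lexx leNgt yj/= add0n add1n ltnS; apply: leq_sum => l _.
by case: (boolP (u l <= y)%R) => // uly; rewrite (le_trans uly (ltW yj)).
Qed.

Lemma rank_others_le n i t u x y : x <= y ->
  (rank_others n i t u x <= rank_others n i t u y)%N.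
Proof.
move=> xy; apply: leq_sum => l _; case: (boolP (u l <= x)%R) => // ulx.
by rewrite (le_trans ulx xy).
Qed.

Lemma sum_others_le n i t (f : nat -> nat) :
  (\sum_(0 <= l < n | (l != i) && (l != t)) f l <= \sum_(0 <= l < n) f l)%N.
Proof. by rewrite big_mkcond/=; apply: leq_sum => l _; case: ifP. Qed.

Lemma sum_others_ge n i t (f : nat -> nat) :
  (\sum_(0 <= l < n) f l <= \sum_(0 <= l < n | (l != i) && (l != t)) f l + f i + f t)%N.
Proof.
have split1 (Q : pred nat) k : (\sum_(0 <= l < n | Q l) f l <=
    \sum_(0 <= l < n | Q l && (l != k)) f l + f k)%N.
  rewrite (bigID (fun l => l != k))/= leq_add2l.
  apply: (@leq_trans (\sum_(0 <= l < n | l == k) f l)%N).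
    rewrite !(big_mkcond _ f)/=; apply: leq_sum => l _; rewrite negbK.
    by case: (l == k) => //; rewrite ?andbF//; case: (Q l).
  by rewrite big_nat1_eq/=; case: ifP.
apply: leq_trans (split1 xpredT t) _; rewrite leq_add2r.
apply: leq_trans (split1 (fun l => l != t) i) _.
by rewrite leq_add2r; under eq_bigl do rewrite andbC.
Qed.

(** A seed of rank exactly [m] is the target itself: both verdicts are then false and no point
    survives it. *)
Definition quant_lo n m u j := (rank_below n u (u j) < m)%N.
Definition quant_hi n m u j := (m < rank_below n u (u j))%N.

Definition quant_survives n m u := survives (quant_lo n m u) (quant_hi n m u) u.

Definition quant_part (b : R -> R -> R) n m t u : R :=
  if quant_survives n m u t (u t) then
    \sum_(t.+1 <= i < n | quant_survives n m u t (u i)) b (u i) (u t)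
  else 0.

(** Requiring [v <= 1 - lam] gives the empty window its full mass [lam] inside the unit interval;
    closer to the endpoint, the endpoint itself confines the search interval. *)
Definition right_gap t lam u (v : R) : bool :=
  (0 < v <= 1 - lam) && all (fun j => ~~ (v < u j < v + lam)) (iota 0 t).

Definition left_gap t lam u (v : R) : bool :=
  (lam <= v < 1) && all (fun j => ~~ (v - lam < u j < v)) (iota 0 t).

Definition near_others n i t lam u (v : R) : nat :=
  (\sum_(0 <= l < n | (l != i) && (l != t)) (`|u l - v| < lam)%R)%N.

(** The window has length [2 * lam], so at most [2 * n * lam] seeds are expected in it; the
    threshold is four times that, far enough for an exponential bound. *)
Definition crowded n i t lam u (v : R) : bool :=
  8 * n%:R * lam <= (near_others n i t lam u v)%:R.

(** The target rank is passed within [lam] of [v]. On the left, a seed between [v - lam] and [v] of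
    rank below [m] raises the count by one; on the right, the two omitted seeds lower it by at most
    2. Both effects lead to the same shift [.+1], so the two inequalities exclude each other at
    distant values of [v]. *)
Definition crossing n m i t lam u (v : R) : bool :=
  [|| v < lam, 1 - lam < v | ((rank_others n i t u (v - lam)).+1 < m)%N &&
                             (m <= (rank_others n i t u (v + lam)).+1)%N].

(** If [N] of the later seeds survive, Jensen's inequality over them leaves the factor [N / n] to
    the power [p - 1]. It is at most 1, which suffices on the three rare events; outside them
    [N / n <= 9 * lam], and [crossing] is forced. *)
Lemma quant_part_bound (b : R -> R -> R) n m t u (lam p : R) :
  (forall x v, 0 <= b x v) -> 1 <= p -> 0 < lam -> n%:R^-1 <= lam -> (0 < n)%N ->
  (quant_part b n m t u / n%:R) `^ p <=
  n%:R^-1 * \sum_(t.+1 <= i < n) (b (u i) (u t) `^ p *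
    ((right_gap t lam u (u t))%:R + (left_gap t lam u (u t))%:R +
     (crowded n i t lam u (u t))%:R +
     (9 * lam) `^ (p - 1) *
       ((crossing n m i t lam u (u t))%:R * (`|u i - u t| < lam)%R%:R))).
Proof.
move=> b0 p1 lam0 nlam n0.
have nr0 : 0 < n%:R :> R by rewrite ltr0n.
have p0 : 0 < p by lra.
have term0 i : 0 <= (right_gap t lam u (u t))%:R + (left_gap t lam u (u t))%:R +
    (crowded n i t lam u (u t))%:R + (9 * lam) `^ (p - 1) *
    ((crossing n m i t lam u (u t))%:R * (`|u i - u t| < lam)%R%:R) :> R.
  by rewrite !addr_ge0// !mulr_ge0 ?powR_ge0.
rewrite /quant_part; case: ifPn => [St|_]; last first.
  rewrite mul0r powR0 ?gt_eqF// mulr_ge0 ?invr_ge0 ?ler0n//.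
  by apply: sumr_ge0 => i _; rewrite mulr_ge0 ?powR_ge0.
set S := quant_survives n m u t in St *.
pose N : R := \sum_(t.+1 <= i < n | S (u i)) 1.
have N0 : 0 <= N by apply: sumr_ge0.
have NE : N = (\sum_(t.+1 <= i < n) S (u i))%N%:R.
  by rewrite /N big_mkcond/= natr_sum; apply: eq_bigr => i _; case: (S _).
have Nn : N <= n%:R.
  rewrite NE ler_nat; apply: leq_trans (leq_sum _ _ (E2 := fun=> 1%N)) _.
    by move=> i _; case: (S _).
  by rewrite sum_nat_const_nat muln1 leq_subr.
rewrite powRM ?invr_ge0 ?(ltW nr0)//; last by apply: sumr_ge0.
have := @powR_sum_count R _ (index_iota t.+1 n) (fun i => S (u i)) p
  (fun i => b (u i) (u t)) p1 (fun=> b0 _ _).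
rewrite -/N => /(ler_wpM2r (powR_ge0 n%:R^-1 p)) /le_trans; apply.
have -> : N `^ (p - 1) * (\sum_(t.+1 <= i < n | S (u i)) b (u i) (u t) `^ p) * n%:R^-1 `^ p =
    n%:R^-1 * \sum_(t.+1 <= i < n | S (u i)) (b (u i) (u t) `^ p * (N / n%:R) `^ (p - 1)).
  rewrite -mulr_suml powRM ?invr_ge0 ?(ltW nr0)//.
  have -> : n%:R^-1 `^ p = n%:R^-1 * n%:R^-1 `^ (p - 1) :> R.
    rewrite -[X in X * _]powRr1 ?invr_ge0 ?(ltW nr0)// -powRD; last first.
      by apply/implyP => _; rewrite gt_eqF// invr_gt0.
    by congr (_ `^ _); ring.
  by ring.
apply: ler_wpM2l; first by rewrite invr_ge0 ltW.
rewrite big_mkcond/= big_nat_cond [leRHS]big_nat_cond.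
apply: ler_sum => i; rewrite andbT => /andP[ti iltn].
case: ifPn => [Si|_]; last by rewrite mulr_ge0 ?powR_ge0.
apply: ler_wpM2l; first exact: powR_ge0.
have Nn1 : (N / n%:R) `^ (p - 1) <= 1.
  apply: le_trans (_ : 1 `^ (p - 1) <= 1); last by rewrite powR1.
  apply: ge0_ler_powR.
  - lra.
  - by rewrite nnegrE divr_ge0// ltW.
  - by rewrite nnegrE.
  - by rewrite ler_pdivrMr// mul1r.
have rest0 : 0 <= (9 * lam) `^ (p - 1) *
    ((crossing n m i t lam u (u t))%:R * (`|u i - u t| < lam)%R%:R) :> R.
  by rewrite !mulr_ge0 ?powR_ge0.
case: (boolP (right_gap t lam u (u t))) => Rg.
  by apply: le_trans Nn1 _; rewrite -!addrA lerDl !addr_ge0.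
case: (boolP (left_gap t lam u (u t))) => Lg.
  by apply: le_trans Nn1 _; rewrite add0r -!addrA lerDl !addr_ge0.
case: (boolP (crowded n i t lam u (u t))) => Cr.
  by apply: le_trans Nn1 _; rewrite !add0r lerDl.
rewrite !add0r.
(* Without a gap, an earlier seed just above [u t] and one just below it
   confine the interval to a window around [u t]. *)
have [ut01 Sut] := survivesP _ _ _ _ _ St.
have right x : S x -> x < u t + lam.
  move=> /survivesP[x01 Sx]; case: (boolP (u t <= 1 - lam)) => utl; last by lra.
  move: Rg; rewrite /right_gap (andP ut01).1 utl/= => /allPn[j]; rewrite mem_iota add0n => jt.
  rewrite negbK => /andP[utj ujl].
  have := Sut j jt; rewrite (ltNge (u j)) (ltW utj) andbF/= => /andP[hij _].
  have := Sx j jt; case/orP => /andP[].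
    by move: hij; rewrite /quant_hi /quant_lo ltnNge => /negP H /ltnW /H.
  by move=> _ xj; apply: lt_trans xj _; lra.
have left x : S x -> u t - lam < x.
  move=> /survivesP[x01 Sx]; case: (boolP (lam <= u t)) => utl; last by lra.
  move: Lg; rewrite /left_gap (andP ut01).2 utl/= => /allPn[j]; rewrite mem_iota add0n => jt.
  rewrite negbK => /andP[utj ujl].
  have := Sut j jt; rewrite (ltNge (u t)) (ltW ujl) andbF orbF/= => /andP[loj _].
  have := Sx j jt; case/orP => /andP[].
    by move=> _ xj; lra.
  by move: loj; rewrite /quant_hi /quant_lo ltnNge => /negP H /ltnW /H.
have nr x : S x -> `|x - u t| < lam.
  by move=> Sx; have := right _ Sx; have := left _ Sx; rewrite ltr_norml; lra.
have jin j : (j < t)%N -> (j < n)%N by move=> jt; apply: ltn_trans jt (ltn_trans ti iltn).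
have others y : (rank_below n u y <= (rank_others n i t u y).+2)%N.
  apply: leq_trans (sum_others_ge n i t (fun l => (u l <= y)%R)) _.
  by rewrite -addnA -addn2 leq_add2l; case: (u i <= y); case: (u t <= y).
have -> : crossing n m i t lam u (u t).
  rewrite /crossing; case: (ltP (u t) lam) => //= lt1; case: (ltP (1 - lam) (u t)) => //= lt2.
  move: Rg; rewrite /right_gap (andP ut01).1 lt2/= => /allPn[j]; rewrite mem_iota add0n => jt.
  rewrite negbK => /andP[utj ujl].
  move: Lg; rewrite /left_gap (andP ut01).2 lt1/= => /allPn[k]; rewrite mem_iota add0n => kt.
  rewrite negbK => /andP[ulk ukt].
  have := Sut j jt; rewrite (ltNge (u j)) (ltW utj) andbF/= => /andP[hij _].
  have := Sut k kt; rewrite (ltNge (u t)) (ltW ukt) andbF orbF/= => /andP[lok _].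
  apply/andP; split.
    apply: leq_ltn_trans lok; apply: leq_ltn_trans (rank_below_lt (jin _ kt) ulk).
    exact: sum_others_le.
  rewrite -ltnS; apply: leq_trans hij _; apply: leq_trans (others _).
  exact/rank_below_le/ltW.
rewrite nr// mulr1 mulr1.
apply: ge0_ler_powR; rewrite ?nnegrE; [lra|by rewrite divr_ge0// ltW|lra|].
rewrite ler_pdivrMr//.
(* The constant 9 is 8 + 1: [near_others] leaves out the seed [i], which survives as well, and
   [1 <= n * lam] absorbs it. The seed [t] is not among the later ones. *)
apply: (@le_trans _ _ (1 + 8 * n%:R * lam)); last first.
  have : 1 <= lam * n%:R by rewrite -ler_pdivrMr// mul1r.
  lra.
move: Cr; rewrite /crowded -ltNge => /ltW Cr.
apply: le_trans (_ : (1 + (near_others n i t lam u (u t))%:R) <= _); last by rewrite lerD2l.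
rewrite NE -[1]/(1%:R) -natrD ler_nat (big_nat_widenl _ 0)// big_mkcond/=.
apply: (@leq_trans (\sum_(0 <= l < n) ((l == i) +
    (if (l != i) && (l != t) then (`|u l - u t| < lam)%R : nat else 0%N)))%N).
  apply: leq_sum => l _; case: ifP => // tl.
  case: (l =P i) => [->|/=]; first by case: (S _).
  move=> _; rewrite gtn_eqF//= add0n; case: (boolP (S (u l))) => // /nr ->//.
rewrite big_split/=; apply: leq_add; last by rewrite /near_others [leqRHS]big_mkcond.
apply: (@leq_trans (\sum_(0 <= l < n | l == i) 1)%N).
  by rewrite [leqRHS]big_mkcond/=; apply: leq_sum => l _; case: (l == i).
by rewrite big_nat1_eq; case: ifP.
Qed.
End pivots.

(** * Measurability *)

Section measurability.
Context d (X : measurableType d) (R : realType).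

Lemma measurable_all (I : Type) (s : seq I) (Q : I -> X -> bool) :
  (forall j, measurable_fun setT (Q j)) ->
  measurable_fun setT (fun x => all (fun j => Q j x) s).
Proof.
move=> mQ; elim: s => [|j s IH]; first exact: measurable_cst.
exact: measurable_and.
Qed.

Lemma measurable_sumn (I : Type) (s : seq I) (Q : pred I) (F : I -> X -> nat) :
  (forall j, measurable_fun setT (F j)) ->
  measurable_fun setT (fun x => \sum_(j <- s | Q j) F j x)%N.
Proof.
move=> mF; elim: s => [|j s IH].
  by under eq_fun do rewrite big_nil; exact: measurable_cst.
under eq_fun do rewrite big_cons; case: (Q j) => //.
exact: measurable_fun_addn.
Qed.

Lemma measurable_nat_of_bool (f : X -> bool) :
  measurable_fun setT f -> measurable_fun setT (fun x => f x : nat).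
Proof.
move=> mf; rewrite (_ : (fun _ => _) = fun x => if f x then 1%N else 0%N); last first.
  by apply/funext => x; case: (f x).
exact: measurable_fun_ifT.
Qed.

Lemma measurable_natr (f : X -> nat) :
  measurable_fun setT f -> measurable_fun setT (fun x => (f x)%:R : R).
Proof. by move=> mf; apply: (measurableT_comp (f := fun n : nat => n%:R : R)). Qed.

Lemma measurable_sum_cond (I : Type) (s : seq I) (Q : I -> X -> bool)
    (F : I -> X -> R) :
  (forall j, measurable_fun setT (Q j)) -> (forall j, measurable_fun setT (F j)) ->
  measurable_fun setT (fun x => \sum_(j <- s | Q j x) F j x).
Proof.
move=> mQ mF; under eq_fun do rewrite big_mkcond/=.
by apply: measurable_sum => j; exact: measurable_fun_ifT.
Qed.

Lemma measurable_seed_comp (f : X -> seeds R) i :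
  measurable_fun setT f -> measurable_fun setT (fun x => f x i).
Proof. by move=> mf; exact: (measurableT_comp (measurable_seed i) mf). Qed.

Lemma measurable_powR_comp (f : X -> R) (p : R) :
  measurable_fun setT f -> measurable_fun setT (fun x => f x `^ p).
Proof. by move=> mf; exact: (measurableT_comp (measurable_powR p) mf). Qed.

Lemma measurable_norm_comp (f : X -> R) :
  measurable_fun setT f -> measurable_fun setT (fun x => `|f x|).
Proof. by move=> mf; exact: measurableT_comp. Qed.

Lemma measurable_kernel_comp (b : R -> R -> R) (f g : X -> R) :
  measurable_fun setT (fun z : R * R => b z.1 z.2) ->
  measurable_fun setT f -> measurable_fun setT g ->
  measurable_fun setT (fun x => b (f x) (g x)).
Proof.
move=> mb mf mg.
by apply: (measurableT_comp (f := fun z : R * R => b z.1 z.2) mb (measurable_fun_pair mf mg)).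
Qed.
End measurability.

Ltac measurability_eta :=
  lazymatch goal with
  | |- measurable_fun _ (fun x => _) => fail
  | |- measurable_fun ?D ?f => change (measurable_fun D (fun x => f x))
  end.
Ltac measurability_step :=
  lazymatch goal with
  | |- measurable_fun _ (fun _ => ?c) => exact: measurable_cst
  | |- measurable_fun _ (fun x => x) => exact: measurable_id
  | |- measurable_fun _ (fun x => fst _) =>
      first [assumption | exact: measurable_fst | apply: (measurableT_comp measurable_fst)]
  | |- measurable_fun _ (fun x => snd _) =>
      first [assumption | exact: measurable_snd | apply: (measurableT_comp measurable_snd)]
  | |- measurable_fun _ (fun x => (@?a x < @?b x)%R) => apply: measurable_fun_ltr
  | |- measurable_fun _ (fun x => (@?a x <= @?b x)%R) => apply: measurable_fun_ler
  | |- measurable_fun _ (fun x => ((@?a x).+1 <= @?b x)%N) => apply: measurable_fun_ltn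
  | |- measurable_fun _ (fun x => (@?a x <= @?b x)%N) => apply: measurable_fun_leq
  | |- measurable_fun _ (fun x => @?a x && @?b x) => apply: measurable_and
  | |- measurable_fun _ (fun x => @?a x || @?b x) => apply: measurable_or
  | |- measurable_fun _ (fun x => ~~ @?a x) => apply: measurable_neg
  | |- measurable_fun _ (fun x => all _ _) => apply: measurable_all => ?
  | |- measurable_fun _ (fun x => if _ then _ else _) => apply: measurable_fun_ifT
  | |- measurable_fun _ (fun x => nat_of_bool _) => apply: measurable_nat_of_bool
  | |- measurable_fun _ (fun x => (_).+1) =>
      apply: (measurableT_comp (f := fun n : nat => n.+1)); first by []
  | |- measurable_fun _ (fun x => (_)%:R) => apply: measurable_natr
  | |- measurable_fun _ (fun x => (_)%:E) => apply/measurable_EFinP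
  | |- measurable_fun _ (fun x => - _) => apply: measurable_funN
  | |- measurable_fun _ (fun x => (_ - _)) => apply: measurable_funB
  | |- measurable_fun _ (fun x => _ + _) => apply: measurable_funD
  | |- measurable_fun _ (fun x => _ * _) => apply: measurable_funM
  | |- measurable_fun _ (fun x => `| _ |) => apply: measurable_norm_comp
  | |- measurable_fun _ (fun x => _ `^ _) => apply: measurable_powR_comp
  | |- measurable_fun _ (fun x => upd _ _ _) => apply: measurable_upd
  | |- measurable_fun _ (fun x => bigop _ _ _) =>
      first [apply: measurable_sumn => ? | apply: measurable_sum_cond => ?
            | apply: measurable_sum => ?]
  | |- measurable_fun _ (fun x => _) =>
      first [assumption | exact: measurable_cst | exact: measurable_seed | apply: measurable_seed_comp | apply: measurable_kernel_comp => //]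
  | |- measurable_fun _ _ => first [assumption | exact: measurable_id | exact: measurable_fst | exact: measurable_snd
                                  | exact: measurable_funP | measurability_eta]
  end.
Ltac measurability := repeat (cbv beta; measurability_step).

Section pivot_measurability.
Context d (X : measurableType d) (R : realType).
Variables (f : X -> seeds R) (g : X -> R).
Hypotheses (mf : measurable_fun setT f) (mg : measurable_fun setT g).

Lemma measurable_rank_below n : measurable_fun setT (fun x => rank_below n (f x) (g x)).
Proof. by rewrite /rank_below; measurability. Qed.

Lemma measurable_rank_others n i t :
  measurable_fun setT (fun x => rank_others n i t (f x) (g x)).
Proof. by rewrite /rank_others; measurability. Qed.

Lemma measurable_right_gap t lam : measurable_fun setT (fun x => right_gap t lam (f x) (g x)).
Proof. by rewrite /right_gap; measurability. Qed.

Lemma measurable_left_gap t lam : measurable_fun setT (fun x => left_gap t lam (f x) (g x)).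
Proof. by rewrite /left_gap; measurability. Qed.

Lemma measurable_crowded n i t lam :
  measurable_fun setT (fun x => crowded n i t lam (f x) (g x)).
Proof. by rewrite /crowded /near_others; move: (8 * n%:R * lam) => c; measurability. Qed.

End pivot_measurability.

Section survival_measurability.
Context d (X : measurableType d) (R : realType).
Variables (f : X -> seeds R) (g : X -> R).
Hypotheses (mf : measurable_fun setT f) (mg : measurable_fun setT g).

Lemma measurable_crossing n m i t lam :
  measurable_fun setT (fun x => crossing n m i t lam (f x) (g x)).
Proof.
rewrite /crossing; measurability.
all: apply: measurable_rank_others; measurability.
Qed.

Lemma measurable_survives (lo hi : nat -> X -> bool) t :
  (forall j, measurable_fun setT (lo j)) -> (forall j, measurable_fun setT (hi j)) ->
  measurable_fun setT (fun x => survives (lo ^~ x) (hi ^~ x) (f x) t (g x)).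
Proof. by move=> mlo mhi; rewrite /survives; measurability. Qed.

Lemma measurable_quant_survives n m t :
  measurable_fun setT (fun x => quant_survives n m (f x) t (g x)).
Proof.
apply: (@measurable_survives (fun j x => quant_lo n m (f x) j)
  (fun j x => quant_hi n m (f x) j)) => j; rewrite /quant_lo /quant_hi;
  measurability; apply: measurable_rank_below => //; exact: measurable_seed_comp.
Qed.
End survival_measurability.

Lemma measurable_quant_part (R : realType) (b : R -> R -> R) n m t :
  measurable_fun setT (fun z : R * R => b z.1 z.2) ->
  measurable_fun setT (fun u : seeds R => quant_part b n m t u).
Proof.
move=> mb; have mid : measurable_fun setT (fun u : seeds R => u) by exact: measurable_id.
apply: measurable_fun_ifT => //.
  by apply: (measurable_quant_survives mid); exact: measurable_seed.
apply: measurable_sum_cond => i.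
  by apply: (measurable_quant_survives mid); exact: measurable_seed.
by apply: measurable_kernel_comp => //; exact: measurable_seed.
Qed.

(** * Moments of a contribution, uniformly in n *)

Section cost_moments.
Context {R : realType} (mu : probability (seeds R) R).
Hypothesis iid_mu : iid (unif R) mu.
Local Notation nu := (unif R).

(** Seed [t] is resampled first and becomes a fixed value [v]; seed [i] is then integrated out
    against [q], uniformly in [v], since [G] at [v] depends on neither seed. This decouples a
    singular kernel from an event. *)
Lemma int_two_le i t (q : R -> R -> R) (G : seeds R -> R -> R) (Kq : R) :
  i != t -> measurable_fun setT (fun z : R * R => q z.1 z.2) ->
  (forall x v, 0 <= q x v) ->
  (forall v, \int[nu]_x (q x v)%:E <= Kq%:E)%E ->
  measurable_fun setT (fun z : R * seeds R => G z.2 z.1) ->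
  (forall u v, 0 <= G u v) ->
  (forall u v x, G (upd u t x) v = G u v) ->
  (forall u v x, G (upd u i x) v = G u v) ->
  (\int[mu]_u (q (u i) (u t) * G u (u t))%:E <=
   Kq%:E * \int[nu]_v \int[mu]_u (G u v)%:E)%E.
Proof.
move=> it mq q0 Kq_ mG G0 Gt Gi.
have Kq0 : 0 <= Kq.
  by rewrite -lee_fin; apply: le_trans (Kq_ 0); apply: integral_ge0 => x _; rewrite lee_fin.
have mGv v : measurable_fun setT (fun u => G u v).
  apply: (measurableT_comp (f := fun z : R * seeds R => G z.2 z.1) mG
    (g := fun u => (v, u))); exact: measurable_fun_pair.
have mqv v : measurable_fun setT (fun x => q x v).
  by apply: measurable_kernel_comp.
have mGu i' : measurable_fun setT (fun u : seeds R => G u (u i')).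
  apply: (measurableT_comp (f := fun z : R * seeds R => G z.2 z.1) mG
    (g := fun u : seeds R => (u i', u))); apply: measurable_fun_pair => //.
  exact: measurable_seed.
have mGE : measurable_fun setT (fun z : R * seeds R => (G z.2 z.1)%:E).
  exact/measurable_EFinP.
have GE0 (z : R * seeds R) : (0 <= (G z.2 z.1)%:E)%E by rewrite lee_fin.
have mGint := measurable_fun_fubini_tonelli_F (m2 := mu) _ mGE GE0.
rewrite (integral_resample iid_mu t); last 2 first.
- apply/measurable_EFinP; apply: measurable_funM => //.
  by apply: measurable_kernel_comp => //; exact: measurable_seed.
- by move=> u; rewrite lee_fin mulr_ge0.
rewrite -ge0_integralZl; [|exact: measurableT|exact: mGint| |by rewrite lee_fin]; last first.
  by move=> v _; apply: integral_ge0 => u _; rewrite lee_fin.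
apply: le_int => v; first by apply: integral_ge0 => u _; rewrite lee_fin mulr_ge0.
under eq_integral => u _ do rewrite updE updN// Gt.
rewrite [leLHS](integral_resampleC iid_mu i); last 2 first.
- apply/measurable_EFinP; apply: measurable_funM => //.
  by apply: measurable_kernel_comp => //; exact: measurable_seed.
- by move=> u; rewrite lee_fin mulr_ge0.
rewrite -integral_EFinZl//.
apply: le_int => u; first by apply: integral_ge0 => x _; rewrite lee_fin mulr_ge0.
under eq_integral => x _ do rewrite updE Gi mulrC.
by rewrite integral_EFinZl// EFinM muleC; apply: lee_wpmul2r; rewrite ?lee_fin.
Qed.

Lemma le_expR_1D (x : R) n : -1 <= x -> (1 + x) ^+ n <= expR (n%:R * x).
Proof.
move=> x1; rewrite mulrC expRM_natr; apply: lerXn2r; rewrite ?nnegrE ?expR_ge0//; first lra.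
exact: expR_ge1Dx.
Qed.

Lemma right_gap_le t (lam v : R) : 0 < lam <= 1 ->
  (\int[mu]_u ((right_gap t lam u v)%:R : R)%:E <= (expR (- (t%:R * lam)))%:E)%E.
Proof.
move=> /andP[lam0 lam1].
have [v01|v01] := boolP (0 < v <= 1 - lam); last first.
  apply: int_cst_le => u; rewrite /right_gap (negbTE v01)/= ?lee_fin//.
  exact: expR_ge0.
pose phi (l : nat) (x : R) : R := (~~ (v < x < v + lam))%:R.
apply: (@le_trans _ _ (\int[mu]_u (\prod_(l < t) phi l (u l))%:E)%E).
  apply: le_int => u; rewrite ?lee_fin// /right_gap v01/=.
  case: allP => [H|_]; last by apply: prodr_ge0.
  rewrite big1// => l _; rewrite /phi H// mem_iota add0n; exact: ltn_ord.
apply: (@le_trans _ _ (\prod_(l < t) (1 - lam))%:E); last first.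
  rewrite prodr_const card_ord lee_fin -mulrN; apply: le_expR_1D; lra.
apply: (@integral_prod_le _ _ _ iid_mu t phi (fun=> 1 - lam)).
- by move=> l; rewrite /phi; apply: measurable_fun_natr_bool; measurability.
- by move=> l x.
- by move=> _; lra.
- by move=> l; rewrite /phi integral_unif_outside; [rewrite lee_fin; lra|lra..].
Qed.

Lemma left_gap_le t (lam v : R) : 0 < lam <= 1 ->
  (\int[mu]_u ((left_gap t lam u v)%:R : R)%:E <= (expR (- (t%:R * lam)))%:E)%E.
Proof.
move=> /andP[lam0 lam1].
have [v01|v01] := boolP (lam <= v < 1); last first.
  apply: int_cst_le => u; rewrite /left_gap (negbTE v01)/= ?lee_fin//.
  exact: expR_ge0.
pose phi (l : nat) (x : R) : R := (~~ (v - lam < x < v))%:R.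
apply: (@le_trans _ _ (\int[mu]_u (\prod_(l < t) phi l (u l))%:E)%E).
  apply: le_int => u; rewrite ?lee_fin// /left_gap v01/=.
  case: allP => [H|_]; last by apply: prodr_ge0.
  rewrite big1// => l _; rewrite /phi H// mem_iota add0n; exact: ltn_ord.
apply: (@le_trans _ _ (\prod_(l < t) (1 - lam))%:E); last first.
  rewrite prodr_const card_ord lee_fin -mulrN; apply: le_expR_1D; lra.
apply: (@integral_prod_le _ _ _ iid_mu t phi (fun=> 1 - lam)).
- by move=> l; rewrite /phi; apply: measurable_fun_natr_bool; measurability.
- by move=> l x.
- by move=> _; lra.
- by move=> l; rewrite /phi integral_unif_outside; [rewrite lee_fin; lra|lra..].
Qed.

(* Chernoff bound for the exponential moment of base 2. *)
Lemma crowded_le n i t (lam v : R) : 0 < lam ->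
  (\int[mu]_u ((crowded n i t lam u v)%:R : R)%:E <= (expR (- (n%:R * lam)))%:E)%E.
Proof.
move=> lam0.
pose phi (l : nat) (x : R) : R :=
  if (l != i) && (l != t) then (if `|x - v| < lam then 2 else 1) else 1.
have phi0 l x : 0 <= phi l x by rewrite /phi; case: ifP => // _; case: ifP.
have mnear : measurable_fun setT (fun x : R => `|x - v| < lam) by measurability.
have mphi l : measurable_fun setT (phi l).
  by rewrite /phi; case: (_ && _); [apply: measurable_fun_ifT|].
have mprod : measurable_fun setT (fun u : seeds R => \prod_(l < n) phi l (u l)).
  apply: measurable_prod => l _.
  exact: (measurableT_comp (mphi l) (measurable_seed l)).
(* On the event, 2 to the power [near_others] is at least [expR (4 * n * lam)], because
   [expR 2^-1 <= 2]. The product has mean at most [(1 + 2 * lam) ^+ n], hence at most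
   [expR (2 * n * lam)]. *)
pose a : R := expR (- (4 * n%:R * lam)).
apply: (@le_trans _ _ (\int[mu]_u (a * \prod_(l < n) phi l (u l))%:E)%E).
  apply: le_int => u; rewrite ?lee_fin//.
  have prod0 : 0 <= \prod_(l < n) phi l (u l) by apply: prodr_ge0.
  case: (boolP (crowded n i t lam u v)) => [Cr|_]; last by rewrite mulr_ge0// expR_ge0.
  have -> : \prod_(l < n) phi l (u l) = 2 ^+ near_others n i t lam u v.
    rewrite /near_others big_mkord expr_sum [RHS]big_mkcond; apply: eq_bigr => l _.
    by rewrite /phi; case: ifP => // _; case: ifP.
  have e2 : expR (2^-1) <= 2 :> R.
    have := @expR_ge1Dx R (- 2^-1); rewrite expRN => H.
    rewrite -[leLHS]invrK -[leRHS]invrK lef_pV2 ?posrE ?invr_gt0 ?expR_gt0//.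
    by apply: le_trans H; lra.
  apply: (@le_trans _ _ (a * expR (2^-1) ^+ near_others n i t lam u v)).
    rewrite -expRM_natr /a -expRD -[leLHS]expR0 ler_expR.
    by move: Cr; rewrite /crowded; lra.
  apply: ler_wpM2l; first exact: expR_ge0.
  by apply: lerXn2r; rewrite ?nnegrE ?expR_ge0.
rewrite integral_EFinZl ?expR_ge0//; last by move=> u; apply: prodr_ge0.
apply: (@le_trans _ _ (a%:E * (\prod_(l < n) (1 + 2 * lam))%:E)%E).
  apply: lee_wpmul2l; first by rewrite lee_fin expR_ge0.
  apply: (@integral_prod_le _ _ _ iid_mu n phi (fun=> 1 + 2 * lam)) => // [_|l]; first lra.
  rewrite /phi; case: (_ && _); last by apply: int_cst_le => x; rewrite lee_fin//; lra.
  rewrite (eq_integral (fun x : R => (1 + ((`|x - v| < lam)%R%:R : R))%:E)); last first.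
    by move=> x _; case: (_ < _) => /=; congr (_%:E); ring.
  rewrite integral_EFinD//; last exact: measurable_fun_natr_bool.
  rewrite integral_cst// [X in (1 * X)%E]probability_setT mule1 EFinD.
  rewrite int_natr_bool//; apply: leeD => //; exact/unif_near/ltW.
rewrite prodr_const card_ord -EFinM lee_fin.
apply: le_trans (ler_wpM2l (expR_ge0 _) (le_expR_1D n _)) _; first lra.
rewrite -expRD ler_expR.
have := mulr_ge0 (ler0n R n) (ltW lam0); lra.
Qed.

(** Whatever the other seeds are, the counts increase with [v], so two values at which the target
    rank is passed differ by less than [2 * lam], and all of them lie in an interval of length
    [4 * lam]. The two ends of the unit interval contribute [lam] each. *)
Lemma crossing_le n m i t (lam : R) (u : seeds R) : 0 < lam ->
  (\int[nu]_v ((crossing n m i t lam u v)%:R : R)%:E <= (6 * lam)%:E)%E.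
Proof.
move=> lam0.
have muu : measurable_fun setT (fun _ : R => u : seeds R) by exact: measurable_cst.
pose C v := ((rank_others n i t u (v - lam)).+1 < m)%N &&
  (m <= (rank_others n i t u (v + lam)).+1)%N.
have mC : measurable_fun setT C.
  by rewrite /C; measurability;
    apply: (measurable_rank_others (f := fun=> u : seeds R)); measurability.
have m1 : measurable_fun setT (fun v : R => v < lam) by measurability.
have m2 : measurable_fun setT (fun v : R => 1 - lam < v) by measurability.
have mnat (f : R -> bool) : measurable_fun setT f ->
    measurable_fun setT (fun v => (f v)%:R : R) by exact: measurable_fun_natr_bool.
apply: (@le_trans _ _ (\int[nu]_v ((v < lam)%R%:R + ((1 - lam < v)%R%:R + (C v)%:R : R))%:E)%E).
  apply: le_int => v; rewrite lee_fin// /crossing -/(C v).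
  by case: (v < lam); case: (1 - lam < v); case: (C v) => /=; lra.
rewrite integral_EFinD//; [|exact: mnat|by apply: measurable_funD; exact: mnat].
rewrite integral_EFinD//; [|exact: mnat|exact: mnat].
rewrite !int_natr_bool//.
have mS (f : R -> bool) : measurable_fun setT f -> measurable [set v | f v].
  by move=> mf; rewrite -[X in measurable X]setTI; exact: (mf measurableT [set true]).
have -> : (6 * lam)%:E = (lam%:E + (lam%:E + (4 * lam)%:E))%E by rewrite -!EFinD; congr (_%:E); ring.
apply: leeD; last apply: leeD.
- have E : lam = lam - 0 by ring.
  rewrite [leRHS](congr1 EFin E); apply: unif_le; [exact: (mS (fun v => v < lam))|lra|].
  by move=> v /= []; rewrite !in_itv/=; lra.
- have E : lam = 1 - (1 - lam) by ring.
  rewrite [leRHS](congr1 EFin E); apply: unif_le; [exact: (mS (fun v => 1 - lam < v))|lra|].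
  by move=> v /= []; rewrite !in_itv/=; lra.
have [[v0 Cv0]|noC] := pselect (exists v, C v); last first.
  rewrite (_ : [set v | C v] = set0) ?measure0 ?lee_fin; first lra.
  by apply/seteqP; split=> v //= Cv; apply: noC; exists v.
have -> : 4 * lam = (v0 + 2 * lam) - (v0 - 2 * lam) by ring.
have spread v w : C v -> C w -> v - lam < w + lam.
  move=> /andP[Cv _] /andP[_ Cw]; rewrite ltNge; apply/negP => vw.
  have := rank_others_le n i t u vw; rewrite -ltnS => H.
  by have := leq_ltn_trans (leq_trans Cw H) Cv; rewrite ltnn.
apply: unif_le; [exact: (mS C)|lra|] => v /= [Cv _].
by have := spread _ _ Cv Cv0; have := spread _ _ Cv0 Cv; rewrite in_itv/=; lra.
Qed.

End cost_moments.

Section locality.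
Context {R : realType}.
Implicit Types (u w : nat -> R) (v lam : R).

Lemma right_gap_local t lam u w v : (forall j, (j < t)%N -> u j = w j) ->
  right_gap t lam u v = right_gap t lam w v.
Proof.
move=> uw; congr (_ && _); apply: eq_in_all => j; rewrite mem_iota add0n => jt.
by rewrite uw.
Qed.

Lemma left_gap_local t lam u w v : (forall j, (j < t)%N -> u j = w j) ->
  left_gap t lam u v = left_gap t lam w v.
Proof.
move=> uw; congr (_ && _); apply: eq_in_all => j; rewrite mem_iota add0n => jt.
by rewrite uw.
Qed.

Lemma crowded_local n i t lam u w v :
  (forall j, (j != i) && (j != t) -> u j = w j) ->
  crowded n i t lam u v = crowded n i t lam w v.
Proof.
move=> uw; rewrite /crowded /near_others; congr (_ <= _%:R).
by apply: eq_bigr => j /uw ->.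
Qed.

Lemma crossing_local n m i t lam u w v :
  (forall j, (j != i) && (j != t) -> u j = w j) ->
  crossing n m i t lam u v = crossing n m i t lam w v.
Proof.
move=> uw; have H y : rank_others n i t u y = rank_others n i t w y.
  by apply: eq_bigr => j /uw ->.
by rewrite /crossing !H.
Qed.
End locality.

Section quant_moments.
Context {R : realType} (mu : probability (seeds R) R).
Hypothesis iid_mu : iid (unif R) mu.
Local Notation nu := (unif R).
Variables (b : R -> R -> R) (c eps p : R).
Hypotheses (mb : measurable_fun setT (fun z : R * R => b z.1 z.2))
  (b0 : forall x v, 0 <= b x v)
  (b_sing : forall x v, b x v <= c * `|x - v| `^ (- eps))
  (b_supp : forall x v, ~~ ((0 < x < 1) && (0 < v < 1)) -> b x v = 0)
  (c0 : 0 < c) (eps0 : 0 < eps) (p1 : 1 <= p) (eps_p : eps * p < 1).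

Let p0 : 0 < p. Proof. by apply: lt_le_trans p1. Qed.

Lemma kernel_powR_le x v : b x v `^ p <= c `^ p * `|x - v| `^ (- (eps * p)).
Proof.
rewrite -mulNr powRrM -powRM ?(ltW c0) ?powR_ge0//.
by apply: ge0_ler_powR; rewrite ?nnegrE ?(ltW p0)// mulr_ge0 ?powR_ge0// ltW.
Qed.

Definition kernel_const : R := c `^ p * sing_const (eps * p).

Lemma kernel_const_ge0 : 0 <= kernel_const.
Proof. by rewrite mulr_ge0 ?powR_ge0 ?sing_const_ge0. Qed.

Lemma integral_kernel_near (r v : R) : 0 < r ->
  (\int[nu]_x (b x v `^ p * (`|x - v| < r)%R%:R)%:E <=
   (kernel_const * r `^ (1 - eps * p))%:E)%E.
Proof.
move=> r0.
pose f x : R := if `|x - v| < r then `|x - v| `^ (- (eps * p)) else 0.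
have f0 x : 0 <= f x by rewrite /f; case: ifP => // _; rewrite powR_ge0.
have mf : measurable_fun setT f by rewrite /f; measurability.
apply: (@le_trans _ _ (\int[nu]_x (c `^ p * f x)%:E)%E).
  apply: le_int => x; rewrite lee_fin; first by rewrite mulr_ge0 ?powR_ge0.
  rewrite /f; case: (`|x - v| < r) => /=; last by rewrite !mulr0.
  by rewrite mulr1; exact: kernel_powR_le.
rewrite integral_EFinZl ?powR_ge0// /kernel_const -mulrA EFinM.
apply: lee_wpmul2l; first by rewrite lee_fin powR_ge0.
by apply: integral_sing_near => //; rewrite mulr_gt0.
Qed.

Lemma integral_kernel_powR (v : R) :
  (\int[nu]_x (b x v `^ p)%:E <= kernel_const%:E)%E.
Proof.
have := @integral_kernel_near 1 v ltr01; rewrite powR1 mulr1; apply: le_trans.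
apply: le_int => x; rewrite lee_fin ?powR_ge0//.
case: (boolP ((0 < x < 1) && (0 < v < 1))) => [xv|/b_supp ->]; last first.
  by rewrite powR0 ?gt_eqF// mul0r.
have -> : `|x - v| < 1 by rewrite ltr_norml; lra.
by rewrite mulr1.
Qed.

(** First summand: the two gaps and crowding, each with the full moment of the kernel. Second
    summand: Jensen's factor, the moment of the kernel within distance [lam], and the probability of
    [crossing]. *)
Definition moment_bound (t : nat) (lam : R) : R :=
  3 * kernel_const * expR (- (t%:R * lam)) +
  (9 * lam) `^ (p - 1) * (kernel_const * lam `^ (1 - eps * p) * (6 * lam)).

Lemma moment_quant_part n m t (lam : R) : 0 < lam <= 1 -> n%:R^-1 <= lam ->
  (t < n)%N ->
  (\int[mu]_u ((quant_part b n m t u / n%:R) `^ p)%:E <= (moment_bound t lam)%:E)%E.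
Proof.
move=> /[dup] lam01 /andP[lam0 lam1] nlam tn.
have n0 : (0 < n)%N by apply: leq_ltn_trans tn.
have nr0 : 0 < n%:R :> R by rewrite ltr0n.
have K0 := kernel_const_ge0.
have seedm i : measurable_fun setT (fun u : seeds R => u i) by exact: measurable_seed.
have idm : measurable_fun setT (fun u : seeds R => u) by exact: measurable_id.
have mR := @measurable_right_gap _ _ _ _ _ idm (seedm t) t lam.
have mL := @measurable_left_gap _ _ _ _ _ idm (seedm t) t lam.
have mC i := @measurable_crowded _ _ _ _ _ idm (seedm t) n i t lam.
have mX i := @measurable_crossing _ _ _ _ _ idm (seedm t) n m i t lam.
have mB i : measurable_fun setT (fun u : seeds R => b (u i) (u t) `^ p).
  by apply: measurable_powR_comp; apply: measurable_kernel_comp.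
have mN i : measurable_fun setT (fun u : seeds R => `|u i - u t| < lam) by measurability.
have nb (f : seeds R -> bool) : measurable_fun setT f ->
  measurable_fun setT (fun u => (f u)%:R : R) by exact: measurable_fun_natr_bool.
pose A : R := (9 * lam) `^ (p - 1).
have A0 : 0 <= A by rewrite powR_ge0.
pose X1 i (u : seeds R) : R := b (u i) (u t) `^ p * (right_gap t lam u (u t))%:R.
pose X2 i (u : seeds R) : R := b (u i) (u t) `^ p * (left_gap t lam u (u t))%:R.
pose X3 i (u : seeds R) : R := b (u i) (u t) `^ p * (crowded n i t lam u (u t))%:R.
pose X4 i (u : seeds R) : R := (b (u i) (u t) `^ p * (`|u i - u t| < lam)%R%:R) *
  (crossing n m i t lam u (u t))%:R.
have m1 i : measurable_fun setT (X1 i) by apply: measurable_funM => //; exact: nb.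
have m2 i : measurable_fun setT (X2 i) by apply: measurable_funM => //; exact: nb.
have m3 i : measurable_fun setT (X3 i) by apply: measurable_funM => //; exact: nb.
have m4 i : measurable_fun setT (X4 i).
  by apply: measurable_funM; [apply: measurable_funM => //|]; exact: nb.
have X10 i u : 0 <= X1 i u by rewrite mulr_ge0 ?powR_ge0.
have X20 i u : 0 <= X2 i u by rewrite mulr_ge0 ?powR_ge0.
have X30 i u : 0 <= X3 i u by rewrite mulr_ge0 ?powR_ge0.
have X40 i u : 0 <= X4 i u by rewrite !mulr_ge0 ?powR_ge0.
pose Y i u := X1 i u + (X2 i u + (X3 i u + A * X4 i u)).
have mY i : measurable_fun setT (Y i).
  by do 3 (apply: measurable_funD => //); apply: measurable_funM.
have Y0 i u : 0 <= Y i u by rewrite !addr_ge0// mulr_ge0.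
apply: (@le_trans _ _ (\int[mu]_u (n%:R^-1 * \sum_(t.+1 <= i < n) Y i u)%:E)%E).
  apply: le_int => u; rewrite lee_fin ?powR_ge0//.
  apply: le_trans (quant_part_bound _ _ _ b0 p1 lam0 nlam n0) _.
  apply: ler_wpM2l; first by rewrite invr_ge0 ltW.
  rewrite le_eqVlt; apply/orP; left; apply/eqP; apply: eq_bigr => i _.
  by rewrite /Y /X1 /X2 /X3 /X4 -/A; ring.
rewrite integral_EFinZl ?invr_ge0 ?(ltW nr0)//; [|exact: measurable_sum|by move=> u; apply: sumr_ge0].
rewrite integral_EFin_sum//.
have two_le i (q : R -> R -> R) (G : seeds R -> R -> bool) (Kq g : R) : (i != t)%N ->
  measurable_fun setT (fun z : R * R => q z.1 z.2) -> (forall x v, 0 <= q x v) ->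
  (forall v, \int[nu]_x (q x v)%:E <= Kq%:E)%E ->
  measurable_fun setT (fun z : R * seeds R => G z.2 z.1) ->
  (forall u v x, G (upd u t x) v = G u v) -> (forall u v x, G (upd u i x) v = G u v) ->
  (\int[nu]_v \int[mu]_u ((G u v)%:R : R)%:E <= g%:E)%E ->
  (\int[mu]_u (q (u i) (u t) * (G u (u t))%:R)%:E <= (Kq * g)%:E)%E.
  move=> it mq q0 Kq_ mG Gt Gi Gg.
  have Kq0 : 0 <= Kq.
    by rewrite -lee_fin; apply: le_trans (Kq_ 0); apply: integral_ge0 => x _; rewrite lee_fin.
  have := @int_two_le _ _ iid_mu i t q (fun u v => (G u v)%:R) Kq it mq q0 Kq_.
  move=> /(_ (measurable_fun_natr_bool mG) (fun _ _ => ler0n _ _)) H.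
  apply: le_trans (H _ _) _.
  - by move=> u v x; rewrite Gt.
  - by move=> u v x; rewrite Gi.
  by rewrite EFinM; apply: lee_wpmul2l.
have mid : measurable_fun setT (fun z : R * seeds R => z.2) by exact: measurable_snd.
have mid1 : measurable_fun setT (fun z : R * seeds R => z.1) by exact: measurable_fst.
have mbp : measurable_fun setT (fun z : R * R => b z.1 z.2 `^ p).
  exact: measurable_powR_comp.
have const_le (G : seeds R -> R -> bool) (g : R) :
  (forall v, \int[mu]_u ((G u v)%:R : R)%:E <= g%:E)%E ->
  (\int[nu]_v \int[mu]_u ((G u v)%:R : R)%:E <= g%:E)%E.
  by move=> Gg; apply: int_cst_le => // v; apply: integral_ge0 => u _; rewrite lee_fin.
have Yi i : (t < i < n)%N -> (\int[mu]_u (Y i u)%:E <= (moment_bound t lam)%:E)%E.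
  move=> /andP[ti iltn].
  have it : (i != t)%N by rewrite gtn_eqF.
  have ne j : (j < t)%N -> (j != i) && (j != t).
    by move=> jt; rewrite !ltn_eqF// (ltn_trans jt ti).
  set e := expR (- (t%:R * lam)).
  have I1 : (\int[mu]_u (X1 i u)%:E <= (kernel_const * e)%:E)%E.
    apply: (two_le i (fun x v => b x v `^ p) (fun u v => right_gap t lam u v)) => //.
    - by move=> x v; exact: powR_ge0.
    - exact: integral_kernel_powR.
    - exact: measurable_right_gap.
    - by move=> u v x; apply: right_gap_local => j /ne /andP[_ jt]; rewrite updN.
    - by move=> u v x; apply: right_gap_local => j /ne /andP[ji _]; rewrite updN.
    by apply: const_le => v; exact: right_gap_le.
  have I2 : (\int[mu]_u (X2 i u)%:E <= (kernel_const * e)%:E)%E.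
    apply: (two_le i (fun x v => b x v `^ p) (fun u v => left_gap t lam u v)) => //.
    - by move=> x v; exact: powR_ge0.
    - exact: integral_kernel_powR.
    - exact: measurable_left_gap.
    - by move=> u v x; apply: left_gap_local => j /ne /andP[_ jt]; rewrite updN.
    - by move=> u v x; apply: left_gap_local => j /ne /andP[ji _]; rewrite updN.
    by apply: const_le => v; exact: left_gap_le.
  have I3 : (\int[mu]_u (X3 i u)%:E <= (kernel_const * e)%:E)%E.
    apply: (two_le i (fun x v => b x v `^ p) (fun u v => crowded n i t lam u v)) => //.
    - by move=> x v; exact: powR_ge0.
    - exact: integral_kernel_powR.
    - exact: measurable_crowded.
    - by move=> u v x; apply: crowded_local => j /andP[_ jt]; rewrite updN.
    - by move=> u v x; apply: crowded_local => j /andP[ji _]; rewrite updN.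
    apply: const_le => v; apply: le_trans (crowded_le iid_mu n i t v lam0) _.
    by rewrite lee_fin ler_expR lerN2 ler_wpM2r ?(ltW lam0)// ler_nat ltnW.
  have I4 : (\int[mu]_u (X4 i u)%:E <=
      (kernel_const * lam `^ (1 - eps * p) * (6 * lam))%:E)%E.
    apply: (two_le i (fun x v => b x v `^ p * (`|x - v| < lam)%R%:R)
      (fun u v => crossing n m i t lam u v)) => //.
    - apply: measurable_funM => //; apply: measurable_fun_natr_bool; measurability.
    - by move=> x v; rewrite mulr_ge0 ?powR_ge0.
    - by move=> v; exact: integral_kernel_near.
    - exact: measurable_crossing.
    - by move=> u v x; apply: crossing_local => j /andP[_ jt]; rewrite updN.
    - by move=> u v x; apply: crossing_local => j /andP[ji _]; rewrite updN.
    have mcr : measurable_fun setT (fun z : R * seeds R =>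
        ((crossing n m i t lam z.2 z.1)%:R : R)%:E).
      by apply/measurable_EFinP/measurable_fun_natr_bool; exact: measurable_crossing.
    (* The order is exchanged because [crossing_le] fixes the other seeds and averages over the
       pivot, whereas the bounds for gaps and crowding fix the pivot. *)
    rewrite (fubini_tonelli _ mcr); last by move=> z; rewrite lee_fin.
    apply: int_cst_le => u; first by apply: integral_ge0 => v _; rewrite lee_fin.
    exact: crossing_le.
  rewrite /Y integral_EFinD//; last 2 first.
  - by do 2 (apply: measurable_funD => //); apply: measurable_funM.
  - by move=> u; rewrite !addr_ge0// mulr_ge0.
  rewrite integral_EFinD//; last 2 first.
  - by apply: measurable_funD => //; apply: measurable_funM.
  - by move=> u; rewrite !addr_ge0// mulr_ge0.
  rewrite integral_EFinD//; last 2 first.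
  - exact: measurable_funM.
  - by move=> u; rewrite mulr_ge0.
  rewrite integral_EFinZl//.
  have -> : moment_bound t lam = kernel_const * e + (kernel_const * e +
      (kernel_const * e + A * (kernel_const * lam `^ (1 - eps * p) * (6 * lam)))).
    by rewrite /moment_bound -/e -/A; ring.
  rewrite !EFinD; apply: leeD => //; apply: leeD => //; apply: leeD => //.
  rewrite [leRHS]EFinM; apply: lee_wpmul2l; rewrite ?lee_fin; [exact: A0|exact: I4].
have B0 : 0 <= moment_bound t lam.
  apply: addr_ge0; apply: mulr_ge0; rewrite ?expR_ge0 ?powR_ge0//.
    by rewrite mulr_ge0.
  exact: mulr_ge0 (mulr_ge0 K0 (powR_ge0 _ _)) (mulr_ge0 (ler0n _ 6) (ltW lam0)).
apply: (@le_trans _ _ (n%:R^-1%:E * (\sum_(t.+1 <= i < n) moment_bound t lam)%:E)%E).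
  apply: lee_wpmul2l; first by rewrite lee_fin invr_ge0 ltW.
  rewrite -sumEFin big_nat_cond [leRHS]big_nat_cond; apply: lee_sum => i.
  by rewrite andbT => /Yi.
rewrite -EFinM lee_fin mulrC ler_pdivrMr// sumr_const_nat -[leLHS]mulr_natr.
by apply: ler_wpM2l; rewrite ?ler_nat ?leq_subr; [exact: B0|].
Qed.

End quant_moments.

(** * Contributions at a fixed time *)

Section law_of_large_numbers.
Context {R : realType} (nu : probability R R) (mu : probability (seeds R) R).
Hypothesis iid_mu : iid nu mu.
Variables (t : nat) (f : seeds R -> R -> R) (M : R).
Hypotheses (mf : measurable_fun setT (fun z : seeds R * R => f z.1 z.2))
  (f0 : forall u x, 0 <= f u x) (fM : forall u x, f u x <= M)
  (f_local : forall u w x, (forall j, (j <= t)%N -> u j = w j) -> f u x = f w x).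

(** For [i > t], the conditional mean of [f u (u i)] given the seeds up to [t], since [f u] depends
    on these only. *)
Definition mean_of (u : seeds R) : R := fine (\int[nu]_x (f u x)%:E).

Lemma mean_ofE u : (mean_of u)%:E = (\int[nu]_x (f u x)%:E)%E.
Proof.
rewrite fineK// ge0_fin_numE; last by apply: integral_ge0 => x _; rewrite lee_fin.
have H : (\int[nu]_x (f u x)%:E <= M%:E)%E by apply: int_cst_le => x; rewrite lee_fin.
exact: le_lt_trans H (ltry _).
Qed.

Lemma mean_of_ge0 u : 0 <= mean_of u.
Proof. by apply: fine_ge0; apply: integral_ge0 => x _; rewrite lee_fin. Qed.

Lemma mean_of_le u : mean_of u <= M.
Proof.
by rewrite -lee_fin mean_ofE; apply: int_cst_le => x; rewrite lee_fin.
Qed.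

Lemma measurable_mean_of : measurable_fun setT mean_of.
Proof.
have mE : measurable_fun setT (fun z : seeds R * R => (f z.1 z.2)%:E).
  exact/measurable_EFinP.
have H := measurable_fun_fubini_tonelli_F (m2 := nu) _ mE
  (fun z => (f0 z.1 z.2 : (0 <= (f z.1 z.2)%:E)%E)).
exact: (measurableT_comp (fine_measurable measurableT) H).
Qed.

Let M0 : 0 <= M. Proof. exact: le_trans (f0 point 0) (fM point 0). Qed.

Let mfi i : measurable_fun setT (fun u : seeds R => f u (u i)).
Proof.
apply: (measurableT_comp (f := fun z : seeds R * R => f z.1 z.2) mf
  (g := fun u : seeds R => (u, u i))).
apply: measurable_fun_pair; [exact: measurable_id|exact: measurable_seed].
Qed.

Let mfu u : measurable_fun setT (f u).
Proof.
apply: (measurableT_comp (f := fun z : seeds R * R => f z.1 z.2) mf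
  (g := fun x => (u, x))).
apply: measurable_fun_pair; [exact: measurable_cst|exact: measurable_id].
Qed.

Let f_upd u i x : (t < i)%N -> f (upd u i x) = f u.
Proof.
move=> ti; apply/funext => y; apply: f_local => j jt.
by rewrite updN// ltn_eqF// (leq_ltn_trans jt).
Qed.

Let mean_upd u i x : (t < i)%N -> mean_of (upd u i x) = mean_of u.
Proof. by move=> ti; rewrite /mean_of f_upd. Qed.

Let e2 : R := fine (\int[mu]_u (mean_of u ^+ 2)%:E).

Let e2E : e2%:E = (\int[mu]_u (mean_of u ^+ 2)%:E)%E.
Proof.
rewrite fineK// ge0_fin_numE; last first.
  by apply: integral_ge0 => u _; rewrite lee_fin sqr_ge0.
have H : (\int[mu]_u (mean_of u ^+ 2)%:E <= (M ^+ 2)%:E)%E.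
  apply: int_cst_le => u; rewrite lee_fin ?sqr_ge0//.
  by apply: lerXn2r; rewrite ?nnegrE ?mean_of_ge0 ?mean_of_le.
exact: le_lt_trans H (ltry _).
Qed.

Let mean_cross i : (t < i)%N ->
  (\int[mu]_u (mean_of u * f u (u i))%:E = e2%:E)%E.
Proof.
move=> ti; rewrite (integral_resampleC iid_mu i); last 2 first.
- by apply/measurable_EFinP/measurable_funM => //; exact: measurable_mean_of.
- by move=> u; rewrite lee_fin mulr_ge0// mean_of_ge0.
rewrite e2E; apply: eq_integral => u _.
under eq_integral => x _ do rewrite mean_upd// f_upd// updE.
by rewrite integral_EFinZl// ?mean_of_ge0// -mean_ofE -EFinM expr2.
Qed.

Let cross i j : (t < i)%N -> (t < j)%N ->
  (\int[mu]_u (f u (u i) * f u (u j))%:E <= ((i == j)%:R * M ^+ 2 + e2)%:E)%E.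
Proof.
move=> ti tj; have e20 : 0 <= e2.
  by apply: fine_ge0; apply: integral_ge0 => u _; rewrite lee_fin sqr_ge0.
have [->|ij] := eqVneq i j.
  apply: int_cst_le => u; rewrite lee_fin ?mulr_ge0// mul1r.
  apply: ler_wpDr => //; rewrite expr2; exact: ler_pM.
rewrite mul0r add0r (integral_resampleC iid_mu i); last 2 first.
- by apply/measurable_EFinP/measurable_funM.
- by move=> u; rewrite lee_fin mulr_ge0.
rewrite -(mean_cross tj) le_eqVlt; apply/orP; left; apply/eqP.
apply: eq_integral => u _.
under eq_integral => x _.
  rewrite f_upd// updE updN 1?eq_sym// mulrC; over.
by rewrite integral_EFinZl// -mean_ofE -EFinM mulrC.
Qed.

(** Given the seeds up to [t], the terms are independent with mean [mean_of u]. In the expanded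
    square the second moment [e2] of that mean cancels, and only the diagonal is left, at most
    [M ^+ 2] per term. *)
Lemma variance_sum n :
  (\int[mu]_u ((\sum_(t.+1 <= i < n) f u (u i) - (n - t.+1)%:R * mean_of u) ^+ 2)%:E
   <= ((n - t.+1)%:R * M ^+ 2)%:E)%E.
Proof.
set N : R := (n - t.+1)%:R.
have N0 : 0 <= N by exact: ler0n.
pose X (u : seeds R) := \sum_(t.+1 <= i < n) f u (u i).
have X0 u : 0 <= X u by apply: sumr_ge0.
have mX : measurable_fun setT X by exact: measurable_sum.
have mJ := measurable_mean_of.
have mD : measurable_fun setT (fun u => (X u - N * mean_of u) ^+ 2).
  by apply: measurable_funX; apply: measurable_funB => //; exact: measurable_funM.
have XE : (\int[mu]_u (2 * N * (mean_of u * X u))%:E = (2 * N * (N * e2))%:E)%E.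
  rewrite integral_EFinZl; last 3 first.
  - exact: measurable_funM.
  - by move=> u; rewrite mulr_ge0// mean_of_ge0.
  - by rewrite mulr_ge0.
  rewrite [RHS]EFinM; congr (_ * _)%E.
  under eq_integral do rewrite mulr_sumr.
  rewrite integral_EFin_sum; last 2 first.
  - by move=> i; exact: measurable_funM.
  - by move=> i u; rewrite mulr_ge0// mean_of_ge0.
  rewrite big_nat_cond (eq_bigr (fun=> e2%:E)); last first.
    by move=> i /andP[/andP[ti _] _]; exact: mean_cross.
  by rewrite -big_nat_cond sumEFin sumr_const_nat mulr_natl.
have X2 : (\int[mu]_u (X u ^+ 2)%:E <= (N * M ^+ 2 + N ^+ 2 * e2)%:E)%E.
  rewrite (eq_integral (fun u => (\sum_(t.+1 <= i < n) \sum_(t.+1 <= j < n)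
      f u (u i) * f u (u j))%:E)); last first.
    move=> u _; rewrite expr2 /X mulr_suml; congr (_%:E).
    by apply: eq_bigr => i _; rewrite mulr_sumr.
  rewrite integral_EFin_sum; last 2 first.
  - by move=> i; apply: measurable_sum => j; exact: measurable_funM.
  - by move=> i u; apply: sumr_ge0 => j _; rewrite mulr_ge0.
  apply: (@le_trans _ _ (\sum_(t.+1 <= i < n) (M ^+ 2 + N * e2)%:E)%E); last first.
    rewrite sumEFin sumr_const_nat lee_fin -[leLHS]mulr_natl -/N.
    by rewrite le_eqVlt; apply/orP; left; apply/eqP; ring.
  rewrite big_nat_cond [leRHS]big_nat_cond; apply: lee_sum => i /andP[/andP[ti iltn] _].
  rewrite integral_EFin_sum; last 2 first.
  - by move=> j; exact: measurable_funM.
  - by move=> j u; rewrite mulr_ge0.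
  apply: (@le_trans _ _ (\sum_(t.+1 <= j < n) ((i == j)%:R * M ^+ 2 + e2)%:E)%E).
    rewrite big_nat_cond [leRHS]big_nat_cond; apply: lee_sum => j /andP[/andP[tj _] _].
    exact: cross.
  rewrite sumEFin lee_fin big_split/= sumr_const_nat -[e2 *+ _]mulr_natl -/N lerD2r.
  rewrite -mulr_suml -[leRHS]mul1r; apply: ler_wpM2r; first exact: sqr_ge0.
  rewrite -natr_sum -[1]/(1%:R) ler_nat.
  apply: (@leq_trans (\sum_(t.+1 <= j < n | j == i) 1)%N).
    by rewrite [leqRHS]big_mkcond/=; apply: leq_sum => j _; rewrite eq_sym; case: eqP.
  by rewrite big_nat1_eq; case: ifP.
(* The cross term stands on the left, so that every integrand is nonnegative; being finite, it is
   cancelled at the end. *)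
have sum_eq : (\int[mu]_u ((X u - N * mean_of u) ^+ 2)%:E + (2 * N * (N * e2))%:E =
    \int[mu]_u (X u ^+ 2)%:E + (N ^+ 2 * e2)%:E)%E.
  rewrite -XE -integral_EFinD//; last 3 first.
  - by apply: measurable_funM => //; exact: measurable_funM.
  - by move=> u; exact: sqr_ge0.
  - by move=> u; rewrite !mulr_ge0// mean_of_ge0.
  rewrite EFinM e2E -integral_EFinZl; last 3 first.
  - exact: measurable_funX.
  - by move=> u; exact: sqr_ge0.
  - exact: sqr_ge0.
  rewrite -integral_EFinD; last 4 first.
  - exact: measurable_funX.
  - by apply: measurable_funM => //; exact: measurable_funX.
  - by move=> u; exact: sqr_ge0.
  - by move=> u; rewrite mulr_ge0 ?sqr_ge0.
  by apply: eq_integral => u _; congr (_%:E); ring.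
have := leeD2r (N ^+ 2 * e2)%:E X2; rewrite -sum_eq -EFinD.
have -> : N * M ^+ 2 + N ^+ 2 * e2 + N ^+ 2 * e2 = N * M ^+ 2 + 2 * N * (N * e2) by ring.
by rewrite EFinD leeD2rE.
Qed.

(** Chebyshev's inequality. Dividing by [n] although only [n - t.+1] terms are summed shifts the
    average by at most [t.+1 * M / n], which accounts for the summand [t.+1 ^+ 2]. *)
Lemma deviation_le n (d : R) : (t < n)%N -> 0 < d ->
  (\int[mu]_u ((d < `|(\sum_(t.+1 <= i < n) f u (u i)) / n%:R - mean_of u|)%R%:R : R)%:E
   <= (2 * M ^+ 2 * (1 + t.+1%:R ^+ 2) / (d ^+ 2 * n%:R))%:E)%E.
Proof.
move=> tn d0; have nr0 : 0 < n%:R :> R by rewrite ltr0n (leq_ltn_trans _ tn).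
have nr1 : 1 <= n%:R :> R by rewrite ler1n (leq_ltn_trans _ tn).
set N : R := (n - t.+1)%:R.
have NE : N = n%:R - t.+1%:R by rewrite /N natrB.
pose X (u : seeds R) := \sum_(t.+1 <= i < n) f u (u i).
have mX : measurable_fun setT X by exact: measurable_sum.
have mJ := measurable_mean_of.
have mD : measurable_fun setT (fun u => (X u - N * mean_of u) ^+ 2).
  by apply: measurable_funX; apply: measurable_funB => //; exact: measurable_funM.
pose a : R := (d ^+ 2 * n%:R ^+ 2)^-1.
have a0 : 0 <= a by rewrite invr_ge0 mulr_ge0 ?sqr_ge0.
have a20 : 0 <= 2 * a := mulr_ge0 (ler0n _ 2) a0.
have b0 : 0 <= t.+1%:R ^+ 2 * M ^+ 2 := mulr_ge0 (sqr_ge0 _) (sqr_ge0 _).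
have ab0 : 0 <= 2 * a * (t.+1%:R ^+ 2 * M ^+ 2) := mulr_ge0 a20 b0.
apply: (@le_trans _ _ (\int[mu]_u (2 * a * ((X u - N * mean_of u) ^+ 2)
    + 2 * a * (t.+1%:R ^+ 2 * M ^+ 2))%:E)%E).
  apply: le_int => u; rewrite lee_fin//.
  set J := mean_of u; have J0 : 0 <= J := mean_of_ge0 u; have JM : J <= M := mean_of_le u.
  have rhs0 : 0 <= 2 * a * (X u - N * J) ^+ 2 + 2 * a * (t.+1%:R ^+ 2 * M ^+ 2).
    exact: addr_ge0 (mulr_ge0 a20 (sqr_ge0 _)) ab0.
  case: ltP => // dX.
  have E : X u / n%:R - J = (X u - N * J - t.+1%:R * J) / n%:R.
    by rewrite NE; field; rewrite gt_eqF.
  move: dX; rewrite E normrM [X in _ * X]ger0_norm ?invr_ge0 ?(ltW nr0)//.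
  rewrite ltr_pdivlMr// => dX.
  set Z := X u - N * J in dX *; set W := t.+1%:R * J in dX *.
  have dn0 : 0 <= d * n%:R by rewrite mulr_ge0// ltW.
  have : (d * n%:R) ^+ 2 <= (Z - W) ^+ 2.
    by rewrite -[leRHS]real_normK ?num_real// lerXn2r ?nnegrE// ltW.
  have W2 : W ^+ 2 <= t.+1%:R ^+ 2 * M ^+ 2.
    by rewrite exprMn ler_wpM2l ?sqr_ge0// lerXn2r ?nnegrE.
  have ZW : (Z - W) ^+ 2 <= 2 * Z ^+ 2 + 2 * W ^+ 2.
    by have := sqr_ge0 (Z + W); rewrite !expr2; lra.
  rewrite exprMn => H.
  have dn2 : 0 < d ^+ 2 * n%:R ^+ 2 by rewrite mulr_gt0 ?exprn_gt0.
  apply: (@le_trans _ _ (a * (d ^+ 2 * n%:R ^+ 2))); first by rewrite /a mulVf ?gt_eqF.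
  have -> : 2 * a * Z ^+ 2 + 2 * a * (t.+1%:R ^+ 2 * M ^+ 2) =
      a * (2 * Z ^+ 2 + 2 * (t.+1%:R ^+ 2 * M ^+ 2)) by ring.
  apply: ler_wpM2l => //; apply: le_trans H _; apply: le_trans ZW _.
  by rewrite lerD2l; apply: ler_wpM2l.
rewrite integral_EFinD; last 4 first.
- by apply: measurable_funM.
- exact: measurable_cst.
- by move=> u; exact: mulr_ge0 a20 (sqr_ge0 _).
- by move=> u; exact: ab0.
rewrite integral_EFinZl//; last by move=> u; exact: sqr_ge0.
rewrite integral_cst// [X in (_ + _ * X)%E]probability_setT mule1.
apply: (@le_trans _ _ ((2 * a)%:E * (N * M ^+ 2)%:E + (2 * a * (t.+1%:R ^+ 2 * M ^+ 2))%:E)%E).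
  apply: leeD => //; apply: lee_wpmul2l; first by rewrite lee_fin mulr_ge0.
  exact: variance_sum.
rewrite -EFinM -EFinD lee_fin.
have -> : 2 * M ^+ 2 * (1 + t.+1%:R ^+ 2) / (d ^+ 2 * n%:R) =
  2 * a * (n%:R * M ^+ 2) + 2 * a * (n%:R * (t.+1%:R ^+ 2 * M ^+ 2)).
  by rewrite /a; field; rewrite !gt_eqF.
apply: lerD; apply: ler_wpM2l => //.
  by apply: ler_wpM2r; rewrite ?sqr_ge0// NE lerBlDr lerDl.
by rewrite ler_peMl// mulr_ge0 ?sqr_ge0.
Qed.

End law_of_large_numbers.

(** * Comparison of ranks with the target rank and of seeds with [alpha] *)

Section agreement.
Context {R : realType} (mu : probability (seeds R) R).
Hypothesis iid_mu : iid (unif R) mu.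
Local Notation nu := (unif R).

Lemma integral_one_seed j (g : R -> R) : measurable_fun setT g ->
  (forall x, 0 <= g x) -> (\int[mu]_u (g (u j))%:E = \int[nu]_x (g x)%:E)%E.
Proof.
move=> mg g0; rewrite (integral_resampleC iid_mu j); last 2 first.
- by apply/measurable_EFinP; exact: (measurableT_comp mg (measurable_seed j)).
- by move=> u; rewrite lee_fin.
under eq_integral => u _.
  under eq_integral => x _ do rewrite updE.
  over.
by rewrite integral_cst// [X in (_ * X)%E]probability_setT mule1.
Qed.

Lemma unif_cdf (v : R) : 0 <= v <= 1 ->
  (\int[nu]_x ((x <= v)%R%:R : R)%:E = v%:E)%E.
Proof.
move=> /andP[v0 v1]; rewrite int_natr_bool; last by measurability.
have mS : measurable [set x : R | x <= v].
  have -> : [set x : R | x <= v] = `]-oo, v]%classic.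
    by apply/seteqP; split=> x /=; rewrite in_itv.
  exact: measurable_itv.
apply: etrans (unifE mS) _; rewrite (_ : _ `&` _ = `[0, v]%classic).
  rewrite lebesgue_measure_itv/= lte_fin; case: ltP => [_|v0']; first by rewrite sube0.
  by have -> : v = 0 by apply/eqP; rewrite eq_le v0 v0'.
by apply/seteqP; split=> x /=; rewrite !in_itv/=; lra.
Qed.

Definition val_lo alpha (u : nat -> R) j := (u j < alpha).
Definition val_hi alpha (u : nat -> R) j := (alpha < u j).
Definition val_survives alpha u := survives (val_lo alpha u) (val_hi alpha u) u.

Definition agree1 alpha n m u j :=
  (quant_lo n m u j == val_lo alpha u j) && (quant_hi n m u j == val_hi alpha u j).

Definition agree alpha n m t u := all (agree1 alpha n m u) (iota 0 t).

Lemma measurable_agree1 alpha n m j :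
  measurable_fun setT (fun u : seeds R => agree1 alpha n m u j).
Proof.
have idm : measurable_fun setT (fun u : seeds R => u) by exact: measurable_id.
have mr := @measurable_rank_below _ _ _ _ _ idm (measurable_seed j) n.
have mj : measurable_fun setT (fun u : seeds R => u j) := measurable_seed j.
have meq (f g : seeds R -> bool) : measurable_fun setT f -> measurable_fun setT g ->
    measurable_fun setT (fun u => f u == g u).
  move=> mf' mg'; rewrite (_ : (fun _ => _) = fun u => if f u then g u else ~~ g u); last first.
    by apply/funext => u; case: (f u); case: (g u).
  by apply: measurable_fun_ifT => //; exact: measurable_neg.
apply: measurable_and; apply: meq; rewrite /quant_lo /quant_hi /val_lo /val_hi.
- by apply: measurable_fun_ltn => //.
- by apply: measurable_fun_ltr => //.
- by apply: measurable_fun_ltn => //.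
- by apply: measurable_fun_ltr => //.
Qed.

Variables (alpha : R) (m : nat -> nat).
Hypothesis m_cvg : ((m n)%:R / n%:R : R) @[n --> \oo] --> alpha.

(** The relative rank of seed [j] tends to its value, the mean of [x <= u j] over a uniform [x],
    while [m n / n] tends to [alpha]. Up to a null event, the two comparisons can differ only if a
    deviation occurs or [u j] lies close to [alpha], and both are improbable. *)
Lemma disagree1_near j (e : R) : 0 < e ->
  \forall n \near \oo,
    (\int[mu]_u ((~~ agree1 alpha n (m n) u j)%:R : R)%:E <= e%:E)%E.
Proof.
move=> e0.
pose f (u : seeds R) (x : R) : R := (x <= u j)%R%:R.
have mf : measurable_fun setT (fun z : seeds R * R => f z.1 z.2).
  rewrite /f; apply: measurable_fun_natr_bool; apply: measurable_fun_ler.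
    exact: measurable_snd.
  exact: (measurableT_comp (measurable_seed j) measurable_fst).
have f0 u x : 0 <= f u x by rewrite /f ler0n.
have f1 u x : f u x <= 1 by rewrite /f; case: (x <= u j); rewrite ?lexx ?ler01.
have f_local u w x : (forall k, (k <= j)%N -> u k = w k) -> f u x = f w x.
  by move=> uw; rewrite /f uw.
(* Seed [j] lies within [2 * d] of [alpha] with probability at most [4 * d = e / 4]. The margin
   [2 * d] covers the errors of the relative rank and of [m n / n], at most [d] each. *)
pose d : R := e / 16.
have d0 : 0 < d by rewrite divr_gt0.
have /cvgrPdist_lt /(_ _ d0) mclose := m_cvg.
(* The first bound keeps the share of the seeds up to [j], which the law of large numbers omits,
   below [d / 2] in the relative rank; the second gives a deviation beyond [d / 2] probability at
   most [e / 2]. *)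
pose bigN : R := Num.max (j.+1%:R / (d / 2)) (2 * (1 + j.+1%:R ^+ 2) / ((d / 2) ^+ 2 * (e / 2))).
near=> n.
have nN : bigN <= n%:R by near: n; exact: nbhs_infty_ger.
have jn : (j < n)%N by near: n; exact: nbhs_infty_gt.
have nr0 : 0 < n%:R :> R by rewrite ltr0n (leq_ltn_trans _ jn).
have nj : j.+1%:R / n%:R <= d / 2.
  have : j.+1%:R / (d / 2) <= n%:R by apply: le_trans nN; rewrite le_max lexx.
  by rewrite ler_pdivrMr ?divr_gt0// ler_pdivrMr// mulrC.
have ndev : 2 * (1 + j.+1%:R ^+ 2) / ((d / 2) ^+ 2 * n%:R) <= e / 2.
  have : 2 * (1 + j.+1%:R ^+ 2) / ((d / 2) ^+ 2 * (e / 2)) <= n%:R.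
    by apply: le_trans nN; rewrite le_max lexx orbT.
  have dd : 0 < (d / 2) ^+ 2 by rewrite exprn_gt0// divr_gt0.
  rewrite ler_pdivrMr ?mulr_gt0 ?divr_gt0// => H; rewrite ler_pdivrMr ?mulr_gt0//.
  by apply: le_trans H _; rewrite le_eqVlt; apply/orP; left; apply/eqP; ring.
have mn : `|alpha - (m n)%:R / n%:R| < d by near: n.
pose dev u := (d / 2 < `|(\sum_(j.+1 <= i < n) f u (u i)) / n%:R - mean_of (unif R) f u|).
have mdev : measurable_fun setT dev.
  apply: measurable_fun_ltr => //; apply: measurable_norm_comp.
  apply: measurable_funB; last exact: (measurable_mean_of _ mf f0).
  apply: measurable_funM => //; apply: measurable_sum => i; rewrite /f.
  apply: measurable_fun_natr_bool; measurability.
pose out (u : seeds R) := ~~ (0 < u j < 1).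
have mout : measurable_fun setT out by rewrite /out; measurability.
pose cl (u : seeds R) := `|u j - alpha| < 2 * d.
have mcl : measurable_fun setT cl by rewrite /cl; measurability.
have nb := @measurable_fun_natr_bool _ (seeds R) R.
apply: (@le_trans _ _ (\int[mu]_u ((out u)%:R + ((cl u)%:R + (dev u)%:R : R))%:E)%E).
  apply: le_int => u; rewrite lee_fin//.
  case: (boolP (out u)) => [_|]; first by case: (~~ _); rewrite ?lerDl ?addr_ge0.
  rewrite negbK => /andP[u0 u1].
  case: (boolP (cl u)) => [_|]; first by rewrite add0r; case: (~~ _); rewrite ?lerDl ?addr_ge0.
  rewrite /cl -leNgt => far.
  case: (boolP (dev u)) => [_|]; first by rewrite !add0r; case: (~~ _).
  rewrite /dev -leNgt !add0r.
  have -> : mean_of (unif R) f u = u j.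
    by rewrite /mean_of unif_cdf// !ltW.
  move=> dv; rewrite [X in ~~ X](_ : _ = true)//.
  set r := rank_below n u (u j).
  have rE : r%:R = \sum_(0 <= i < j.+1) f u (u i) + \sum_(j.+1 <= i < n) f u (u i).
    by rewrite -big_cat_nat// /r /rank_below natr_sum.
  have s0 : 0 <= \sum_(0 <= i < j.+1) f u (u i) by apply: sumr_ge0.
  have s1 : \sum_(0 <= i < j.+1) f u (u i) <= j.+1%:R.
    apply: le_trans (ler_sum _ (fun i _ => f1 u (u i))) _.
    by rewrite sumr_const_nat subn0.
  have q0 : 0 <= (\sum_(0 <= i < j.+1) f u (u i)) / n%:R by rewrite divr_ge0// ltW.
  have q1 : (\sum_(0 <= i < j.+1) f u (u i)) / n%:R <= d / 2.
    by apply: le_trans nj; rewrite ler_wpM2r// invr_ge0 ltW.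
  have rn : `|r%:R / n%:R - u j| <= d.
    rewrite rE mulrDl; move: dv q0 q1.
    move: (_ / n%:R) (_ / n%:R) => x y; rewrite !ler_norml; lra.
  have cmp k : (k%:R < r%:R :> R) = (k%:R / n%:R < r%:R / n%:R :> R).
    by rewrite ltr_pM2r// invr_gt0.
  have lo : (r < m n)%N = (u j < alpha).
    rewrite -(ltr_nat R) -(ltr_pM2r (x := n%:R^-1)) ?invr_gt0//.
    move: rn mn far; rewrite ler_norml ltr_norml ler_normr.
    move: (r%:R / n%:R) ((m n)%:R / n%:R) => x y h1 h2 h3.
    by apply/idP/idP; lra.
  have hi : (m n < r)%N = (alpha < u j).
    rewrite -(ltr_nat R) -(ltr_pM2r (x := n%:R^-1)) ?invr_gt0//.
    move: rn mn far; rewrite ler_norml ltr_norml ler_normr.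
    move: (r%:R / n%:R) ((m n)%:R / n%:R) => x y h1 h2 h3.
    by apply/idP/idP; lra.
  by rewrite /agree1 /quant_lo /quant_hi -/r lo hi /val_lo /val_hi !eqxx.
rewrite integral_EFinD//; [|exact: nb|by apply: measurable_funD; exact: nb].
rewrite integral_EFinD//; [|exact: nb|exact: nb].
have -> : e%:E = (0%:E + ((2 * (2 * d))%:E + (e - 4 * d)%:E))%E.
  by rewrite -!EFinD; congr (_%:E); ring.
apply: leeD; last apply: leeD.
- rewrite (@integral_one_seed j (fun x => (~~ (0 < x < 1))%:R))//.
    by rewrite integral_unif_outside// subr0 subrr.
  by apply: measurable_fun_natr_bool; measurability.
- rewrite (@integral_one_seed j (fun x => (`|x - alpha| < 2 * d)%R%:R))//.
    rewrite int_natr_bool; last by measurability.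
    by apply: unif_near; rewrite mulr_ge0// ltW.
  by apply: measurable_fun_natr_bool; measurability.
- have d20 : 0 < d / 2 by rewrite divr_gt0.
  apply: le_trans (deviation_le iid_mu mf f0 f1 f_local jn d20) _.
  rewrite lee_fin expr1n mulr1; apply: le_trans ndev _; rewrite /d; lra.
Unshelve. all: by end_near.
Qed.

Lemma disagree_near t (e : R) : 0 < e ->
  \forall n \near \oo,
    (\int[mu]_u ((~~ agree alpha n (m n) t u)%:R : R)%:E <= e%:E)%E.
Proof.
elim: t e => [|t IH] e e0.
  apply: nearW => n; apply: int_cst_le => u; rewrite lee_fin//=; exact: ltW.
have e20 : 0 < e / 2 by rewrite divr_gt0.
near=> n.
have H1 : (\int[mu]_u ((~~ agree alpha n (m n) t u)%:R : R)%:E <= (e / 2)%:E)%E.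
  by near: n; exact: IH.
have H2 : (\int[mu]_u ((~~ agree1 alpha n (m n) u t)%:R : R)%:E <= (e / 2)%:E)%E.
  by near: n; exact: disagree1_near.
have m1 k : measurable_fun setT (fun u : seeds R => ~~ agree1 alpha n (m n) u k).
  by apply: measurable_neg; exact: measurable_agree1.
have mA : measurable_fun setT (fun u : seeds R => ~~ agree alpha n (m n) t u).
  by apply: measurable_neg; apply: measurable_all => k; exact: measurable_agree1.
rewrite [e]splitr EFinD; apply: le_trans (leeD H1 H2).
rewrite -integral_EFinD//; try exact: measurable_fun_natr_bool.
apply: le_int => u; rewrite lee_fin// /agree -addn1 iotaD all_cat/= andbT negb_and.
by case: (~~ _); case: (~~ _); rewrite /= ?lerDl ?lerDr.
Unshelve. all: by end_near.
Qed.

End agreement.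

(** * Convergence of a single contribution in L^p *)

Section fixed_pivot.
Context {R : realType} (mu : probability (seeds R) R).
Hypothesis iid_mu : iid (unif R) mu.
Local Notation nu := (unif R).

(** The contribution [s t]. For the kernels below the integral is finite, so that [fine] does not
    replace an infinite cost by 0. *)
Definition val_part (b : R -> R -> R) alpha t (u : nat -> R) : R :=
  if val_survives alpha u t (u t) then
    fine (\int[nu]_x ((val_survives alpha u t x)%:R * b x (u t))%:E)
  else 0.

Variables (b : R -> R -> R) (c eps p : R).
Implicit Types r : R.
Hypotheses (mb : measurable_fun setT (fun z : R * R => b z.1 z.2))
  (b0 : forall x v, 0 <= b x v)
  (b_sing : forall x v, b x v <= c * `|x - v| `^ (- eps))
  (b_supp : forall x v, ~~ ((0 < x < 1) && (0 < v < 1)) -> b x v = 0)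
  (c0 : 0 < c) (eps0 : 0 < eps) (p1 : 1 <= p) (eps_p : eps * p < 1).
Variables (alpha : R) (m : nat -> nat).
Hypothesis m_cvg : ((m n)%:R / n%:R : R) @[n --> \oo] --> alpha.

Let p0 : 0 < p. Proof. by apply: lt_le_trans p1. Qed.

Let eps1 : eps < 1.
Proof.
by apply: le_lt_trans eps_p; rewrite ler_peMr// ltW.
Qed.

Definition near_part (r x v : R) : R := b x v * (`|x - v| < r)%R%:R.
Definition far_part (r x v : R) : R := b x v * (~~ (`|x - v| < r)%R)%:R.

Lemma near_far (r : R) x v : b x v = far_part r x v + near_part r x v.
Proof. by rewrite /far_part /near_part; case: (_ < _); rewrite /= ?mulr0 ?mulr1 ?add0r ?addr0. Qed.

Lemma near_part_ge0 (r : R) x v : 0 <= near_part r x v.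
Proof. by rewrite mulr_ge0. Qed.

Lemma far_part_ge0 (r : R) x v : 0 <= far_part r x v.
Proof. by rewrite mulr_ge0. Qed.

Lemma far_part_le (r : R) x v : 0 < r -> far_part r x v <= c * r `^ (- eps).
Proof.
move=> r0; rewrite /far_part; case: ltP => [_|rx] /=.
  by rewrite mulr0 mulr_ge0 ?powR_ge0// ltW.
rewrite mulr1; apply: le_trans (b_sing _ _) _; apply: ler_wpM2l; first exact: ltW.
rewrite !powRN lef_pV2 ?posrE ?powR_gt0//; last exact: lt_le_trans rx.
by apply: ge0_ler_powR; rewrite ?nnegrE// ltW.
Qed.

Lemma measurable_near_part (r : R) : measurable_fun setT (fun z : R * R => near_part r z.1 z.2).
Proof. by apply: measurable_funM => //; apply: measurable_fun_natr_bool; measurability. Qed.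

Lemma measurable_far_part (r : R) : measurable_fun setT (fun z : R * R => far_part r z.1 z.2).
Proof. by apply: measurable_funM => //; apply: measurable_fun_natr_bool; measurability. Qed.

Lemma measurable_val_survives d (X : measurableType d) (f : X -> seeds R) (g : X -> R) t :
  measurable_fun setT f -> measurable_fun setT g ->
  measurable_fun setT (fun x => val_survives alpha (f x) t (g x)).
Proof.
move=> mf mg; apply: (@measurable_survives _ _ _ f g mf mg
  (fun j x => val_lo alpha (f x) j) (fun j x => val_hi alpha (f x) j)) => j.
  by rewrite /val_lo; measurability.
by rewrite /val_hi; measurability.
Qed.

Lemma measurable_val_survives1 u t : measurable_fun setT (fun x => val_survives alpha u t x).
Proof.
apply: (@measurable_val_survives _ R (fun=> u : seeds R)) => //; exact: measurable_cst.
Qed.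

Lemma integral_near_part_le (r : R) v : 0 < r ->
  (\int[nu]_x (near_part r x v)%:E <= (c * sing_const eps * r `^ (1 - eps))%:E)%E.
Proof.
move=> r0.
have := @integral_kernel_near R b c eps 1 b0 b_sing c0 eps0 (lexx 1).
rewrite mulr1 => /(_ eps1 r v r0).
rewrite /kernel_const mulr1 powRr1 ?(ltW c0)//; apply: le_trans.
apply: le_int => x; rewrite lee_fin ?near_part_ge0//.
by rewrite powRr1.
Qed.

Lemma integral_val_near_le (r : R) t u v : 0 < r ->
  (\int[nu]_x ((val_survives alpha u t x)%:R * near_part r x v)%:E <=
   (c * sing_const eps * r `^ (1 - eps))%:E)%E.
Proof.
move=> r0; apply: le_trans (integral_near_part_le v r0).
apply: le_int => x; rewrite lee_fin; first by rewrite mulr_ge0// near_part_ge0.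
by rewrite ler_piMl ?near_part_ge0//; case: (val_survives _ _ _ _); rewrite ?lexx ?ler01.
Qed.

Lemma val_part_near_le (r : R) t u : 0 < r ->
  0 <= val_part (near_part r) alpha t u <= c * sing_const eps * r `^ (1 - eps).
Proof.
move=> r0.
have C0 : 0 <= c * sing_const eps * r `^ (1 - eps).
  exact: mulr_ge0 (mulr_ge0 (ltW c0) (sing_const_ge0 eps1)) (powR_ge0 _ _).
rewrite /val_part; case: ifP => _; last by rewrite lexx.
have H := integral_val_near_le t u (u t) r0.
have H0 : (0 <= \int[nu]_x ((val_survives alpha u t x)%:R * near_part r x (u t))%:E)%E.
  by apply: integral_ge0 => x _; rewrite lee_fin mulr_ge0// near_part_ge0.
rewrite fine_ge0//= -lee_fin fineK// ge0_fin_numE//; exact: le_lt_trans H (ltry _).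
Qed.

(** The survival of the pivot enters as a factor, so that the law of large numbers applies on the
    whole space and [mean_of] yields [val_part] of the far part. *)
Definition far_cost (r : R) t (u : seeds R) (x : R) : R :=
  (val_survives alpha u t (u t))%:R * ((val_survives alpha u t x)%:R * far_part r x (u t)).

Lemma far_cost_ge0 (r : R) t u x : 0 <= far_cost r t u x.
Proof. by rewrite !mulr_ge0// far_part_ge0. Qed.

Lemma far_cost_le (r : R) t u x : 0 < r -> far_cost r t u x <= c * r `^ (- eps).
Proof.
move=> r0; apply: le_trans (far_part_le x (u t) r0).
rewrite /far_cost; have := far_part_ge0 r x (u t) => F0.
by case: (val_survives _ _ _ _); case: (val_survives _ _ _ _); rewrite ?mul1r ?mul0r.
Qed.

Lemma measurable_far_cost (r : R) t :
  measurable_fun setT (fun z : seeds R * R => far_cost r t z.1 z.2).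
Proof.
have m1 : measurable_fun setT (fun z : seeds R * R => z.1) by exact: measurable_fst.
have m2 : measurable_fun setT (fun z : seeds R * R => z.2) by exact: measurable_snd.
have m3 : measurable_fun setT (fun z : seeds R * R => z.1 t) by exact: measurable_seed_comp.
apply: measurable_funM; last apply: measurable_funM.
- by apply: measurable_fun_natr_bool; exact: measurable_val_survives.
- by apply: measurable_fun_natr_bool; exact: measurable_val_survives.
- apply: measurable_kernel_comp => //; exact: measurable_far_part.
Qed.

Lemma val_survives_local t u w x : (forall j, (j <= t)%N -> u j = w j) ->
  val_survives alpha u t x = val_survives alpha w t x.
Proof.
move=> uw; congr (_ && _); apply: eq_in_all => j; rewrite mem_iota add0n => jt.
by rewrite /val_lo /val_hi uw// ltnW.
Qed.

Lemma far_cost_local (r : R) t u w x : (forall j, (j <= t)%N -> u j = w j) ->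
  far_cost r t u x = far_cost r t w x.
Proof.
move=> uw; rewrite /far_cost (uw t (leqnn t)).
by rewrite !(@val_survives_local t u w).
Qed.

Lemma mean_far_cost (r : R) t u : mean_of nu (far_cost r t) u = val_part (far_part r) alpha t u.
Proof.
rewrite /mean_of /val_part /far_cost; case: (val_survives alpha u t (u t)).
  by congr fine; apply: eq_integral => x _; rewrite mul1r.
by rewrite (eq_integral (cst 0%E)) ?integral0// => x _; rewrite mul0r.
Qed.

Lemma val_part_split (r : R) t u : 0 < r ->
  val_part b alpha t u = val_part (far_part r) alpha t u + val_part (near_part r) alpha t u.
Proof.
move=> r0; rewrite /val_part; case: ifP => _; last by rewrite addr0.
have mu1 (k : R -> R -> R) : measurable_fun setT (fun z : R * R => k z.1 z.2) ->
    measurable_fun setT (fun x => (val_survives alpha u t x)%:R * k x (u t)).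
  move=> mk; apply: measurable_funM; last exact: measurable_kernel_comp.
  by apply: measurable_fun_natr_bool; exact: measurable_val_survives1.
rewrite -fineD.
- congr fine; rewrite -integral_EFinD.
  + by apply: eq_integral => x _; rewrite (near_far r) mulrDr.
  + exact: (mu1 _ (measurable_far_part r)).
  + exact: (mu1 _ (measurable_near_part r)).
  + by move=> x; rewrite mulr_ge0// far_part_ge0.
  + by move=> x; rewrite mulr_ge0// near_part_ge0.
- rewrite ge0_fin_numE; last by apply: integral_ge0 => x _; rewrite lee_fin mulr_ge0// far_part_ge0.
  apply: (@le_lt_trans _ _ (c * r `^ (- eps))%:E); last exact: ltry.
  apply: int_cst_le => x; rewrite lee_fin; first by rewrite mulr_ge0// far_part_ge0.
  apply: le_trans (far_part_le x (u t) r0).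
  by rewrite ler_piMl ?far_part_ge0//; case: (val_survives _ _ _ _); rewrite ?lexx ?ler01.
- rewrite ge0_fin_numE; last by apply: integral_ge0 => x _; rewrite lee_fin mulr_ge0// near_part_ge0.
  exact: le_lt_trans (integral_val_near_le t u (u t) r0) (ltry _).
Qed.

Lemma val_part_ge0 t u : 0 <= val_part b alpha t u.
Proof.
rewrite /val_part; case: ifP => // _; apply: fine_ge0.
by apply: integral_ge0 => x _; rewrite lee_fin mulr_ge0.
Qed.

Lemma quant_part_split (r : R) n k t u :
  quant_part b n k t u = quant_part (far_part r) n k t u + quant_part (near_part r) n k t u.
Proof.
rewrite /quant_part; case: ifP => _; last by rewrite addr0.
by rewrite -big_split; apply: eq_bigr => i _; exact: near_far.
Qed.

Lemma quant_part_ge0 (k : R -> R -> R) n j t u : (forall x v, 0 <= k x v) ->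
  0 <= quant_part k n j t u.
Proof. by move=> k0; rewrite /quant_part; case: ifP => // _; apply: sumr_ge0. Qed.

(** Survival is dropped, and Jensen's inequality is applied with at most [n] weights [1 / n]. The
    bound does not depend on [n] and vanishes with [r], as [eps * p < 1]. *)
Lemma quant_part_near_powR (r : R) n k t : 0 < r -> (0 < n)%N ->
  (\int[mu]_u ((quant_part (near_part r) n k t u / n%:R) `^ p)%:E <=
   (kernel_const c eps p * r `^ (1 - eps * p))%:E)%E.
Proof.
move=> r0 n0; have nr0 : 0 < n%:R :> R by rewrite ltr0n.
have ni0 : 0 <= n%:R^-1 :> R by rewrite invr_ge0 ltW.
pose q x v := b x v `^ p * (`|x - v| < r)%R%:R.
have q0 x v : 0 <= q x v by rewrite mulr_ge0 ?powR_ge0.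
have mq : measurable_fun setT (fun z : R * R => q z.1 z.2).
  apply: measurable_funM; first exact: measurable_powR_comp.
  by apply: measurable_fun_natr_bool; measurability.
have mqi i : measurable_fun setT (fun u : seeds R => q (u i) (u t)).
  by apply: measurable_kernel_comp => //; exact: measurable_seed.
set B := kernel_const c eps p * r `^ (1 - eps * p).
apply: (@le_trans _ _ (\int[mu]_u (n%:R^-1 * \sum_(t.+1 <= i < n) q (u i) (u t))%:E)%E).
  apply: le_int => u; rewrite lee_fin ?powR_ge0//.
  have rhs0 : 0 <= n%:R^-1 * \sum_(t.+1 <= i < n) q (u i) (u t).
    by rewrite mulr_ge0// sumr_ge0.
  rewrite /quant_part; case: ifP => _; last by rewrite mul0r powR0// gt_eqF.
  apply: (@le_trans _ _ ((n%:R^-1 * \sum_(t.+1 <= i < n) near_part r (u i) (u t)) `^ p)).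
    apply: ge0_ler_powR; rewrite ?nnegrE ?(ltW p0)//.
    - by rewrite mulr_ge0// sumr_ge0// => i _; exact: near_part_ge0.
    - by rewrite mulr_ge0// sumr_ge0// => i _; exact: near_part_ge0.
    rewrite mulrC; apply: ler_wpM2l => //; rewrite big_mkcond/=; apply: ler_sum => i _.
    by case: ifP => // _; exact: near_part_ge0.
  have W : \sum_(t.+1 <= i < n) n%:R^-1 <= 1 :> R.
    rewrite sumr_const_nat -[leLHS]mulr_natl ler_pdivrMr// mul1r ler_nat.
    exact: leq_subr.
  have := @powR_sum_weights _ _ (index_iota t.+1 n) xpredT p (fun=> n%:R^-1)
    (fun i => n%:R^-1 * near_part r (u i) (u t)) p1.
  rewrite invr_gt0 => /(_ (fun=> nr0)) H; rewrite mulr_sumr; apply: le_trans (H _ W) _.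
    by move=> i; rewrite mulr_ge0// near_part_ge0.
  rewrite mulr_sumr; apply: ler_sum => i _.
  rewrite powRM ?near_part_ge0// mulrA -powRD; last first.
    by apply/implyP => _; rewrite gt_eqF// invr_gt0.
  rewrite subrK powRr1//; apply: ler_wpM2l => //.
  rewrite /near_part /q; case: (_ < _) => /=; first by rewrite !mulr1.
  by rewrite !mulr0 powR0// gt_eqF.
rewrite integral_EFinZl//; last 2 first.
- exact: measurable_sum.
- by move=> u; apply: sumr_ge0.
rewrite integral_EFin_sum//.
have B0 : 0 <= B by rewrite mulr_ge0 ?powR_ge0 ?(kernel_const_ge0 _ eps_p).
apply: (@le_trans _ _ (n%:R^-1%:E * (\sum_(t.+1 <= i < n) B)%:E)%E).
  apply: lee_wpmul2l; first by rewrite lee_fin.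
  rewrite -sumEFin big_nat_cond [leRHS]big_nat_cond; apply: lee_sum => i.
  move=> /andP[/andP[ti _] _].
  have it : i != t by rewrite gtn_eqF.
  have := @int_two_le _ _ iid_mu i t q (fun _ _ => 1) B it mq q0.
  move=> /(_ _ (measurable_cst _) _ _ _) H.
  under eq_integral do rewrite -[q _ _]mulr1.
  apply: le_trans (H _ _ _ _) _ => //.
    by move=> v; exact: integral_kernel_near.
  rewrite -[leRHS]mule1; apply: lee_wpmul2l; first by rewrite lee_fin.
  apply: int_cst_le => v; first by apply: integral_ge0.
  by apply: int_cst_le.
rewrite -EFinM lee_fin mulrC ler_pdivrMr// sumr_const_nat -[leLHS]mulr_natr.
by apply: ler_wpM2l; rewrite ?ler_nat ?leq_subr.
Qed.

Lemma powR_small (a y : R) : 0 < a -> 0 < y -> exists2 r, 0 < r <= 1 & r `^ a <= y.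
Proof.
move=> a0 y0; exists (Num.min 1 (y `^ a^-1)).
  by rewrite lt_min ltr01 powR_gt0// ge_min lexx.
apply: (@le_trans _ _ ((y `^ a^-1) `^ a)).
  apply: ge0_ler_powR; rewrite ?nnegrE ?(ltW a0) ?powR_ge0//.
    by rewrite le_min ler01 powR_ge0.
  by rewrite ge_min lexx orbT.
by rewrite -powRrM mulVf ?gt_eqF// powRr1// ltW.
Qed.

Lemma powR_sum3 (x y z : R) : 0 <= x -> 0 <= y -> 0 <= z ->
  (x + (y + z)) `^ p <= 3 `^ (p - 1) * (x `^ p + (y `^ p + z `^ p)).
Proof.
move=> x0 y0 z0.
(* The summands index themselves; [Num.max 0] leaves them unchanged and makes the family nonnegative
   on all of [R]. *)
have := @powR_sum_count R R [:: x; y; z] xpredT p (Num.max 0) p1.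
rewrite !big_cons !big_nil !addr0 !max_r// => /(_ (fun i => _)) H.
have -> : 3 = 1 + (1 + 1) :> R by ring.
by apply: H => i; rewrite le_max lexx.
Qed.

(** Pointwise estimate behind [part_cvg]: [q] and [v] stand for the finite sample and the limit, the
    suffixes [f] and [n] for far from and near the diagonal, [a] for agreement and [dv] for a
    deviation. The term [qn] is kept because it is small only in the mean. *)
Lemma split_bound (eta M C qf qn vf vn : R) (a dv : bool) :
  0 <= eta -> 0 <= M -> 0 <= qf <= M -> 0 <= vf <= M -> 0 <= qn -> 0 <= vn <= C ->
  (a -> ~~ dv -> `|qf - vf| <= eta) ->
  `|qf + qn - (vf + vn)| `^ p <= 3 `^ (p - 1) * (eta `^ p + C `^ p) +
    (3 `^ (p - 1) * M `^ p * ((~~ a)%:R + dv%:R) + 3 `^ (p - 1) * qn `^ p).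
Proof.
move=> eta0 M0 /andP[qf0 qfM] /andP[vf0 vfM] qn0 /andP[vn0 vnC] dev.
have tri : `|qf + qn - (vf + vn)| <= `|qf - vf| + (vn + qn).
  have -> : qf + qn - (vf + vn) = (qf - vf) + (qn - vn) by ring.
  apply: le_trans (ler_normD _ _) _; rewrite lerD2l ler_norml.
  by apply/andP; split; lra.
have mono x y : 0 <= x -> x <= y -> x `^ p <= y `^ p.
  move=> x0 xy; apply: ge0_ler_powR => //; rewrite ?nnegrE ?(ltW p0)//.
  exact: le_trans xy.
have main : `|qf - vf| `^ p <= eta `^ p + M `^ p * ((~~ a)%:R + dv%:R).
  have [/andP[a_ dv_]|bad] := boolP (a && ~~ dv).
    apply: (@le_trans _ _ (eta `^ p)); first by apply: mono => //; exact: dev.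
    by rewrite lerDl mulr_ge0 ?powR_ge0.
  apply: (@le_trans _ _ (M `^ p)).
    by apply: mono => //; rewrite ler_norml; apply/andP; split; lra.
  apply: (@le_trans _ _ (M `^ p * ((~~ a)%:R + dv%:R))); last by rewrite lerDr powR_ge0.
  rewrite ler_peMr ?powR_ge0//.
  by case: a dv bad {dev} => -[] //=; rewrite ?addr0 ?add0r// lerDl.
move: (powR_ge0 3 (p - 1)) main => T0 main.
apply: (@le_trans _ _ (3 `^ (p - 1) * (`|qf - vf| `^ p + (vn `^ p + qn `^ p)))).
  apply: le_trans (powR_sum3 _ _ _) => //; apply: mono => //.
have Cm : vn `^ p <= C `^ p by exact: mono.
set T := 3 `^ (p - 1) in T0 *.
have -> : T * (eta `^ p + C `^ p) + (T * M `^ p * ((~~ a)%:R + dv%:R) + T * qn `^ p) =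
  T * ((eta `^ p + M `^ p * ((~~ a)%:R + dv%:R)) + (C `^ p + qn `^ p)).
  by ring.
by apply: ler_wpM2l => //; apply: lerD => //; rewrite lerD2r.
Qed.

Lemma quant_part_far n k t u : agree alpha n k t u -> forall r,
  quant_part (far_part r) n k t u = \sum_(t.+1 <= i < n) far_cost r t u (u i).
Proof.
move=> /allP agr r.
have E x : quant_survives n k u t x = val_survives alpha u t x.
  congr (_ && _); apply: eq_in_all => j /agr /andP[/eqP -> /eqP ->].
  by [].
rewrite /quant_part E /far_cost; case: (val_survives alpha u t (u t)); last first.
  by rewrite big1// => i _; rewrite mul0r.
rewrite big_mkcond/=; apply: eq_bigr => i _; rewrite E.
by case: (val_survives _ _ _ _); rewrite ?mul1r ?mul0r.
Qed.

Lemma quant_part_far_le r n k t u : 0 < r -> (0 < n)%N ->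
  quant_part (far_part r) n k t u / n%:R <= c * r `^ (- eps).
Proof.
move=> r0 n0; have nr0 : 0 < n%:R :> R by rewrite ltr0n.
have M0 : 0 <= c * r `^ (- eps) by rewrite mulr_ge0 ?powR_ge0// ltW.
rewrite ler_pdivrMr// /quant_part; case: ifP => _; last by rewrite mulr_ge0// ltW.
rewrite big_mkcond/=; apply: (@le_trans _ _ (\sum_(t.+1 <= i < n) c * r `^ (- eps))).
  by apply: ler_sum => i _; case: ifP => // _; exact: far_part_le.
rewrite sumr_const_nat -[leLHS]mulr_natr.
by apply: ler_wpM2l; rewrite ?ler_nat ?leq_subr.
Qed.

Lemma part_cvg t (e : R) : 0 < e ->
  \forall n \near \oo,
    (\int[mu]_u (`|quant_part b n (m n) t u / n%:R - val_part b alpha t u| `^ p)%:E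
     <= e%:E)%E.
Proof.
move=> e0.
pose T : R := 3 `^ (p - 1).
have T0 : 0 < T by rewrite powR_gt0.
pose C1 := c * sing_const eps.
have C10 : 0 <= C1 := mulr_ge0 (ltW c0) (sing_const_ge0 eps1).
pose Kp := kernel_const c eps p.
have Kp0 : 0 <= Kp by exact: kernel_const_ge0.
pose K1 := Kp + C1 `^ p + 1.
have K10 : 0 < K1 by rewrite ltr_wpDl// addr_ge0// powR_ge0.
have s0 : 0 < 1 - eps * p by rewrite subr_gt0.
(* One half of [e] goes to the near parts, one quarter to [eta] and one quarter to the two bad
   events. The cutoff [r] comes first because the bound [M] on the far part depends on it. With
   [r <= 1], the exponent [(1 - eps) * p] is at least as good as [1 - eps * p]. *)
have [r /andP[r0 r1] rs] : exists2 r, 0 < r <= 1 & r `^ (1 - eps * p) <= e / (2 * T * K1).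
  by apply: powR_small => //; rewrite divr_gt0// !mulr_gt0.
have small : T * (Kp * r `^ (1 - eps * p) + (C1 * r `^ (1 - eps)) `^ p) <= e / 2.
  apply: (@le_trans _ _ (T * (K1 * r `^ (1 - eps * p)))); last first.
    apply: (@le_trans _ _ (T * (K1 * (e / (2 * T * K1))))).
      by rewrite !ler_wpM2l// ltW.
    by rewrite le_eqVlt; apply/orP; left; apply/eqP; field; rewrite !gt_eqF.
  apply: ler_wpM2l; first exact: ltW.
  have H : (C1 * r `^ (1 - eps)) `^ p <= C1 `^ p * r `^ (1 - eps * p).
    rewrite powRM ?powR_ge0//; apply: ler_wpM2l; first exact: powR_ge0.
    by rewrite -powRrM; apply: ger_powR; [rewrite r0|rewrite mulrBl mul1r lerD2r].
  rewrite /K1 !mulrDl mul1r; have := powR_ge0 r (1 - eps * p); lra.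
pose M := c * r `^ (- eps).
have M0 : 0 < M by rewrite mulr_gt0// powR_gt0.
pose eta : R := (e / (4 * T)) `^ p^-1.
have eta0 : 0 < eta by rewrite powR_gt0// divr_gt0// mulr_gt0.
have etap : eta `^ p = e / (4 * T).
  by rewrite /eta -powRrM mulVf ?gt_eqF// powRr1// ltW// divr_gt0// mulr_gt0.
pose del : R := e / (8 * T * M `^ p).
have Mp0 : 0 < M `^ p by rewrite powR_gt0.
have T8 : 0 < 8 * T by rewrite mulr_gt0.
have del0 : 0 < del by exact: divr_gt0 e0 (mulr_gt0 T8 Mp0).
have mf := measurable_far_cost r t.
have f0 := far_cost_ge0 r t.
have fM u x : far_cost r t u x <= M by exact: far_cost_le.
have f_local : forall u w x, (forall j, (j <= t)%N -> u j = w j) ->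
    far_cost r t u x = far_cost r t w x by exact: far_cost_local.
pose bigN : R := 2 * M ^+ 2 * (1 + t.+1%:R ^+ 2) / (eta ^+ 2 * del).
near=> n.
have tn : (t < n)%N by near: n; exact: nbhs_infty_gt.
have nN : bigN <= n%:R by near: n; exact: nbhs_infty_ger.
have n0 : (0 < n)%N by apply: leq_ltn_trans tn.
have nr0 : 0 < n%:R :> R by rewrite ltr0n.
have P1 : (\int[mu]_u ((~~ agree alpha n (m n) t u)%:R : R)%:E <= del%:E)%E.
  by near: n; exact: disagree_near.
pose dev (u : seeds R) := (eta < `|(\sum_(t.+1 <= i < n) far_cost r t u (u i)) / n%:R
    - mean_of nu (far_cost r t) u|).
have P2 : (\int[mu]_u ((dev u)%:R : R)%:E <= del%:E)%E.
  apply: le_trans (deviation_le iid_mu mf f0 fM f_local tn eta0) _.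
  have e20 : 0 < eta ^+ 2 by rewrite exprn_gt0.
  move: nN; rewrite lee_fin /bigN (ler_pdivrMr _ _ (mulr_gt0 e20 del0)) => nN.
  rewrite (ler_pdivrMr _ _ (mulr_gt0 e20 nr0)); apply: le_trans nN _.
  by rewrite le_eqVlt; apply/orP; left; apply/eqP; ring.
have mA : measurable_fun setT (fun u : seeds R => ~~ agree alpha n (m n) t u).
  by apply: measurable_neg; apply: measurable_all => k; exact: measurable_agree1.
have mdev : measurable_fun setT dev.
  apply: measurable_fun_ltr => //; apply: measurable_norm_comp.
  apply: measurable_funB; last exact: (measurable_mean_of _ mf f0).
  apply: measurable_funM => //; apply: measurable_sum => i.
  apply: (measurableT_comp (f := fun z : seeds R * R => far_cost r t z.1 z.2) mf
    (g := fun u : seeds R => (u, u i))).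
  apply: measurable_fun_pair; [exact: measurable_id|exact: measurable_seed].
have nb (f : seeds R -> bool) : measurable_fun setT f ->
  measurable_fun setT (fun u => (f u)%:R : R) by exact: measurable_fun_natr_bool.
pose Q (u : seeds R) := (quant_part (near_part r) n (m n) t u / n%:R) `^ p.
have Q0 u : 0 <= Q u by exact: powR_ge0.
have mQ : measurable_fun setT Q.
  apply: measurable_powR_comp; apply: measurable_funM => //.
  by apply: measurable_quant_part; exact: measurable_near_part.
pose W : R := T * (eta `^ p + (C1 * r `^ (1 - eps)) `^ p).
pose Z (u : seeds R) : R := (~~ agree alpha n (m n) t u)%:R + (dev u)%:R.
have mZ : measurable_fun setT Z by apply: measurable_funD; exact: nb.
have Z0 u : 0 <= Z u by rewrite addr_ge0.
have W0 : 0 <= W := mulr_ge0 (ltW T0) (addr_ge0 (powR_ge0 _ _) (powR_ge0 _ _)).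
apply: (@le_trans _ _ (\int[mu]_u (W + (T * M `^ p * Z u + T * Q u))%:E)%E).
  apply: le_int => u; rewrite lee_fin ?powR_ge0//.
  rewrite (quant_part_split r) (val_part_split _ _ r0).
  rewrite mulrDl; apply: split_bound.
  - exact: ltW.
  - exact: ltW.
  - apply/andP; split; last exact: quant_part_far_le.
    by rewrite divr_ge0 ?(ltW nr0)//; apply: quant_part_ge0; exact: far_part_ge0.
  - by rewrite -mean_far_cost mean_of_ge0//=; exact: mean_of_le.
  - by rewrite divr_ge0 ?(ltW nr0)//; apply: quant_part_ge0; exact: near_part_ge0.
  - exact: val_part_near_le.
  - by move=> agr; rewrite /dev -leNgt -(quant_part_far agr) mean_far_cost.
have TM0 : 0 <= T * M `^ p by rewrite mulr_ge0// ltW.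
rewrite (integral_affine mu mZ mQ Z0 Q0 W0 TM0 (ltW T0)).
have Z2 : (\int[mu]_u (Z u)%:E <= del%:E + del%:E)%E.
  rewrite /Z integral_EFinD; [exact: leeD|exact: nb|exact: nb|by []|by []].
have := quant_part_near_powR (m n) t r0 n0.
rewrite -/Kp => P3.
apply: (@le_trans _ _ (W%:E + ((T * M `^ p)%:E * (del%:E + del%:E) +
   T%:E * (Kp * r `^ (1 - eps * p))%:E))%E).
  apply: leeD => //; apply: leeD.
    by apply: lee_wpmul2l; rewrite ?lee_fin.
  by apply: lee_wpmul2l; rewrite ?lee_fin// ltW.
rewrite -[leLHS]/((W + (T * M `^ p * (del + del) + T * (Kp * r `^ (1 - eps * p))))%:E).
rewrite lee_fin /W etap.
have E1 : T * M `^ p * (del + del) = e / 4.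
  by rewrite /del; field; rewrite !gt_eqF.
have E2 : T * (e / (4 * T)) = e / 4 by field; rewrite gt_eqF.
rewrite E1 mulrDr E2; move: small; rewrite mulrDr; lra.
Unshelve. all: by end_near.
Qed.

End fixed_pivot.

(** * Series dominated in L^p *)

Section dominated_series.
Local Open Scope ereal_scope.

Lemma cvge0_near (R : realType) (f : nat -> \bar R) : (forall n, 0 <= f n) ->
  (forall e : R, (0 < e)%R -> \forall n \near \oo, f n <= e%:E) ->
  f n @[n --> \oo] --> 0.
Proof.
move=> f0 fe; apply/fine_cvgP; split.
  near=> n; rewrite ge0_fin_numE//; apply: (@le_lt_trans _ _ 1%:E); last exact: ltry.
  by near: n; exact: fe.
apply/cvgrPdist_le => e e0; near=> n.
have H : f n <= e%:E by near: n; exact: fe.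
rewrite /= sub0r normrN ger0_norm; last exact: fine_ge0.
by rewrite -lee_fin fineK// ge0_fin_numE//; exact: le_lt_trans H (ltry _).
Unshelve. all: by end_near.
Qed.

Lemma poweR_le_EFin (R : realType) (x : \bar R) (p r : R) : 0 <= x -> (0 < p)%R ->
  (0 <= r)%R -> x <= (r `^ p^-1)%:E -> x `^ p <= r%:E.
Proof.
move=> x0 p0 r0 xr.
apply: (@le_trans _ _ ((r `^ p^-1)%:E `^ p)).
  apply: gt0_ler_poweR => //; first exact: ltW.
    by rewrite in_itv/= x0 leey.
  by rewrite in_itv/= lee_fin powR_ge0 leey.
by rewrite poweR_EFin -powRrM mulVf ?gt_eqF// powRr1.
Qed.

Section weights.
Variables (R : realType) (p : R) (w : nat -> R).
Hypotheses (p1 : (1 <= p)%R) (w0 : forall t, (0 < w t)%R)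
  (w1 : forall N, (\sum_(0 <= t < N) w t <= 1)%R).

Let p0 : (0 < p)%R. Proof. exact: lt_le_trans p1. Qed.

Lemma nneseries_powR_weights (y : nat -> R) : (forall t, (0 <= y t)%R) ->
  (\sum_(0 <= t <oo) (y t)%:E) `^ p <=
  \sum_(0 <= t <oo) (w t `^ (1 - p) * y t `^ p)%:E.
Proof.
move=> y0; set Y := \sum_(0 <= t <oo) _; set Z := \sum_(0 <= t <oo) _.
have Y0 : 0 <= Y by apply: nneseries_ge0 => t _ _; rewrite lee_fin.
have z0 t : 0 <= (w t `^ (1 - p) * y t `^ p)%:E by rewrite lee_fin mulr_ge0 ?powR_ge0.
have Z0 : 0 <= Z by apply: nneseries_ge0 => t _ _; exact: z0.
have [Zfin|Zinf] := ltP Z +oo; last first.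
  by apply: le_trans Zinf; exact: leey.
have ZE : Z = (fine Z)%:E by rewrite fineK// ge0_fin_numE.
rewrite ZE; apply: poweR_le_EFin => //; first exact: fine_ge0.
apply: lime_le; first by apply: is_cvg_nneseries => t _ _; rewrite lee_fin.
apply: nearW => N; rewrite sumEFin lee_fin.
have S0 : (0 <= \sum_(0 <= t < N) y t)%R by apply: sumr_ge0.
have -> : (\sum_(0 <= t < N) y t = ((\sum_(0 <= t < N) y t) `^ p) `^ p^-1)%R.
  by rewrite -powRrM mulfV ?gt_eqF// powRr1.
apply: ge0_ler_powR; rewrite ?nnegrE ?powR_ge0 ?fine_ge0 ?invr_ge0 ?(ltW p0)//.
apply: le_trans (powR_sum_weights p1 w0 y0 (w1 N)) _.
by rewrite -lee_fin -ZE -sumEFin; apply: nneseries_lim_ge.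
Qed.

Variables (d : measure_display) (T : measurableType d) (mu : {measure set T -> \bar R}).

Lemma integral_nneseries_powR_weights (y : nat -> T -> R) :
  (forall t, measurable_fun setT (y t)) -> (forall t x, (0 <= y t x)%R) ->
  \int[mu]_x (\sum_(0 <= t <oo) (y t x)%:E) `^ p <=
  \sum_(0 <= t <oo) (w t `^ (1 - p))%:E * \int[mu]_x (y t x `^ p)%:E.
Proof.
move=> my y0.
apply: (@le_trans _ _ (\int[mu]_x \sum_(0 <= t <oo) (w t `^ (1 - p) * y t x `^ p)%:E)).
  apply: le_int => x; first exact: poweR_ge0.
  exact: nneseries_powR_weights.
have myp t : measurable_fun setT (fun x => y t x `^ p)%R by exact: measurable_powR_comp.
rewrite integral_nneseries//; last 2 first.
- by move=> t; apply/measurable_EFinP; exact: measurable_funM.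
- by move=> t x _; rewrite lee_fin mulr_ge0 ?powR_ge0.
apply: lee_nneseries => t _.
  by move=> _; apply: integral_ge0 => x _; rewrite lee_fin mulr_ge0 ?powR_ge0.
by rewrite integral_EFinZl ?powR_ge0// => x; exact: powR_ge0.
Qed.

End weights.

(** If the right-hand side is infinite, there is nothing to prove; otherwise the series of [s] is
    finite too, being at most that of [a] plus that of the distances, and the subtraction takes
    place among reals. *)
Lemma abse_nneseries_sub (R : realType) (a s : nat -> R) :
  (forall t, (0 <= a t)%R) -> (forall t, (0 <= s t)%R) ->
  \sum_(0 <= t <oo) (a t)%:E < +oo ->
  `|\sum_(0 <= t <oo) (a t)%:E - \sum_(0 <= t <oo) (s t)%:E| <=
  \sum_(0 <= t <oo) `|a t - s t|%:E.
Proof.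
move=> a0 s0; set A := \sum_(0 <= t <oo) (a t)%:E; set S := \sum_(0 <= t <oo) (s t)%:E.
set D := \sum_(0 <= t <oo) _ => Afin.
have A0 : 0 <= A by apply: nneseries_ge0 => t _ _; rewrite lee_fin.
have S0 : 0 <= S by apply: nneseries_ge0 => t _ _; rewrite lee_fin.
have D0 : 0 <= D by apply: nneseries_ge0 => t _ _; rewrite lee_fin.
have AE : A = (fine A)%:E by rewrite fineK// ge0_fin_numE.
have SAD : S <= A + D.
  rewrite /A /D -nneseriesD; [|by move=> t _ _; rewrite lee_fin..].
  apply: lee_nneseries => t _; first by rewrite lee_fin.
  by rewrite -EFinD lee_fin -lerBlDl distrC; exact: ler_norm.
have ASD : A <= S + D.
  rewrite /S /D -nneseriesD; [|by move=> t _ _; rewrite lee_fin..].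
  apply: lee_nneseries => t _; first by rewrite lee_fin.
  by rewrite -EFinD lee_fin -lerBlDl; exact: ler_norm.
have [Dfin|] := ltP D +oo; last by rewrite leye_eq => /eqP ->; rewrite leey.
have DE : D = (fine D)%:E by rewrite fineK// ge0_fin_numE.
have Sfin : S < +oo.
  by apply: le_lt_trans SAD _; rewrite AE DE -EFinD ltry.
have SE : S = (fine S)%:E by rewrite fineK// ge0_fin_numE.
move: SAD ASD; rewrite AE SE DE -!EFinD !lee_fin ler_norml => H1 H2.
by apply/andP; split; lra.
Qed.

Section tannery.
Variables (R : realType) (p : R) (w : nat -> R).
Hypotheses (p1 : (1 <= p)%R) (w0 : forall t, (0 < w t)%R)
  (w1 : forall N, (\sum_(0 <= t < N) w t <= 1)%R).
Variables (d : measure_display) (T : measurableType d) (mu : {measure set T -> \bar R}).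
Variables (a : nat -> nat -> T -> R) (s : nat -> T -> R) (C : nat -> R).
Hypotheses (ma : forall n t, measurable_fun setT (a n t))
  (ms : forall t, measurable_fun setT (s t))
  (a0 : forall n t x, (0 <= a n t x)%R) (s0 : forall t x, (0 <= s t x)%R)
  (a_fin : forall n t x, (n <= t)%N -> a n t x = 0%R)
  (C0 : forall t, (0 <= C t)%R)
  (C_sum : \sum_(0 <= t <oo) (w t `^ (1 - p) * C t)%:E < +oo)
  (a_le : forall n t, \int[mu]_x (a n t x `^ p)%:E <= (C t)%:E)
  (a_cvg : forall t e, (0 < e)%R -> \forall n \near \oo,
     \int[mu]_x (`|a n t x - s t x| `^ p)%:E <= e%:E).

Let p0 : (0 < p)%R. Proof. exact: lt_le_trans p1. Qed.

Let H : R := (2 `^ (p - 1))%R.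
Let H0 : (0 <= H)%R. Proof. exact: powR_ge0. Qed.

Lemma powR_sum2 (x y z : R) : (0 <= x)%R -> (0 <= y)%R -> (0 <= z)%R ->
  (z <= x + y)%R -> (z `^ p <= H * x `^ p + H * y `^ p)%R.
Proof.
move=> x0 y0 z0 zxy; apply: (@le_trans _ _ ((x + y) `^ p))%R.
  by apply: ge0_ler_powR; rewrite ?nnegrE ?addr_ge0 ?(ltW p0).
have := @powR_sum_count R R [:: x; y] xpredT p (Num.max 0%R) p1.
rewrite !big_cons !big_nil !addr0 !max_r// -mulrDr => HH.
by apply: HH => i; rewrite le_max lexx.
Qed.

Let mdist n t : measurable_fun setT (fun x => `|a n t x - s t x|)%R.
Proof. by apply: measurable_norm_comp; exact: measurable_funB. Qed.

Let split2 (f g h : T -> R) (A B : R) :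
  measurable_fun setT f -> measurable_fun setT g ->
  (forall x, 0 <= f x)%R -> (forall x, 0 <= g x)%R -> (forall x, 0 <= h x)%R ->
  (forall x, h x <= f x + g x)%R ->
  \int[mu]_x (f x `^ p)%:E <= A%:E -> \int[mu]_x (g x `^ p)%:E <= B%:E ->
  \int[mu]_x (h x `^ p)%:E <= (H * A + H * B)%:E.
Proof.
move=> mf mg f0 g0 h0 hfg fA gB.
have mfp : measurable_fun setT (fun x => f x `^ p)%R by exact: measurable_powR_comp.
have mgp : measurable_fun setT (fun x => g x `^ p)%R by exact: measurable_powR_comp.
apply: (@le_trans _ _ (\int[mu]_x (H * f x `^ p + H * g x `^ p)%:E)).
  apply: le_int => x; rewrite lee_fin ?powR_ge0//; exact: powR_sum2.
rewrite integral_EFinD; [|exact: measurable_funM|exact: measurable_funM|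
  by move=> x; rewrite mulr_ge0 ?powR_ge0..].
rewrite !integral_EFinZl//; try by move=> x; exact: powR_ge0.
by rewrite EFinD !EFinM; apply: leeD; apply: lee_wpmul2l; rewrite ?lee_fin.
Qed.

(** The bound passes to the limit through [s <= |a - s| + a] at a large [n], where the first summand
    is negligible; splitting the power costs the factor [H]. *)
Lemma limit_part_le t : \int[mu]_x (s t x `^ p)%:E <= (H * C t)%:E.
Proof.
apply/lee_addgt0Pr => e e0.
have He0 : (0 < e / (H + 1))%R by rewrite divr_gt0// ltr_wpDl.
have [N _ /(_ N (leqnn N)) HN] := a_cvg t He0.
apply: le_trans (split2 (mdist N t) (ma N t) _ _ _ _ HN (a_le N t)) _ => //.
  by move=> x; rewrite addrC -lerBlDl distrC; exact: ler_norm.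
rewrite -EFinD lee_fin addrC lerD2l mulrA ler_pdivrMr ?ltr_wpDl//.
by rewrite mulrC; apply: ler_wpM2l; [exact: ltW|rewrite lerDl].
Qed.

Let D t : R := (H * (H * C t) + H * C t)%R.

Let dist_le n t : \int[mu]_x (`|a n t x - s t x| `^ p)%:E <= (D t)%:E.
Proof.
apply: split2 (limit_part_le t) (a_le n t) => // x.
by apply: le_trans (ler_normB _ _) _; rewrite !ger0_norm// addrC.
Qed.

Let wC0 t : 0 <= (w t `^ (1 - p) * C t)%:E.
Proof. by rewrite lee_fin mulr_ge0 ?powR_ge0. Qed.

Lemma integral_partial_sum_le n :
  \int[mu]_x (\sum_(0 <= t <oo) (a n t x)%:E) `^ p <=
  \sum_(0 <= t <oo) (w t `^ (1 - p) * C t)%:E.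
Proof.
apply: le_trans (integral_nneseries_powR_weights p1 w0 w1 mu (ma n) (a0 n)) _.
apply: lee_nneseries => t _.
  move=> _; apply: mule_ge0; first by rewrite lee_fin powR_ge0.
  by apply: integral_ge0 => x _; rewrite lee_fin powR_ge0.
by rewrite EFinM; apply: lee_wpmul2l; rewrite ?lee_fin ?powR_ge0.
Qed.

Lemma integral_limit_sum_lty :
  \int[mu]_x (\sum_(0 <= t <oo) (s t x)%:E) `^ p < +oo.
Proof.
apply: le_lt_trans (integral_nneseries_powR_weights p1 w0 w1 mu ms s0) _.
apply: (@le_lt_trans _ _ (\sum_(0 <= t <oo) H%:E * (w t `^ (1 - p) * C t)%:E)).
  apply: lee_nneseries => t _.
    move=> _; apply: mule_ge0; first by rewrite lee_fin powR_ge0.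
    by apply: integral_ge0 => x _; rewrite lee_fin powR_ge0.
  apply: (@le_trans _ _ ((w t `^ (1 - p))%:E * (H * C t)%:E)).
    by apply: lee_wpmul2l; [rewrite lee_fin powR_ge0|exact: limit_part_le].
  by rewrite -!EFinM lee_fin mulrCA.
by rewrite nneseriesZl// lte_mul_pinfty.
Qed.

Lemma cvg_sum_Lp :
  (\int[mu]_x `|\sum_(0 <= t <oo) (a n t x)%:E - \sum_(0 <= t <oo) (s t x)%:E| `^ p)
    @[n --> \oo] --> 0.
Proof.
apply: cvge0_near => [n|e e0]; first by apply: integral_ge0 => x _; exact: poweR_ge0.
pose v t : R := (w t `^ (1 - p))%R.
have v0 t : (0 <= v t)%R by exact: powR_ge0.
pose K : R := (H * H + H)%R.
have K0 : (0 <= K)%R by rewrite addr_ge0// mulr_ge0.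
have vDE t : (v t * D t)%:E = K%:E * (v t * C t)%:E.
  by rewrite -EFinM; congr (_%:E); rewrite /D /K; ring.
have vD0 t : 0 <= (v t * D t)%:E by rewrite vDE mule_ge0 ?lee_fin// mulr_ge0.
have D_sum : \sum_(0 <= t <oo) (v t * D t)%:E < +oo.
  rewrite (eq_eseriesr (fun t _ => vDE t)) nneseriesZl; last by move=> t _; exact: wC0.
  by rewrite lte_mul_pinfty.
have e20 : (0 < e / 2)%R by rewrite divr_gt0.
have tail := nneseries_tail_cvg D_sum (fun t _ => vD0 t).
have [N HN] : exists N, \sum_(N <= t <oo) (v t * D t)%:E <= (e / 2)%:E.
  move: tail => /fine_cvgP[[N1 _ H1] /cvgrPdist_le /(_ _ e20)[N2 _ H2]].
  exists (maxn N1 N2).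
  have := H2 (maxn N1 N2) (leq_maxr _ _); have := H1 (maxn N1 N2) (leq_maxl _ _).
  rewrite /= => fin; rewrite sub0r normrN ger0_norm; last first.
    by apply: fine_ge0; apply: nneseries_ge0 => t _ _; exact: vD0.
  by rewrite -lee_fin fineK.
(* Each of the first [N] terms gets the share [e / (2 * N.+1)]; the successor avoids dividing by
   zero when [N] is 0. *)
have head k : \forall n \near \oo, \sum_(0 <= t < k)
    (v t)%:E * \int[mu]_x (`|a n t x - s t x| `^ p)%:E <= (k%:R * (e / (2 * N.+1%:R)))%:E.
  have eN : (0 < e / (2 * N.+1%:R))%R by rewrite divr_gt0.
  elim: k => [|k IH]; first by apply: nearW => n; rewrite big_nil mul0r.
  have vk : (0 < e / (2 * N.+1%:R) / (v k + 1))%R by rewrite divr_gt0// ltr_wpDl.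
  near=> n; rewrite big_nat_recr//= -natr1 mulrDl mul1r EFinD; apply: leeD.
    by near: n; exact: IH.
  have Hk : \int[mu]_x (`|a n k x - s k x| `^ p)%:E <= (e / (2 * N.+1%:R) / (v k + 1))%:E.
    by near: n; exact: a_cvg.
  apply: le_trans (lee_wpmul2l _ Hk) _; first by rewrite lee_fin.
  rewrite -EFinM lee_fin mulrA ler_pdivrMr ?ltr_wpDl// mulrC.
  by apply: ler_wpM2l; [exact: ltW|rewrite lerDl].
near=> n.
have Hn : \sum_(0 <= t < N) (v t)%:E * \int[mu]_x (`|a n t x - s t x| `^ p)%:E <=
    (N%:R * (e / (2 * N.+1%:R)))%:E by near: n; exact: head.
apply: (@le_trans _ _ (\int[mu]_x (\sum_(0 <= t <oo) `|a n t x - s t x|%:E) `^ p)).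
  apply: le_int => x; first exact: poweR_ge0.
  apply: gt0_ler_poweR; [exact: ltW| | |].
  - by rewrite in_itv/= abse_ge0 leey.
  - by rewrite in_itv/= leey andbT nneseries_ge0// => t _ _; rewrite lee_fin.
  apply: abse_nneseries_sub => //.
  (* Only the first [n] times contribute to the sample, so its series is a finite sum and finite at
     every point. *)
  rewrite (nneseries_split 0 n); last by move=> t _; rewrite lee_fin.
  rewrite add0n [X in (_ + X)%E]eseries0; last by move=> t nt _; rewrite a_fin.
  by rewrite adde0 sumEFin ltry.
apply: le_trans (integral_nneseries_powR_weights p1 w0 w1 mu (mdist n) (fun t x => normr_ge0 _)) _.
have i0 t : 0 <= (v t)%:E * \int[mu]_x (`|a n t x - s t x| `^ p)%:E.
  apply: mule_ge0; first by rewrite lee_fin.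
  by apply: integral_ge0 => x _; rewrite lee_fin powR_ge0.
rewrite (nneseries_split 0 N (fun t _ => i0 t)) add0n.
have -> : e%:E = (e / 2)%:E + (e / 2)%:E by rewrite -EFinD -splitr.
apply: leeD.
  apply: le_trans Hn _; rewrite lee_fin.
  have -> : (N%:R * (e / (2 * N.+1%:R)) = (e / 2) * (N%:R / N.+1%:R))%R.
    by rewrite invfM !mulrA; congr (_ / _)%R; rewrite [RHS]mulrAC; congr (_ / _)%R; rewrite mulrC.
  by rewrite ler_piMr ?(ltW e20)// ler_pdivrMr// mul1r ler_nat.
apply: le_trans HN; apply: lee_nneseries => [t _ _|t _]; first exact: i0.
by rewrite EFinM; apply: lee_wpmul2l; rewrite ?lee_fin; [exact: v0|exact: dist_le].
Unshelve. all: by end_near.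
Qed.

End tannery.
End dominated_series.

(** * Weights and summability of the moment bounds *)

Section power_weights.
Context {R : realType}.
Implicit Types x y a delta : R.

(** The tangent inequality for the convex power [delta^-1], applied to the [delta]-th power of
    [x]. *)
Lemma powR_concave x delta : 0 < delta -> delta <= 1 -> 0 <= x ->
  x `^ delta <= 1 + delta * (x - 1).
Proof.
move=> d0 d1 x0; have d1' : 1 <= delta^-1 by rewrite invf_ge1.
have := powR_tangent d1' (powR_ge0 x delta).
rewrite -powRrM mulfV ?gt_eqF// powRr1// => H.
have := ler_wpM2l (ltW d0) H.
rewrite mulrDr mulrA mulfV ?gt_eqF//; lra.
Qed.

(** Differences of a decreasing power: the partial sums telescope and stay below 1, as Jensen's
    inequality requires, while each weight is of order [t.+1] to the power [- (1 + delta)]. *)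
Definition weight delta (t : nat) : R := t.+1%:R `^ (- delta) - t.+2%:R `^ (- delta).

Lemma weight_ge delta t : 0 < delta -> delta <= 1 ->
  delta / 2 * t.+1%:R `^ (- (1 + delta)) <= weight delta t.
Proof.
move=> d0 d1; rewrite /weight; set x : R := t.+1%:R.
have x1 : 1 <= x by rewrite ler1n.
have x0 : 0 < x by lra.
have -> : t.+2%:R = x + 1 :> R by rewrite /x -[in RHS]natr1 -natr1 -natr1.
have y0 : 0 < x + 1 by lra.
have q0 : 0 <= x / (x + 1) by rewrite divr_ge0// ltW.
have H := powR_concave d0 d1 q0.
have E : (x + 1) `^ (- delta) = x `^ (- delta) * (x / (x + 1)) `^ delta.
  rewrite powRM ?invr_ge0 ?(ltW x0) ?(ltW y0)// mulrA -powRD; last first.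
    by apply/implyP => _; rewrite gt_eqF.
  by rewrite addNr powRr0 mul1r -powR_inv1 ?(ltW y0)// -powRrM mulN1r.
rewrite E; have X0 : 0 < x `^ (- delta) by rewrite powR_gt0.
have H2 := ler_wpM2l (ltW X0) H.
have E2 : x `^ (- (1 + delta)) = x `^ (- delta) * x^-1.
  rewrite opprD addrC powRD; last by apply/implyP => _; rewrite gt_eqF.
  by rewrite powR_inv1 ?(ltW x0).
rewrite E2.
have E3 : x / (x + 1) - 1 = - (x + 1)^-1 by field; rewrite gt_eqF.
rewrite E3 in H2.
have H3 : x^-1 / 2 <= (x + 1)^-1.
  by rewrite -invfM lef_pV2 ?posrE ?mulr_gt0//; lra.
have H4 := ler_wpM2l (ltW X0) (ler_wpM2l (ltW d0) H3).
apply: le_trans (_ : x `^ (- delta) * (delta * (x^-1 / 2)) <= _).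
  by rewrite le_eqVlt; apply/orP; left; apply/eqP; ring.
apply: le_trans H4 _; move: H2; rewrite mulrDr mulr1 mulrN mulrN; lra.
Qed.

Lemma weight_gt0 delta t : 0 < delta -> delta <= 1 -> 0 < weight delta t.
Proof.
move=> d0 d1; apply: lt_le_trans (weight_ge t d0 d1).
by rewrite mulr_gt0 ?powR_gt0 ?divr_gt0 ?ltr0n.
Qed.

Lemma sum_weight_le delta N : \sum_(0 <= t < N) weight delta t <= 1.
Proof.
have -> : \sum_(0 <= t < N) weight delta t = 1 - N.+1%:R `^ (- delta).
  elim: N => [|N IH]; first by rewrite big_nil powR1 subrr.
  by rewrite big_nat_recr//= IH /weight; ring.
by rewrite gerBl powR_ge0.
Qed.

(** Take [1 + z <= expR z] at [z = y / a], drop the 1, raise to the power [a] and invert. *)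
Lemma expRN_le_powR y a : 0 < y -> 0 < a -> expR (- y) <= a `^ a * y `^ (- a).
Proof.
move=> y0 a0; have H : (y / a) `^ a <= expR y.
  have -> : expR y = expR (y / a) `^ a.
    by rewrite /powR gt_eqF ?expR_gt0// expRK mulrC divfK// gt_eqF.
  apply: ge0_ler_powR; rewrite ?nnegrE ?expR_ge0 ?divr_ge0 ?(ltW a0) ?(ltW y0)//.
  by apply: le_trans (expR_ge1Dx _); rewrite lerDr.
have E : a `^ a * y `^ (- a) = ((y / a) `^ a)^-1.
  rewrite powRM ?invr_ge0 ?(ltW y0) ?(ltW a0)// invfM powRN mulrC; congr (_ * _).
  by rewrite -powR_inv1 ?(ltW a0)// -powRrM mulN1r powRN invrK.
rewrite E expRN lef_pV2 ?posrE ?expR_gt0// powR_gt0// divr_gt0//.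
Qed.

Lemma ler_powRN x y q : 0 < x -> x <= y -> 0 <= q -> y `^ (- q) <= x `^ (- q).
Proof.
move=> x0 xy q0; have y0 := lt_le_trans x0 xy.
rewrite !powRN lef_pV2 ?posrE ?powR_gt0//.
by apply: ge0_ler_powR => //; rewrite nnegrE ltW.
Qed.

Section moment_series.
Variables (c eps p : R).
Hypotheses (c0 : 0 < c) (eps0 : 0 < eps) (p1 : 1 <= p) (eps_p : eps * p < 1).

Let p0 : 0 < p. Proof. exact: lt_le_trans p1. Qed.

(** With [S = 1 - eps * p], the series needs [p * (1 + dl) <= (1 - dl) * (p + S)], that is
    [dl * (2 * p + S) <= S]. As [S < 1 <= p], this holds for [dl = S / (4 * p)]. *)
Definition weight_exponent : R := (1 - eps * p) / (4 * p).
Local Notation dl := weight_exponent.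

Lemma weight_exponent_itv : 0 < dl /\ dl <= 1 / 4.
Proof.
have s0 : 0 < eps * p by rewrite mulr_gt0.
split; rewrite /dl; first by rewrite divr_gt0 ?subr_gt0// mulr_gt0.
by rewrite ler_pdivrMr ?mulr_gt0//; have := p1; lra.
Qed.

(** The choice of [lam] at time [t]. Its product with [t.+1] is [t.+1] to the power [dl], which
    tends to infinity, so that the exponential term decays faster than every power. *)
Definition window (t : nat) : R := t.+1%:R `^ (- (1 - dl)).

Lemma window_itv t : 0 < window t <= 1.
Proof.
have [d0 d1] := weight_exponent_itv.
rewrite powR_gt0 ?ltr0n//= /window powRN invf_le1 ?powR_gt0 ?ltr0n//.
rewrite -[leLHS](powRr0 t.+1%:R); apply: ler_powR; last lra.
by rewrite ler1n.
Qed.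

Lemma window_ge n t : (t < n)%N -> n%:R^-1 <= window t.
Proof.
move=> tn; have [d0 d1] := weight_exponent_itv.
have t0 : 0 < t.+1%:R :> R by rewrite ltr0n.
apply: (@le_trans _ _ t.+1%:R^-1).
  by rewrite lef_pV2 ?posrE ?ler_nat// ltr0n (leq_ltn_trans _ tn).
rewrite -powR_inv1 ?(ltW t0)//; apply: ler_powR; last lra.
by rewrite ler1n.
Qed.

(* With [x = t + 1], the moment bound is of order
   [x ^ (- (1 - dl) (p + 1 - eps p))], and dividing by the power
   [weight dl t ^ (p - 1)] still leaves an exponent below [- (1 + dl)]. *)
Lemma moment_bound_le : exists2 A : R, 0 <= A & forall t,
  moment_bound c eps p t (window t) <=
  A * t.+1%:R `^ (- ((1 - dl) * (p + 1 - eps * p))).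
Proof.
have [d0 d1] := weight_exponent_itv.
pose K := kernel_const c eps p.
have K0 : 0 <= K by exact: kernel_const_ge0.
(* With this exponent, [expRN_le_powR] at the [dl]-th power of [x] gives [x] to the power
   [- (p + 1)], and [p + 1] is at least [kap]. The factor [expR 1] pays for having [t] in place of
   [x = t + 1]. *)
pose a := (p + 1) / dl.
have a0 : 0 < a := divr_gt0 (addr_gt0 p0 ltr01) d0.
have e0 : 0 <= expR 1 :> R by exact: expR_ge0.
exists (3 * K * (expR 1 * a `^ a) + 9 `^ (p - 1) * (K * 6)).
  apply: addr_ge0; apply: mulr_ge0; rewrite ?powR_ge0//; last exact: mulr_ge0.
    exact: mulr_ge0.
  by rewrite mulr_ge0 ?powR_ge0.
move=> t; set x : R := t.+1%:R; set kap := (1 - dl) * (p + 1 - eps * p).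
have x1 : 1 <= x by rewrite ler1n.
have x0 : 0 < x by lra.
have /andP[l0 l1] := window_itv t.
have xl : x * window t = x `^ dl.
  rewrite /window -/x -{1}(powRr1 (ltW x0)) -powRD; last first.
    by apply/implyP => _; rewrite gt_eqF.
  by congr (_ `^ _); ring.
have E1 : expR (- (t%:R * window t)) <= expR 1 * a `^ a * x `^ (- kap).
  have -> : - (t%:R * window t) = window t - x `^ dl.
    by rewrite -xl /x -natr1; ring.
  rewrite expRD -mulrA; apply: ler_pM; rewrite ?expR_ge0 ?ler_expR//.
  apply: le_trans (expRN_le_powR (powR_gt0 _ x0) a0) _.
  apply: ler_wpM2l; first exact: powR_ge0.
  rewrite -powRrM; apply: ler_powR => //.
  have -> : dl * - a = - (p + 1) by rewrite /a; field; rewrite gt_eqF.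
  rewrite lerN2 /kap.
  have s0 : 0 < eps * p by rewrite mulr_gt0.
  have : (1 - dl) * (p + 1 - eps * p) <= 1 * (p + 1 - eps * p).
    by apply: ler_wpM2r; have := p0; have := eps_p; lra.
  lra.
have E2 : (9 * window t) `^ (p - 1) * (K * window t `^ (1 - eps * p) * (6 * window t)) =
    9 `^ (p - 1) * (K * 6) * x `^ (- kap).
  have -> : x `^ (- kap) = window t `^ (p - 1) * window t `^ (1 - eps * p) * window t.
    rewrite -{3}(powRr1 (ltW l0)) -!powRD; last 2 first.
    - by apply/implyP => _; rewrite gt_eqF.
    - by apply/implyP => _; rewrite gt_eqF.
    by rewrite /window -powRrM /kap; congr (_ `^ _); ring.
  rewrite powRM ?(ltW l0)//; move: (window t) (window t `^ _) (window t `^ _) (9 `^ _).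
  by move=> y1 y2 y3 y4; ring.
rewrite /moment_bound -/K E2 [leRHS]mulrDl; apply: lerD => //.
rewrite -[leRHS]mulrA; apply: ler_wpM2l => //.
by rewrite mulr_ge0.
Qed.

(** The terms are compared with multiples of the weights themselves, whose series is at most 1. *)
Lemma moment_series_lty :
  (\sum_(0 <= t <oo) (weight dl t `^ (1 - p) * moment_bound c eps p t (window t))%:E < +oo)%E.
Proof.
have [d0 d1] := weight_exponent_itv.
have d1' : dl <= 1 by lra.
have [A A0 HA] := moment_bound_le.
have d20 : 0 < dl / 2 by rewrite divr_gt0.
pose B := (dl / 2) `^ (1 - p) * A * (2 / dl).
have B0 : 0 <= B := mulr_ge0 (mulr_ge0 (powR_ge0 _ _) A0) (divr_ge0 (ler0n _ 2) (ltW d0)).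
have mb0 t : 0 <= moment_bound c eps p t (window t).
  have /andP[l0 l1] := window_itv t.
  have K0 : 0 <= kernel_const c eps p by exact: kernel_const_ge0.
  rewrite /moment_bound; apply: addr_ge0; apply: mulr_ge0.
  - exact: mulr_ge0.
  - exact: expR_ge0.
  - exact: powR_ge0.
  - exact: mulr_ge0 (mulr_ge0 K0 (powR_ge0 _ _)) (mulr_ge0 (ler0n _ 6) (ltW l0)).
have key t : weight dl t `^ (1 - p) * moment_bound c eps p t (window t) <=
    B * weight dl t.
  set x : R := t.+1%:R.
  have x1 : 1 <= x by rewrite ler1n.
  have x0 : 0 < x by lra.
  have Wg := weight_ge t d0 d1'; rewrite -/x in Wg.
  have W0 := weight_gt0 t d0 d1'.
  have L0 : 0 < dl / 2 * x `^ (- (1 + dl)) by rewrite mulr_gt0// powR_gt0.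
  have H1 : weight dl t `^ (1 - p) <= (dl / 2 * x `^ (- (1 + dl))) `^ (1 - p).
    rewrite -[1 - p]opprB; apply: ler_powRN => //.
    by rewrite subr_ge0.
  apply: (@le_trans _ _ ((dl / 2 * x `^ (- (1 + dl))) `^ (1 - p) *
      (A * x `^ (- ((1 - dl) * (p + 1 - eps * p)))))).
    by apply: ler_pM; [exact: powR_ge0|exact: mb0|exact: H1|exact: HA].
  rewrite powRM ?(ltW d20) ?powR_ge0// -powRrM.
  have -> : B * weight dl t = (dl / 2) `^ (1 - p) * A * (2 / dl * weight dl t).
    by rewrite /B !mulrA.
  rewrite mulrACA; apply: ler_wpM2l; first by rewrite mulr_ge0// powR_ge0.
  rewrite -powRD; last by apply/implyP => _; rewrite gt_eqF.
  apply: (@le_trans _ _ (x `^ (- (1 + dl)))).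
    apply: ler_powR => //.
    have dlE : dl * (4 * p) = 1 - eps * p by rewrite /dl; field; rewrite gt_eqF.
    have h1 : 0 <= (dl * eps) * p := mulr_ge0 (mulr_ge0 (ltW d0) (ltW eps0)) (ltW p0).
    have h2 : 0 <= dl * (p - 1) by apply: mulr_ge0; [exact: ltW|rewrite subr_ge0].
    have h3 := eps_p.
    lra.
  rewrite mulrAC -[leLHS]mul1r ler_pdivlMr//.
  by move: Wg; rewrite mulrAC ler_pdivrMr//; lra.
apply: (@le_lt_trans _ _ (\sum_(0 <= t <oo) B%:E * (weight dl t)%:E)%E).
  apply: lee_nneseries => t _; first by rewrite lee_fin mulr_ge0 ?powR_ge0.
  by rewrite -EFinM lee_fin.
have W0 t : 0 <= weight dl t by exact/ltW/weight_gt0.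
rewrite nneseriesZl; last by move=> t _; rewrite lee_fin.
apply: (@le_lt_trans _ _ (B%:E * 1%:E)%E); last by rewrite mule1 ltry.
apply: lee_wpmul2l; first by rewrite lee_fin.
apply: lime_le; first by apply: is_cvg_nneseries => t _ _; rewrite lee_fin.
by apply: nearW => N; rewrite sumEFin lee_fin sum_weight_le.
Qed.

End moment_series.
End power_weights.

(** * From the order of the pivots to their times *)

Section search_process.
Context {R : realType}.
Variables (u : nat -> R) (q : pred nat) (step : nat -> R * R -> R * R).

Definition inside (V : R * R) (x : R) : bool := V.1 < x < V.2.

Hypothesis step_sub : forall t V x, inside V (u t) ->
  inside (step t V) x -> inside V x /\ x != u t.

Fixpoint by_pivot (k : nat) : R * R :=
  if k is j.+1 then
    if first_index (fun i => q i && inside (by_pivot j) (u i)) is Some t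
    then step t (by_pivot j) else by_pivot j
  else (0, 1).

Fixpoint by_time (t : nat) : R * R :=
  if t is s.+1 then
    if q s && inside (by_time s) (u s) then step s (by_time s) else by_time s
  else (0, 1).

Variable G : nat -> R * R -> \bar R.
Hypothesis G0 : forall t V, (0 <= G t V)%E.

Definition pivot_cost k : \bar R :=
  if first_index (fun i => q i && inside (by_pivot k) (u i)) is Some t
  then G t (by_pivot k) else 0%E.

Definition time_cost t : \bar R :=
  if q t && inside (by_time t) (u t) then G t (by_time t) else 0%E.

Lemma pivot_cost_ge0 k : (0 <= pivot_cost k)%E.
Proof. by rewrite /pivot_cost; case: first_index => [t|]. Qed.

Lemma time_cost_ge0 t : (0 <= time_cost t)%E.
Proof. by rewrite /time_cost; case: ifP. Qed.

Lemma first_indexP (Q : pred nat) :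
  if first_index Q is Some t then Q t /\ forall i, (i < t)%N -> ~~ Q i
  else forall i, ~~ Q i.
Proof.
rewrite /first_index; case: pselect => [ex|noex].
  case: ex_minnP => t Qt tmin; split=> // i it.
  by apply/negP => /tmin; rewrite leqNgt it.
by move=> i; apply/negP => Qi; apply: noex; exists i.
Qed.

Lemma idle_by_time s t : (s <= t)%N ->
  (forall i, (s <= i < t)%N -> ~~ (q i && inside (by_time s) (u i))) ->
  by_time t = by_time s /\
  (\sum_(0 <= i < t) time_cost i = \sum_(0 <= i < s) time_cost i)%E.
Proof.
elim: t => [|t IH]; first by rewrite leqn0 => /eqP ->.
rewrite leq_eqVlt => /orP[/eqP -> //|]; rewrite ltnS => st idle.
have [|Vt St] := IH st.
  by move=> i /andP[si it]; apply: idle; rewrite si ltnW.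
have nt : ~~ (q t && inside (by_time s) (u t)) by apply: idle; rewrite st ltnSn.
rewrite /= Vt (negbTE nt); split=> //.
by rewrite big_nat_recr//= St /time_cost Vt (negbTE nt) adde0.
Qed.

(** The witness [s] is the time right after the last of the first [k] pivots. By [step_sub], no
    admissible seed before [s] lies in the interval any more, so the first admissible index inside
    it is also the next time at which the scan moves. The last clause says that [s] grows with [k]
    unless the search has ended. *)
Lemma by_pivot_by_time k : exists s, [/\ by_pivot k = by_time s,
  (\sum_(0 <= i < k) pivot_cost i = \sum_(0 <= t < s) time_cost t)%E,
  (forall i, (i < s)%N -> ~~ inside (by_time s) (u i) || ~~ q i) &
  (k <= s)%N \/ (forall t, (s <= t)%N -> time_cost t = 0%E)].
Proof.
elim: k => [|k [s [Vs Ss out late]]].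
  by exists 0%N; split=> //; [rewrite !big_nil|left].
have := first_indexP (fun i => q i && inside (by_pivot k) (u i)).
rewrite big_nat_recr//= Ss /pivot_cost.
case: first_index => [t [/andP[qt It] tmin]|none]; last first.
  have idle t : (s <= t)%N -> by_time t = by_time s.
    move=> st; apply: (idle_by_time st _).1 => i _; rewrite -Vs; exact: none.
  exists s; rewrite adde0; split=> //; right=> t st.
  by rewrite /time_cost idle// -Vs (negbTE (none t)).
have st : (s <= t)%N.
  rewrite leqNgt; apply/negP => ts; have := out t ts.
  by rewrite -Vs It qt.
have [Vt St] : by_time t = by_time s /\
    (\sum_(0 <= i < t) time_cost i = \sum_(0 <= i < s) time_cost i)%E.
  by apply: idle_by_time => // i /andP[_ it]; rewrite -Vs; exact: tmin.
have Vt1 : by_time t.+1 = step t (by_time s) by rewrite /= Vt -Vs qt It.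
exists t.+1; split.
- by rewrite Vt1 Vs.
- by rewrite big_nat_recr//= St /time_cost Vt -Vs qt It.
- move=> i; rewrite ltnS => it; rewrite Vt1 -Vs.
  case: (boolP (inside (step t (by_pivot k)) (u i))) => //= Ii.
  have [Ii' iNt] := step_sub It Ii.
  move: it; rewrite leq_eqVlt => /orP[/eqP E|/tmin]; first by rewrite E eqxx in iNt.
  by rewrite Ii' andbT.
- case: late => [ks|late]; first by left; rewrite ltnS (leq_trans ks).
  by right => i ti; apply: late; apply: leq_trans st (ltnW ti).
Qed.

Lemma search_sum :
  (\sum_(0 <= k <oo) pivot_cost k = \sum_(0 <= t <oo) time_cost t)%E.
Proof.
apply/eqP; rewrite eq_le; apply/andP; split.
  apply: lime_le.
    by apply: is_cvg_nneseries => k _ _; exact: pivot_cost_ge0.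
  apply: nearW => k; have [s [_ -> _ _]] := by_pivot_by_time k.
  by apply: nneseries_lim_ge => t _ _; exact: time_cost_ge0.
apply: lime_le.
  by apply: is_cvg_nneseries => k _ _; exact: time_cost_ge0.
(* As many pivots as times are taken: [t] pivots use up at least [t] times, unless the search ends
   earlier and all later costs vanish. *)
apply: nearW => t; have [s [_ Ss _ late]] := by_pivot_by_time t.
have le_s : (\sum_(0 <= i < t) time_cost i <= \sum_(0 <= i < s) time_cost i)%E.
  have [ts|st] := leqP t s.
    rewrite (big_cat_nat _ ts)//=; apply: leeDl.
    by apply: sume_ge0 => i _; exact: time_cost_ge0.
  case: late => [|late]; first by rewrite leqNgt st.
  rewrite (big_cat_nat _ (ltnW st))//= [X in (_ + X)%E]big1_seq ?adde0// => i.
  by rewrite mem_index_iota => /andP[_ /andP[si _]]; exact: late.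
apply: le_trans le_s _; rewrite -Ss.
by apply: nneseries_lim_ge => k _ _; exact: pivot_cost_ge0.
Qed.

Lemma nneseries_from1 (f : nat -> \bar R) : (forall k, (0 <= f k)%E) ->
  (\sum_(1 <= k <oo) f k = \sum_(0 <= k <oo) f k.+1)%E.
Proof.
by move=> f0; rewrite -nneseries_addn//; apply: eq_eseriesr => k _; rewrite addn1.
Qed.

(* Comparison with [survives]: the seeds below and above the target are
   separated, by monotonicity of [lo] and [hi] in the seed. *)
Section closed_form.
Variables (lo hi : nat -> bool).
Hypotheses (lo_down : forall i j, lo j -> u i <= u j -> lo i)
  (hi_up : forall i j, hi j -> u j <= u i -> hi i)
  (u01 : forall i, 0 < u i < 1)
  (step_inside : forall t V x, inside V (u t) ->
     inside (step t V) x = inside V x && (lo t && (u t < x) || hi t && (x < u t))).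

Lemma survivesS t x : survives lo hi u t.+1 x =
  survives lo hi u t x && (lo t && (u t < x) || hi t && (x < u t)).
Proof. by rewrite /survives -addn1 iotaD all_cat/= andbT andbA. Qed.

Lemma inside_by_time t x : (forall i, (i < t)%N -> q i) ->
  inside (by_time t) x = survives lo hi u t x.
Proof.
elim: t x => [|t IH] x qt; first by rewrite /survives /= andbT.
have qs i : (i < t)%N -> q i by move=> it; apply: qt; exact: ltnW.
rewrite survivesS /= qt//=; case: ifP => It.
  by rewrite step_inside// (IH x).
(* Seed [t] lies outside the interval, cut off by some earlier seed [j], whereas [x] survives [j].
   So seed [t] is not on the side of [j] where [x] lies, monotonicity passes the verdict of [j] on
   to seed [t], and [x] survives seed [t] as well. *)
rewrite (IH x)//; case: (boolP (survives lo hi u t x)) => //= /survivesP[x01 Sx].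
move: It; rewrite IH// => /negbT; rewrite /survives u01/= => /allPn[j].
rewrite mem_iota add0n => jt; rewrite negb_or !negb_and.
have := Sx j jt; case/orP => /andP[lj ujx].
  rewrite lj/= -leNgt => /andP[utj _].
  by rewrite (lo_down lj utj) (le_lt_trans utj ujx).
rewrite lj/= -!leNgt => /andP[_ utj].
by rewrite (hi_up lj utj) (lt_le_trans ujx utj) orbT.
Qed.
End closed_form.

End search_process.

Lemma by_pivot_bounds (R : realType) (u : nat -> R) q step :
  (forall t V, inside V (u t) -> 0 <= V.1 -> V.2 <= 1 ->
     0 <= (step t V).1 /\ (step t V).2 <= 1) ->
  forall k, 0 <= (by_pivot u q step k).1 /\ (by_pivot u q step k).2 <= 1.
Proof.
move=> step_bd; elim=> [|k [l0 r1]] //=.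
have := first_indexP (fun i => q i && inside (by_pivot u q step k) (u i)).
by case: first_index => [t [/andP[_ It] _]|_] //; exact: step_bd.
Qed.

(** * The limiting search and QuickSelect as search processes *)

Section instances.
Context {R : realType}.
Variable beta : R -> R -> R.
Hypothesis beta_cost : cost_function beta.
Local Notation nu := (unif R).
Implicit Types (u : nat -> R) (V : R * R).

(* [beta] cut off outside the unit square, where it is unconstrained. *)
Definition unit_kernel (x v : R) : R :=
  if (0 < x < 1) && (0 < v < 1) then beta x v else 0.

(** On the diagonal the tame bound reads 0, since [powR] sends zero to zero for a nonzero exponent;
    with the diagonal set to 0 it holds everywhere. Almost surely no cost changes: the seeds are
    distinct, and a single point is null for the integral. *)
Definition offdiag_kernel (x v : R) : R := if x == v then 0 else unit_kernel x v.

Lemma measurable_unit_kernel :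
  measurable_fun setT (fun z : R * R => unit_kernel z.1 z.2).
Proof.
have [mbeta _ _] := beta_cost.
have mQ : measurable ((`]0, 1[ : set R) `*` (`]0, 1[ : set R)).
  by apply: measurableX; exact: measurable_itv.
rewrite (_ : (fun z => _) = (fun z : R * R => beta z.1 z.2) \_ (`]0, 1[ `*` `]0, 1[)).
  exact/(measurable_restrictT _ mQ).
apply/funext => z; rewrite /unit_kernel patchE; case: ifPn => z01.
  by rewrite mem_set//; move/andP: z01 => [z1 z2]; split; rewrite /= in_itv.
rewrite memNset// => -[]; rewrite /= !in_itv/= => z1 z2.
by move: z01; rewrite z1 z2.
Qed.

Lemma measurable_offdiag_kernel :
  measurable_fun setT (fun z : R * R => offdiag_kernel z.1 z.2).
Proof.
apply: measurable_fun_ifT; first exact: measurable_fun_eqr.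
  exact: measurable_cst.
exact: measurable_unit_kernel.
Qed.

Lemma unit_kernel_ge0 x v : 0 <= unit_kernel x v.
Proof.
have [_ beta0 _] := beta_cost.
by rewrite /unit_kernel; case: ifP => // /andP[x01 v01]; exact: beta0.
Qed.

Lemma offdiag_kernel_ge0 x v : 0 <= offdiag_kernel x v.
Proof. by rewrite /offdiag_kernel; case: ifP => // _; exact: unit_kernel_ge0. Qed.

Lemma offdiag_kernel_supp x v :
  ~~ ((0 < x < 1) && (0 < v < 1)) -> offdiag_kernel x v = 0.
Proof. by move=> /negbTE xv; rewrite /offdiag_kernel /unit_kernel xv if_same. Qed.

Lemma offdiag_kernel_sing (c eps : R) : 0 < c ->
  (forall u t : R, 0 < u -> u < t -> t < 1 -> beta u t <= c * (t - u) `^ (- eps)) ->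
  forall x v, offdiag_kernel x v <= c * `|x - v| `^ (- eps).
Proof.
move=> c0 tame_c x v; have [_ _ sym] := beta_cost.
have rhs0 : 0 <= c * `|x - v| `^ (- eps) by rewrite mulr_ge0 ?powR_ge0// ltW.
rewrite /offdiag_kernel /unit_kernel; case: eqVneq => // xv.
case: ifP => // /andP[x01 v01]; move: (x01) (v01) => /andP[x0 x1] /andP[v0 v1].
have [xlv|vlx] := ltP x v.
  by rewrite distrC (ger0_norm (_ : 0 <= v - x)) ?subr_ge0 ?(ltW xlv)//; exact: tame_c.
rewrite (ger0_norm (_ : 0 <= x - v)) ?subr_ge0// sym//; apply: tame_c => //.
by rewrite lt_neqAle eq_sym xv vlx.
Qed.

Section val.
Variable alpha : R.

Definition val_step (u : nat -> R) t (V : R * R) : R * R :=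
  ((u t < alpha)%R%:R * u t + (alpha < u t)%R%:R * V.1,
   (u t < alpha)%R%:R * V.2 + (alpha < u t)%R%:R * u t).

Lemma val_step_inside u t V x : inside V (u t) -> inside (val_step u t V) x =
  inside V x && (val_lo alpha u t && (u t < x) || val_hi alpha u t && (x < u t)).
Proof.
rewrite /inside /val_step /val_lo /val_hi /= => /andP[lu ur].
case: (ltgtP (u t) alpha) => _; rewrite /= ?mul1r ?mul0r ?addr0 ?add0r ?orbF ?andbF.
- apply/andP/andP => [[ux xr]|[/andP[_ xr] ux]]; last by [].
  by split=> //; rewrite (lt_trans lu ux) xr.
- apply/andP/andP => [[lx xu]|[/andP[lx _] xu]]; last by [].
  by split=> //; rewrite lx (lt_trans xu ur).
(* For [u t = alpha] both indicators vanish and the interval collapses to [(0, 0)]. *)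
- by apply/negP => /andP[x0 x0']; have := lt_trans x0 x0'; rewrite ltxx.
Qed.

Lemma val_step_bounds u t V : inside V (u t) -> 0 <= V.1 -> V.2 <= 1 ->
  0 <= (val_step u t V).1 /\ (val_step u t V).2 <= 1.
Proof.
rewrite /inside /val_step /= => /andP[lu ur] l0 r1.
case: (ltgtP (u t) alpha) => _; rewrite /= ?mul1r ?mul0r ?addr0 ?add0r.
- by split=> //; exact: le_trans l0 (ltW lu).
- by split=> //; exact: le_trans (ltW ur) r1.
- by split=> //; exact: ler01.
Qed.

Lemma LR_by_pivot u k : LR alpha u k = by_pivot u xpredT (val_step u) k.
Proof. by elim: k => //= k ->. Qed.

(** An indicator under a fixed measure replaces the varying domain of integration, which makes the
    cost nonnegative for every [V] and measurable in [V] by Tonelli's theorem. *)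
Definition val_cost (u : nat -> R) t (V : R * R) : \bar R :=
  (\int[nu]_x ((inside V x)%:R * unit_kernel x (u t))%:E)%E.

Lemma val_cost_ge0 u t V : (0 <= val_cost u t V)%E.
Proof. by apply: integral_ge0 => x _; rewrite lee_fin mulr_ge0// unit_kernel_ge0. Qed.

Lemma measurable_inside (V : R * R) : measurable_fun setT (inside V).
Proof. by rewrite /inside; measurability. Qed.

Lemma val_costE u t V : inside V (u t) -> 0 <= V.1 -> V.2 <= 1 ->
  val_cost u t V =
  (\int[lebesgue_measure]_(x in `]V.1, V.2[) (beta x (u t))%:E)%E.
Proof.
rewrite /inside => /andP[lu ur] l0 r1.
have f0 x : (0 <= ((inside V x)%:R * unit_kernel x (u t))%:E)%E.
  by rewrite lee_fin mulr_ge0// unit_kernel_ge0.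
have mf : measurable_fun setT (fun x => ((inside V x)%:R * unit_kernel x (u t))%:E).
  apply/measurable_EFinP; apply: measurable_funM.
    by apply: measurable_fun_natr_bool; exact: measurable_inside.
  by apply: (measurable_kernel_comp measurable_unit_kernel).
rewrite /val_cost integral_unif// integral_mkcond [RHS]integral_mkcond.
apply: eq_integral => x _; rewrite !patchE.
case: (boolP (x \in `]V.1, V.2[%classic)) => [|xV].
  rewrite inE/= in_itv/= => /andP[lx xr].
  have x01 : x \in `[0, 1]%classic.
    by rewrite inE/= in_itv/=; apply/andP; split; apply/ltW; [exact: le_lt_trans lx|exact: lt_le_trans r1].
  rewrite x01 /inside lx xr mul1r /unit_kernel.
  by rewrite (le_lt_trans l0 lx) (lt_le_trans xr r1) (le_lt_trans l0 lu) (lt_le_trans ur r1).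
have -> : inside V x = false.
  by apply/negP => Ix; move/negP: xV; apply; rewrite mem_set//= in_itv.
by rewrite mul0r; case: ifP.
Qed.

Lemma val_step_sub u t V x : inside V (u t) ->
  inside (val_step u t V) x -> inside V x /\ x != u t.
Proof.
move=> It; rewrite val_step_inside// => /andP[Ix H]; split=> //.
apply: contraTneq H => ->; by rewrite !ltxx !andbF.
Qed.

Lemma S_limit_by_time u : S_limit alpha beta u =
  (\sum_(0 <= t <oo) time_cost u xpredT (val_step u) (val_cost u) t)%E.
Proof.
rewrite -search_sum; [|exact: val_step_sub|exact: val_cost_ge0].
have E k : I_term alpha beta u k.+1 = pivot_cost u xpredT (val_step u) (val_cost u) k.
  rewrite /I_term /tau /= /tau_of LR_by_pivot /pivot_cost.
  have := first_indexP (fun i => xpredT i && inside (by_pivot u xpredT (val_step u) k) (u i)).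
  have [l0 r1] := @by_pivot_bounds _ u xpredT (val_step u) (@val_step_bounds u) k.
  rewrite /inside /=.
  by case: first_index => [t [It _]|//]; rewrite val_costE.
rewrite /S_limit nneseries_from1; first by apply: eq_eseriesr => k _; exact: E.
(* At index 0, [0.-1] is [0], so this term repeats the one of index 1 and is nonnegative as well. *)
case=> [|k]; last by rewrite E; apply: pivot_cost_ge0; exact: val_cost_ge0.
rewrite /I_term /tau /=.
have -> : tau_of u (LR alpha u 0) = tau alpha u 1 by [].
have := E 0%N; rewrite /I_term /=; case: (tau alpha u 1) => // t ->.
by apply: pivot_cost_ge0; exact: val_cost_ge0.
Qed.

End val.

Section quant.
Variables (n m : nat).

Definition quant_step (u : nat -> R) t (V : R * R) : R * R :=
  let r := rank_below n u (u t) in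
  ((r <= m)%N%:R * u t + (m < r)%N%:R * V.1,
   (m <= r)%N%:R * u t + (r < m)%N%:R * V.2).

Lemma quant_step_inside u t V x : inside V (u t) -> inside (quant_step u t V) x =
  inside V x && (quant_lo n m u t && (u t < x) || quant_hi n m u t && (x < u t)).
Proof.
rewrite /inside /quant_step /quant_lo /quant_hi /= => /andP[lu ur].
case: (ltngtP (rank_below n u (u t)) m) => _;
  rewrite /= ?mul1r ?mul0r ?addr0 ?add0r ?orbF ?andbF.
- apply/andP/andP => [[ux xr]|[/andP[_ xr] ux]]; last by [].
  by split=> //; rewrite (lt_trans lu ux) xr.
- apply/andP/andP => [[lx xu]|[/andP[lx _] xu]]; last by [].
  by split=> //; rewrite lx (lt_trans xu ur).
- by apply/negP => /andP[x0 x0']; have := lt_trans x0 x0'; rewrite ltxx.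
Qed.

Lemma quant_step_bounds u t V : inside V (u t) -> 0 <= V.1 -> V.2 <= 1 ->
  0 <= (quant_step u t V).1 /\ (quant_step u t V).2 <= 1.
Proof.
rewrite /inside /quant_step /= => /andP[lu ur] l0 r1.
have u0 := le_trans l0 (ltW lu); have u1 := le_trans (ltW ur) r1.
by case: (ltngtP (rank_below n u (u t)) m) => _;
  rewrite /= ?mul1r ?mul0r ?addr0 ?add0r.
Qed.

Lemma seed_rankE u t : seed_rank n u t = rank_below n u (u t).
Proof.
rewrite /seed_rank /rank_below big_mkord -sum1_card big_mkcond/=.
by apply: eq_bigr => i _; rewrite inE; case: (_ <= _).
Qed.

Lemma LRQ_by_pivot u k :
  LRQ n m u k = by_pivot u (fun i => (i < n)%N) (quant_step u) k.
Proof.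
elim: k => //= k ->; rewrite /tauQ_of /inside.
by case: first_index => // t; rewrite /quant_step seed_rankE.
Qed.

Definition quant_cost (u : nat -> R) t (V : R * R) : R :=
  \sum_(t.+1 <= i < n | inside V (u i)) unit_kernel (u i) (u t).

Lemma quant_cost_ge0 u t V : (0 <= (quant_cost u t V)%:E)%E.
Proof. by rewrite lee_fin; apply: sumr_ge0 => i _; exact: unit_kernel_ge0. Qed.

Lemma quant_step_sub u t V x : inside V (u t) ->
  inside (quant_step u t V) x -> inside V x /\ x != u t.
Proof.
move=> It; rewrite quant_step_inside// => /andP[Ix H]; split=> //.
apply: contraTneq H => ->; by rewrite !ltxx !andbF.
Qed.

Lemma SQ_by_time u : SQ beta n m u =
  (\sum_(0 <= t <oo) time_cost u (fun i => (i < n)%N) (quant_step u)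
     (fun t V => (quant_cost u t V)%:E) t)%E.
Proof.
rewrite -search_sum; [|exact: quant_step_sub|exact: quant_cost_ge0].
pose V k := by_pivot u (fun i => (i < n)%N) (quant_step u) k.
have E k : (SQ_term beta n m u k.+1)%:E = pivot_cost u (fun i => (i < n)%N) (quant_step u)
    (fun t V => (quant_cost u t V)%:E) k.
  rewrite /SQ_term /tauQ /= /tauQ_of LRQ_by_pivot /pivot_cost.
  have := first_indexP (fun i => (i < n)%N && inside (V k) (u i)).
  have [l0 r1] := @by_pivot_bounds _ u (fun i => (i < n)%N) (quant_step u) (@quant_step_bounds u) k.
  rewrite -/(V k) /inside /= in l0 r1 *.
  case: first_index => [t [/andP[_ /andP[lu ur]] _]|//]; congr (_%:E).
  apply: eq_bigr => i /andP[lx xr]; rewrite /unit_kernel.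
  by rewrite (le_lt_trans l0 lx) (lt_le_trans xr r1) (le_lt_trans l0 lu) (lt_le_trans ur r1).
rewrite /SQ nneseries_from1; first by apply: eq_eseriesr => k _; exact: E.
case=> [|k]; last by rewrite E; apply: pivot_cost_ge0; exact: quant_cost_ge0.
have -> : SQ_term beta n m u 0 = SQ_term beta n m u 1 by [].
by rewrite E; apply: pivot_cost_ge0; exact: quant_cost_ge0.
Qed.

End quant.
End instances.

(** * Generic seeds, measurability and closed forms of the costs *)

Section almost_surely.
Context {R : realType} (mu : probability (seeds R) R).
Hypothesis iid_mu : iid (unif R) mu.

Definition generic_seeds (u : nat -> R) :=
  (forall i, 0 < u i < 1) /\ (forall i j, i != j -> u i != u j).

Lemma ae_not (f : seeds R -> bool) : measurable_fun setT f ->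
  (\int[mu]_u ((f u)%:R : R)%:E = 0)%E -> {ae mu, forall u, ~~ f u}.
Proof.
move=> mf; rewrite int_natr_bool// => f0.
exists [set u | f u]; split=> //.
  by rewrite -[X in measurable X]setTI; exact: (mf measurableT [set true]).
by move=> u /=; case: (f u) => //= H; exfalso; exact: H.
Qed.

(** For distinctness, a fresh draw of seed [i] hits the value of seed [j] with probability 0, the
    uniform law having no atoms. *)
Lemma ae_generic_seeds : {ae mu, forall u, generic_seeds u}.
Proof.
have H1 : {ae mu, forall u, forall i, 0 < u i < 1}.
  apply: ae_foralln => i; have : {ae mu, forall u, ~~ ~~ (0 < (u : seeds R) i < 1)}.
    apply: ae_not; first by measurability.
    rewrite (@integral_one_seed _ _ iid_mu i (fun x => (~~ (0 < x < 1))%:R))//.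
      by rewrite integral_unif_outside// subr0 subrr.
    by apply: measurable_fun_natr_bool; measurability.
  by apply: filterS => u; rewrite negbK.
have H2 : {ae mu, forall u, forall i, forall j, i != j -> u i != u j}.
  apply: ae_foralln => i; apply: ae_foralln => j.
  have [->|ij] := eqVneq i j; first by apply: nearW => u; rewrite eqxx.
  have meq : measurable_fun setT (fun u : seeds R => u i == u j).
    by apply: measurable_fun_eqr; exact: measurable_seed.
  have : {ae mu, forall u : seeds R, ~~ (u i == u j)}.
    apply: ae_not => //.
    rewrite (integral_resampleC iid_mu i); last 2 first.
    - by apply/measurable_EFinP/measurable_fun_natr_bool.
    - by move=> u; rewrite lee_fin.
    rewrite (eq_integral (cst 0%E)) ?integral0// => u _.
    under eq_integral => x _ do rewrite updE updN 1?eq_sym//.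
    rewrite int_natr_bool; last by apply: measurable_fun_eqr => //; exact: measurable_cst.
    apply: etrans (unif_set1 (u j)); congr (unif R _).
    by apply/seteqP; split=> x /=; [move=> /eqP ->|move=> ->; rewrite eqxx].
  by apply: (@filterS _ _ (ae_filter_ringOfSetsType mu)) => u H _; exact: H.
apply: (@filterS2 _ _ (ae_filter_ringOfSetsType mu) _ _ _ _ H1 H2) => u.
by split.
Qed.

End almost_surely.

Section seeds_measurability.
Context {R : realType}.
Variable beta : R -> R -> R.
Hypothesis beta_cost : cost_function beta.
Local Notation nu := (unif R).
Local Notation b := (offdiag_kernel beta).

(** The scan by time has deterministic indices, so measurability passes through its recursion; the
    order of the pivots would bring in the random index of each pivot. *)
Lemma measurable_by_time (q : pred nat) (step : seeds R -> nat -> R * R -> R * R) :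
  (forall t (V : seeds R -> R * R), measurable_fun setT (fun u => (V u).1) ->
    measurable_fun setT (fun u => (V u).2) ->
    measurable_fun setT (fun u => (step u t (V u)).1) /\
    measurable_fun setT (fun u => (step u t (V u)).2)) ->
  forall t, measurable_fun setT (fun u : seeds R => (by_time u q (step u) t).1) /\
    measurable_fun setT (fun u : seeds R => (by_time u q (step u) t).2).
Proof.
move=> mstep; elim=> [|t [m1 m2]]; first by split; exact: measurable_cst.
pose V (u : seeds R) := by_time u q (step u) t.
have [s1 s2] := mstep t V m1 m2.
have mI : measurable_fun setT (fun u : seeds R => q t && inside (V u) (u t)).
  apply: measurable_and; first exact: measurable_cst.
  by apply: measurable_and; apply: measurable_fun_ltr => //; exact: measurable_seed.
split=> /=.
  rewrite (_ : (fun u => _) = fun u => if q t && inside (V u) (u t)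
    then (step u t (V u)).1 else (V u).1); first exact: measurable_fun_ifT.
  by apply/funext => u; rewrite /V; case: ifP.
rewrite (_ : (fun u => _) = fun u => if q t && inside (V u) (u t)
  then (step u t (V u)).2 else (V u).2); first exact: measurable_fun_ifT.
by apply/funext => u; rewrite /V; case: ifP.
Qed.

Lemma measurable_val_cost t (V : seeds R -> R * R) :
  measurable_fun setT (fun u => (V u).1) -> measurable_fun setT (fun u => (V u).2) ->
  measurable_fun setT (fun u : seeds R => val_cost beta u t (V u)).
Proof.
move=> m1 m2.
have f0 (z : seeds R * R) :
  (0 <= ((inside (V z.1) z.2)%:R * unit_kernel beta z.2 (z.1 t))%:E)%E.
  by rewrite lee_fin mulr_ge0// unit_kernel_ge0.
apply: (measurable_fun_fubini_tonelli_F (m2 := nu) _ _ f0).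
apply/measurable_EFinP; apply: measurable_funM.
  apply: measurable_fun_natr_bool; apply: measurable_and; apply: measurable_fun_ltr.
  - exact: (measurableT_comp m1 measurable_fst).
  - exact: measurable_snd.
  - exact: measurable_snd.
  - exact: (measurableT_comp m2 measurable_fst).
apply: (measurable_kernel_comp (measurable_unit_kernel beta_cost)); first exact: measurable_snd.
exact: (measurableT_comp (measurable_seed t) measurable_fst).
Qed.

Lemma measurable_S_limit alpha :
  measurable_fun setT (fun u : seeds R => S_limit alpha beta u).
Proof.
rewrite (_ : (fun u => _) = fun u : seeds R => (\sum_(0 <= t <oo)
    time_cost u xpredT (val_step alpha u) (val_cost beta u) t)%E); last first.
  by apply/funext => u; exact: S_limit_by_time.
apply: ge0_emeasurable_sum => [t u _ _|t _].
  by apply: time_cost_ge0; exact: val_cost_ge0.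
have mj k := @measurable_seed R k.
have [|m1 m2] := @measurable_by_time xpredT (fun u => val_step alpha u) _ t.
  by move=> k V mV1 mV2; split; rewrite /val_step /=; measurability.
apply: measurable_fun_ifT; last exact: measurable_cst.
  by apply: measurable_and; [|apply: measurable_and; apply: measurable_fun_ltr => //;
    exact: measurable_seed].
exact: measurable_val_cost.
Qed.

Lemma measurable_SQ n m :
  measurable_fun setT (fun u : seeds R => SQ beta n m u).
Proof.
rewrite (_ : (fun u => _) = fun u : seeds R => (\sum_(0 <= t <oo)
    time_cost u (fun i => (i < n)%N) (quant_step n m u)
      (fun t V => (quant_cost beta n u t V)%:E) t)%E); last first.
  by apply/funext => u; exact: SQ_by_time.
apply: ge0_emeasurable_sum => [t u _ _|t _].
  by apply: time_cost_ge0 => s V; exact: quant_cost_ge0.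
have mr s : measurable_fun setT (fun u : seeds R => rank_below n u (u s)).
  by apply: measurable_rank_below; [exact: measurable_id|exact: measurable_seed].
have [|m1 m2] := @measurable_by_time (fun i => (i < n)%N) (fun u => quant_step n m u) _ t.
  by move=> k V mV1 mV2; split; rewrite /quant_step /=; measurability; exact: mr.
apply: measurable_fun_ifT; last exact: measurable_cst.
  by apply: measurable_and; [|apply: measurable_and; apply: measurable_fun_ltr => //;
    exact: measurable_seed].
apply/measurable_EFinP; apply: measurable_sum_cond => i.
  by apply: measurable_and; apply: measurable_fun_ltr => //; exact: measurable_seed.
by apply: (measurable_kernel_comp (measurable_unit_kernel beta_cost)); exact: measurable_seed.
Qed.

Lemma measurable_val_part alpha t :
  measurable_fun setT (fun u : seeds R => val_part b alpha t u).
Proof.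
have m1 : measurable_fun setT (fun z : seeds R * R => z.1) by exact: measurable_fst.
have m2 : measurable_fun setT (fun z : seeds R * R => z.2) by exact: measurable_snd.
have f0 (z : seeds R * R) :
  (0 <= ((val_survives alpha z.1 t z.2)%:R * b z.2 (z.1 t))%:E)%E.
  by rewrite lee_fin mulr_ge0// offdiag_kernel_ge0.
apply: measurable_fun_ifT; last exact: measurable_cst.
  apply: measurable_val_survives; [exact: measurable_id|exact: measurable_seed].
apply: (measurableT_comp (fine_measurable measurableT)).
apply: (measurable_fun_fubini_tonelli_F (m2 := nu) _ _ f0).
apply/measurable_EFinP; apply: measurable_funM.
  by apply: measurable_fun_natr_bool; exact: measurable_val_survives.
apply: (measurable_kernel_comp (measurable_offdiag_kernel beta_cost)) => //.
exact: (measurableT_comp (measurable_seed t) measurable_fst).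
Qed.

Lemma SQ_generic n m u : generic_seeds u ->
  SQ beta n m u = (\sum_(0 <= t <oo) (quant_part b n m t u)%:E)%E.
Proof.
move=> [u01 u_inj]; rewrite SQ_by_time//; apply: eq_eseriesr => t _.
rewrite /time_cost; case: (ltnP t n) => [tn|nt] /=; last first.
  by rewrite /quant_part big_geq ?if_same// leqW.
have E x : inside (by_time u (fun i => (i < n)%N) (quant_step n m u) t) x =
    quant_survives n m u t x.
  apply: inside_by_time => // [i j loj uij|i j hij uji|s V y|i it].
  - exact: leq_ltn_trans (rank_below_le n u uij) loj.
  - exact: leq_trans hij (rank_below_le n u uji).
  - exact: quant_step_inside.
  - exact: ltn_trans tn.
rewrite E /quant_part; case: ifP => // _; congr (_%:E).
rewrite /quant_cost (eq_bigl _ _ (fun i => E (u i))) big_nat_cond [RHS]big_nat_cond.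
apply: eq_bigr => i /andP[/andP[ti _] _].
by rewrite /offdiag_kernel (negbTE (u_inj _ _ _))// gtn_eqF.
Qed.

Lemma S_limit_generic alpha (c eps : R) u : 0 < c -> 0 < eps -> eps < 1 ->
  (forall u t : R, 0 < u -> u < t -> t < 1 -> beta u t <= c * (t - u) `^ (- eps)) ->
  generic_seeds u ->
  S_limit alpha beta u = (\sum_(0 <= t <oo) (val_part b alpha t u)%:E)%E.
Proof.
move=> c0 eps0 eps1 tame_c [u01 u_inj]; rewrite S_limit_by_time//.
apply: eq_eseriesr => t _; rewrite /time_cost /=.
have E x : inside (by_time u xpredT (val_step alpha u) t) x = val_survives alpha u t x.
  apply: inside_by_time => // [i j loj uij|i j hij uji|s V y].
  - exact: le_lt_trans uij loj.
  - exact: lt_le_trans hij uji.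
  - exact: val_step_inside.
rewrite E /val_part; case: ifP => // _.
have mvs : measurable_fun setT (fun x => (val_survives alpha u t x)%:R : R).
  by apply: measurable_fun_natr_bool; exact: measurable_val_survives1.
have mk (k : R -> R -> R) : measurable_fun setT (fun z : R * R => k z.1 z.2) ->
    measurable_fun setT (fun x => ((val_survives alpha u t x)%:R * k x (u t))%:E).
  move=> mk; apply/measurable_EFinP; apply: measurable_funM => //.
  by apply: (measurable_kernel_comp mk).
have f0 x : (0 <= ((val_survives alpha u t x)%:R * b x (u t))%:E)%E.
  by rewrite lee_fin mulr_ge0// offdiag_kernel_ge0.
transitivity (\int[nu]_x ((val_survives alpha u t x)%:R * b x (u t))%:E)%E.
  rewrite /val_cost; apply: ge0_ae_eq_integral => //.
  - rewrite (_ : (fun x => _) = fun x =>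
      ((val_survives alpha u t x)%:R * unit_kernel beta x (u t))%:E).
      exact: (mk _ (measurable_unit_kernel beta_cost)).
    by apply/funext => x; rewrite E.
  - exact: (mk _ (measurable_offdiag_kernel beta_cost)).
  - by move=> x _; rewrite lee_fin mulr_ge0// unit_kernel_ge0.
  (* The two kernels differ only at [x = u t], a null set. *)
  exists [set u t]; split=> //; first exact: unif_set1.
  move=> x /= H; apply: contrapT => xut; apply: H => _.
  by rewrite E /offdiag_kernel; case: eqP.
rewrite fineK// ge0_fin_numE; last exact: integral_ge0.
(* The first moment of the kernel is finite because [eps < 1], so [fine] loses nothing. *)
have := @integral_kernel_powR R b c eps 1 (offdiag_kernel_ge0 beta_cost)
  (offdiag_kernel_sing beta_cost c0 tame_c) (@offdiag_kernel_supp _ beta) c0 eps0 (lexx 1).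
rewrite mulr1 => /(_ eps1 (u t)) H; apply: le_lt_trans (ltry (kernel_const c eps 1)).
apply: le_trans H; apply: le_int => // x.
rewrite lee_fin powRr1 ?offdiag_kernel_ge0//.
by rewrite ler_piMl ?offdiag_kernel_ge0//; case: (val_survives _ _ _ _); rewrite ?lexx ?ler01.
Qed.

End seeds_measurability.

(** * Convergence *)

Section convergence.
Context {R : realType} (mu : probability (seeds R) R).
Hypothesis iid_mu : iid (unif R) mu.
Variables (alpha : R) (m : nat -> nat) (beta : R -> R -> R) (p eps c : R).
Hypotheses (m_cvg : ((m n)%:R / n%:R : R) @[n --> \oo] --> alpha)
  (beta_cost : cost_function beta) (p1 : 1 <= p) (eps0 : 0 < eps)
  (eps_p : eps * p < 1) (c0 : 0 < c)
  (tame_c : forall u t : R, 0 < u -> u < t -> t < 1 ->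
     beta u t <= c * (t - u) `^ (- eps)).
Local Notation b := (offdiag_kernel beta).

Definition scaled_cost n (u : nat -> R) : \bar R := (SQ beta n (m n) u * (n%:R^-1)%:E)%E.

Let a n t (u : seeds R) : R := quant_part b n (m n) t u / n%:R.
Let s t (u : seeds R) : R := val_part b alpha t u.
Let w := weight (weight_exponent eps p).
Let C t := moment_bound c eps p t (window eps p t).

Let mb := measurable_offdiag_kernel beta_cost.
Let b0 := offdiag_kernel_ge0 beta_cost.
Let b_sing := offdiag_kernel_sing beta_cost c0 tame_c.
Let b_supp := @offdiag_kernel_supp _ beta.

Let eps1 : eps < 1.
Proof. by apply: le_lt_trans eps_p; rewrite ler_peMr// ltW. Qed.

Let p0 : 0 < p. Proof. exact: lt_le_trans p1. Qed.

Let w0 t : 0 < w t.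
Proof.
have [d0 d1] := weight_exponent_itv eps0 p1 eps_p.
by apply: weight_gt0 => //; lra.
Qed.

Let w1 N : \sum_(0 <= t < N) w t <= 1.
Proof. exact: sum_weight_le. Qed.

Let ma n t : measurable_fun setT (a n t).
Proof.
by apply: measurable_funM; [exact: measurable_quant_part|exact: measurable_cst].
Qed.

Let ms t : measurable_fun setT (s t).
Proof. exact: measurable_val_part. Qed.

Let a0 n t u : 0 <= a n t u.
Proof. by apply: mulr_ge0; rewrite ?invr_ge0 ?ler0n//; exact: quant_part_ge0. Qed.

Let s0 t u : 0 <= s t u.
Proof. exact: val_part_ge0. Qed.

Let a_fin n t u : (n <= t)%N -> a n t u = 0.
Proof. by move=> nt; rewrite /a /quant_part big_geq ?if_same ?mul0r// leqW. Qed.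

Let C0 t : 0 <= C t.
Proof.
have /andP[l0 _] := window_itv eps0 p1 eps_p t.
have K0 : 0 <= kernel_const c eps p by exact: kernel_const_ge0.
rewrite /C /moment_bound; apply: addr_ge0; apply: mulr_ge0.
- exact: mulr_ge0.
- exact: expR_ge0.
- exact: powR_ge0.
- exact: mulr_ge0 (mulr_ge0 K0 (powR_ge0 _ _)) (mulr_ge0 (ler0n _ 6) (ltW l0)).
Qed.

Let a_le n t : (\int[mu]_u (a n t u `^ p)%:E <= (C t)%:E)%E.
Proof.
(* Times beyond the sample contribute 0; this includes [n = 0]. *)
have [tn|nt] := ltnP t n.
  apply: moment_quant_part => //; first exact: window_itv.
  exact: window_ge.
rewrite (eq_integral (cst 0%E)) ?integral0 ?lee_fin// => u _.
by rewrite a_fin// powR0// gt_eqF.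
Qed.

Let a_cvg t e : 0 < e ->
  \forall n \near \oo, (\int[mu]_u (`|a n t u - s t u| `^ p)%:E <= e%:E)%E.
Proof. by move=> e0; exact: part_cvg. Qed.

Let C_sum := moment_series_lty c eps0 p1 eps_p.

Lemma scaled_cost_generic n u : generic_seeds u ->
  scaled_cost n u = (\sum_(0 <= t <oo) (a n t u)%:E)%E.
Proof.
move=> gu; rewrite /scaled_cost SQ_generic// muleC -nneseriesZl; last first.
  by move=> t _; rewrite lee_fin quant_part_ge0.
by apply: eq_eseriesr => t _; rewrite -EFinM mulrC.
Qed.

Lemma measurable_scaled_cost n : measurable_fun setT (fun u : seeds R => scaled_cost n u).
Proof.
by apply: emeasurable_funM; [exact: measurable_SQ|exact: measurable_cst].
Qed.

Lemma measurable_Lp_power (f : seeds R -> \bar R) : measurable_fun setT f ->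
  measurable_fun setT (fun u => `|f u| `^ p)%E.
Proof.
move=> mf; apply: (measurableT_comp (measurable_poweR p)).
exact: (measurableT_comp _ mf).
Qed.

Lemma integral_generic (f g : seeds R -> \bar R) :
  measurable_fun setT f -> measurable_fun setT g ->
  (forall u, generic_seeds u -> f u = g u) ->
  (\int[mu]_u `|f u| `^ p = \int[mu]_u `|g u| `^ p)%E.
Proof.
move=> mf mg fg; apply: ge0_ae_eq_integral => //.
- exact: measurable_Lp_power.
- exact: measurable_Lp_power.
- by move=> u _; exact: poweR_ge0.
- by move=> u _; exact: poweR_ge0.
apply: (@filterS _ _ (ae_filter_ringOfSetsType mu) _ _ _ (ae_generic_seeds iid_mu)).
by move=> u gu _; rewrite fg.
Qed.

Let mA n : measurable_fun setT (fun u : seeds R => \sum_(0 <= t <oo) (a n t u)%:E)%E.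
Proof.
apply: ge0_emeasurable_sum => [t u _ _|t _]; first by rewrite lee_fin.
exact/measurable_EFinP.
Qed.

Let mS : measurable_fun setT (fun u : seeds R => \sum_(0 <= t <oo) (s t u)%:E)%E.
Proof.
apply: ge0_emeasurable_sum => [t u _ _|t _]; first by rewrite lee_fin.
exact/measurable_EFinP.
Qed.

Let S_generic u : generic_seeds u ->
  S_limit alpha beta u = (\sum_(0 <= t <oo) (s t u)%:E)%E.
Proof. exact: (S_limit_generic beta_cost alpha c0 eps0 eps1 tame_c). Qed.

Lemma scaled_cost_lty n : (\int[mu]_u `|scaled_cost n u| `^ p < +oo)%E.
Proof.
rewrite (integral_generic (measurable_scaled_cost n) (mA n) (@scaled_cost_generic n)).
under eq_integral => u _.
  rewrite gee0_abs; last by apply: nneseries_ge0 => t _ _; rewrite lee_fin.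
  over.
apply: le_lt_trans C_sum.
exact: (integral_partial_sum_le p1 w0 w1 ma a0 a_le).
Qed.

Lemma S_limit_lty : (\int[mu]_u `|S_limit alpha beta u| `^ p < +oo)%E.
Proof.
rewrite (integral_generic (measurable_S_limit beta_cost alpha) mS S_generic).
under eq_integral => u _.
  rewrite gee0_abs; last by apply: nneseries_ge0 => t _ _; rewrite lee_fin.
  over.
exact: (integral_limit_sum_lty p1 w0 w1 ma ms a0 s0 C0 C_sum a_le a_cvg).
Qed.

Lemma scaled_cost_cvg :
  (\int[mu]_u `|scaled_cost n u - S_limit alpha beta u| `^ p)%E @[n --> \oo] --> 0%E.
Proof.
rewrite (_ : (fun n => _) = fun n => (\int[mu]_u
    `|\sum_(0 <= t <oo) (a n t u)%:E - \sum_(0 <= t <oo) (s t u)%:E| `^ p)%E).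
  exact: (cvg_sum_Lp p1 w0 w1 ma ms a0 s0 a_fin C0 C_sum a_le a_cvg).
apply/funext => n; apply: integral_generic.
- apply: emeasurable_funB; first exact: measurable_scaled_cost.
  exact: measurable_S_limit.
- exact: emeasurable_funB.
- by move=> u gu; rewrite scaled_cost_generic// S_generic.
Qed.

End convergence.

Theorem theorem4p1 (R : realType) (d : measure_display) (T : measurableType d)
    (P : probability T R) (U : nat -> {RV P >-> R})
    (alpha : R) (m : nat -> nat) (beta : R -> R -> R) (p eps : R)
    (U_uniform : forall i, uniform01 (U i))
    (U_indep : mutually_independent U)
    (alpha01 : 0 <= alpha <= 1)
    (m_range : forall n, (1 <= n)%N -> (1 <= m n <= n)%N)
    (m_cvg : ((m n)%:R / n%:R : R) @[n --> \oo] --> alpha)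
    (beta_cost : cost_function beta)
    (p_ge1 : 1 <= p)
    (eps_gt0 : 0 < eps)
    (eps_lt : eps < 1 / p)
    (beta_tame : tame eps beta) :
  cvg_in_Lp P p
    (fun n w => (SQ beta n (m n) (fun i => U i w) * (n%:R^-1)%:E)%E)
    (fun w => S_limit alpha beta (fun i => U i w)).
Proof.
have [c c0 tame_c] := beta_tame.
have p0 : 0 < p by exact: lt_le_trans p_ge1.
have eps_p : eps * p < 1 by rewrite -ltr_pdivlMr.
have iid_mu := iid_seed_law U_uniform U_indep.
have mseq := measurable_seed_seq U.
have mX n := measurable_scaled_cost m beta_cost n.
have mY := measurable_S_limit beta_cost alpha.
have E (f : seeds R -> \bar R) : measurable_fun setT f ->
    (\int[P]_w `|f (seed_seq U w)| `^ p = \int[seed_law U]_u `|f u| `^ p)%E.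
  move=> mf; rewrite integral_seed_law//; first exact: measurable_Lp_power.
  by move=> u; exact: poweR_ge0.
split.
- move=> n; split; first exact: (measurableT_comp (mX n) mseq).
  rewrite unlock; apply: poweR_lty; rewrite (E _ (mX n)).
  exact: (scaled_cost_lty iid_mu m beta_cost p_ge1 eps_gt0 eps_p c0 tame_c).
- split; first exact: (measurableT_comp mY mseq).
  rewrite unlock; apply: poweR_lty; rewrite (E _ mY).
  exact: (S_limit_lty iid_mu m_cvg beta_cost p_ge1 eps_gt0 eps_p c0 tame_c).
have mXY n : measurable_fun setT
    (fun u : seeds R => scaled_cost m beta n u - S_limit alpha beta u)%E.
  exact: emeasurable_funB.
have H := scaled_cost_cvg iid_mu m_cvg beta_cost p_ge1 eps_gt0 eps_p c0 tame_c.
apply: cvge0_near => [n|e e0]; first exact: Lnorm_ge0.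
(* The norm takes a [p]-th root, so the integral has to fall below the [p]-th power of [e]. *)
have ep0 : 0 < e `^ p by rewrite powR_gt0.
move/fine_cvgP : H => [Hfin /cvgrPdist_le /(_ _ ep0) Hcvg].
near=> n.
rewrite unlock (E _ (mXY n)).
have i0 : (0 <= \int[seed_law U]_u
    `|scaled_cost m beta n u - S_limit alpha beta u| `^ p)%E.
  by apply: integral_ge0 => u _; exact: poweR_ge0.
apply: poweR_le_EFin => //; rewrite ?invr_gt0 ?invrK ?(ltW e0)//.
have fin : (\int[seed_law U]_u
    `|scaled_cost m beta n u - S_limit alpha beta u| `^ p)%E \is a fin_num.
  by near: n.
rewrite -(fineK fin) lee_fin.
have : `|0 - fine (\int[seed_law U]_u
    `|scaled_cost m beta n u - S_limit alpha beta u| `^ p)%E| <= e `^ p by near: n.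
by rewrite sub0r normrN ger0_norm// fine_ge0.
Unshelve. all: by end_near.
Qed.
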